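(* Consider weighted scale-free percolation $\mathrm{SFP}_{W,L}$ on $\mathbb{Z}^d$ with parameters $\lambda>0$, $\alpha>d$, vertex-weight distribution $W$ with $\mathbb{P}(W>t)=\ell(t)/t^{\tau-1}$ for some $\tau>1$ and $\ell$ slowly varying at infinity, $\gamma:=\alpha(\tau-1)/d\in(1,2)$, and edge-weight distribution $L$ with $\mathbf{I}(L)<\infty$. For $x\in\mathbb{Z}^d$ let $V_x$ be the explosion time of $x$. Then, as $\|x\|\to\infty$, $$(V_0,V_x)\to(V^{(1)},V^{(2)})\qquad\text{in distribution,}$$ where $V^{(1)},V^{(2)}$ are two independent copies of the explosion time $V_0$. Further, for all $\varepsilon>0$, $$\lim_{\|x\|\to\infty}\mathbb{P}\big(\mathrm{d}_L(0,x)-(V_0+V_x)<-\varepsilon\big)=0.$$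
   Context: Scale-free percolation model. Fix $d\ge1$, $\alpha>d$ and $\lambda>0$. Each $x\in\mathbb{Z}^d$ gets an i.i.d. vertex-weight $W_x$ distributed as $W$, where $\mathbb{P}(W\ge1)=1$ and $\mathbb{P}(W>t)=\ell(t)/t^{\tau-1}$, with $\tau>1$ and $\ell$ slowly varying at infinity. Conditionally on $(W_x)_{x\in\mathbb{Z}^d}$, edges are present independently: each pair $x,y$ with $\|x-y\|=1$ (Euclidean norm) is always connected by an edge, and each pair with $\|x-y\|>1$ is connected with probability $1-\exp\{-\lambda W_xW_y/\|x-y\|^\alpha\}$. Then every present edge $e$ is given an i.i.d. edge-weight $L_e\ge0$ distributed as $L$, independent of everything else; the resulting weighted graph is $\mathrm{SFP}_{W,L}$. Set $\gamma:=\alpha(\tau-1)/d$. $\mathrm{d}_L(x,y)$ is the infimum over paths $\pi$ from $x$ to $y$ of $\sum_{e\in\pi}L_e$; $\mathrm{d}_G$ is the graph distance; $B_n^G(x)=\{y:\mathrm{d}_G(x,y)\le n\}$; $\Delta B_n^G(x)=B_n^G(x)\setminus B_{n-1}^G(x)$. $F_L(t)=\mathbb{P}(L\le t)$, $F_L^{(-1)}(y)=\inf\{t\in\mathbb{R}:F_L(t)\ge y\}$, and $\mathbf{I}(L):=\int_0^\infty F_L^{(-1)}(\exp\{-e^{y}\})\,dy$. Explosion time: $V_x$ is the almost sure limit, as $n\to\infty$, of $M_n(x):=\inf\{\mathrm{d}_L(x,y):y\in\Delta B_n^G(x)\}$ (equivalently of $\inf\{t:|\{y:\mathrm{d}_L(x,y)\le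 t\}|\ge n\}$). In the setting of the claim ($\gamma\in(1,2)$, $\mathbf{I}(L)<\infty$) this limit exists and is almost surely finite. *)

(* Defs.v *)
From HB Require Import structures.
From mathcomp Require Import all_boot all_order all_algebra finmap.
From mathcomp Require Import all_classical all_reals all_analysis.
Set Implicit Arguments.
Unset Strict Implicit.
Unset Printing Implicit Defensive.
Import Order.TTheory GRing.Theory Num.Theory.
Import numFieldNormedType.Exports.
Local Open Scope classical_set_scope.
Local Open Scope ring_scope.

Section lattice.
Context {R : realType} {d : nat}.

Definition enorm (x : 'rV[int]_d) : R :=
  Num.sqrt (\sum_(i < d) (x ord0 i)%:~R ^+ 2).

Definition enorm_infty : set_system 'rV[int]_d :=
  [set S | exists r : R, forall x, r < enorm x -> S x].

#[global] Instance enorm_infty_filter : Filter enorm_infty.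
Proof.
split=> [|A B [r rA] [s sB]|A B AB [r rA]].
- by exists 0.
- exists (Num.max r s) => x; rewrite gt_max => /andP[rx sx].
  by split; [exact: rA|exact: sB].
- by exists r => x rx; apply: AB; exact: rA.
Qed.

End lattice.
Arguments enorm_infty : clear implicits.

Section laws_on_the_line.
Context {R : realType}.

Definition slowly_varying (l : R -> R) : Prop :=
  [/\ measurable_fun (`]0, +oo[ : set R) l,
      forall t, 0 < t -> 0 < l t &
      forall c, 0 < c -> l (c * t) / l t @[t --> +oo] --> (1 : R)].

Definition quantile (mu : probability R R) (y : R) : R :=
  inf [set t : R | (y%:E <= mu `]-oo, t]%classic)%E].

(* The integral is taken in [0, +oo]: the integrand is nonnegative whenever mu
   is carried by [0, +oo[. *)
Definition explosion_integral (mu : probability R R) : \bar R :=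
  (\int[lebesgue_measure]_(y in `]0%R, +oo[%classic)
     (quantile mu (expR (- expR y)))%:E)%E.

End laws_on_the_line.

Section probability_notions.
Context {R : realType} {disp : measure_display} {Omega : measurableType disp}.
Variable P : probability Omega R.

Definition has_law {disp' : measure_display} {T : measurableType disp'}
    (X : Omega -> T) (mu : set T -> \bar R) : Prop :=
  forall A, measurable A -> P (X @^-1` A) = mu A.

Definition sigma_family {disp' : measure_display} {T : measurableType disp'}
    {I : Type} (D : set I) (X : I -> Omega -> T) : set_system Omega :=
  <<s \bigcup_(i in D) g_sigma_algebra_preimage (X i) >>.

Definition independent (G H : set_system Omega) : Prop :=
  forall A B, G A -> H B -> P (A `&` B) = (P A * P B)%E.

Definition mutually_independent {I : choiceType} (D : set I)
    (G : I -> set_system Omega) : Prop :=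
  forall (J : {fset I}) (A : I -> set Omega),
    (forall i, i \in J -> D i /\ G i (A i)) ->
    P (\bigcap_(i in [set` J]) A i) = (\prod_(i <- J) P (A i))%E.

Definition iid {disp' : measure_display} {T : measurableType disp'}
    {I : choiceType} (D : set I) (X : I -> Omega -> T)
    (mu : set T -> \bar R) : Prop :=
  (forall i, D i -> has_law (X i) mu) /\
  mutually_independent D (fun i => g_sigma_algebra_preimage (X i)).

End probability_notions.

Section convergence_in_distribution.
Context {R : realType} {disp : measure_display} {Omega : measurableType disp}.
Variable P : probability Omega R.

(* Y1 and Y2 may live on another probability space than X. *)
Definition independent_copies {disp' : measure_display}
    {T : measurableType disp'} (X : Omega -> T)
    {disp1 : measure_display} {Omega1 : measurableType disp1}
    (P1 : probability Omega1 R) (Y1 Y2 : {RV P1 >-> T}) : Prop :=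
  [/\ has_law P1 Y1 (fun A => P (X @^-1` A)),
      has_law P1 Y2 (fun A => P (X @^-1` A)) &
      independent P1 (g_sigma_algebra_preimage Y1)
        (g_sigma_algebra_preimage Y2)].

Definition cvg_in_distribution {T : topologicalType} {I : Type}
    (F : set_system I) (X : I -> Omega -> T)
    {disp1 : measure_display} {Omega1 : measurableType disp1}
    (P1 : probability Omega1 R) (Y : Omega1 -> T) : Prop :=
  forall f : T -> R, continuous f ->
    (exists M : R, forall z, `|f z| <= M) ->
    ('E_P[f \o X i] @[i --> F] --> 'E_P1[f \o Y])%E.

End convergence_in_distribution.

Section weighted_scale_free_percolation.
Context {R : realType} {d : nat}.
Notation vertex := 'rV[int]_d.

(* Unordered pairs of distinct vertices are the two-element finite sets. *)
Definition pairs : set {fset vertex} := [set e | (#|` e|)%fset = 2%N].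

(* For a two-element e, the elements of e are e`_0 and e`_1; the formula is
   symmetric in them, so their order does not matter. *)
Definition edge_prob (alpha lambda : R) (W : vertex -> R)
    (e : {fset vertex}) : R :=
  let x := (enum_fset e)`_0 in let y := (enum_fset e)`_1 in
  if enorm (x - y) == 1 :> R then 1
  else 1 - expR (- (lambda * W x * W y / enorm (x - y) `^ alpha)).

Context {disp : measure_display} {Omega : measurableType disp}.

(* W x is the weight of the vertex x, conn e the indicator that the pair e is
   an edge, and L e the weight of e. The weights L e are attached to all pairs,
   independently of W and conn; only those of present edges matter below. The
   values of conn and L outside pairs are irrelevant. The field sfp_conn says
   that, conditionally on the sigma-algebra of W, the edges are independent
   with probabilities edge_prob; by inclusion-exclusion it determines the whole
   conditional law of the edges. *)
Record is_SFP (P : probability Omega R) (alpha lambda : R)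
    (lawW lawL : probability R R) (W : vertex -> {RV P >-> R})
    (conn : {fset vertex} -> {RV P >-> bool})
    (L : {fset vertex} -> {RV P >-> R}) : Prop := {
  sfp_W : iid P setT (fun x => W x : Omega -> R) lawW ;
  sfp_conn : forall (A : set Omega) (E : {fset {fset vertex}}),
    sigma_family setT (fun x => W x : Omega -> R) A ->
    (forall e, e \in E -> pairs e) ->
    P (A `&` \bigcap_(e in [set` E]) [set w | conn e w]) =
    (\int[P]_(w in A)
       (\prod_(e <- E) edge_prob alpha lambda (fun x => W x w) e)%:E)%E ;
  sfp_L_ge0 : forall e w, pairs e -> 0 <= L e w ;
  sfp_L : iid P pairs (fun e => L e : Omega -> R) lawL ;
  sfp_L_indep : independent P
    (sigma_family pairs (fun e => L e : Omega -> R))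
    <<s sigma_family setT (fun x => W x : Omega -> R) `|`
        sigma_family pairs (fun e => conn e : Omega -> bool) >>
}.

Variables (conn : {fset vertex} -> Omega -> bool)
          (L : {fset vertex} -> Omega -> R).

Definition adj (w : Omega) : rel vertex :=
  [rel x y | (x != y) && conn [fset x; y]%fset w].

(* A path from x to y is given by x and the sequence p of its next vertices.
   Vertices may be repeated: as the weights are nonnegative, this does not
   change the infima below. *)
Definition is_path (w : Omega) (x y : vertex) (p : seq vertex) : Prop :=
  path (adj w) x p /\ last x p = y.

Definition path_weight (w : Omega) (x : vertex) (p : seq vertex) : R :=
  \sum_(e <- zip (x :: p) p) L [fset e.1; e.2]%fset w.

Definition dist_L (x y : vertex) (w : Omega) : \bar R :=
  ereal_inf [set (path_weight w x p)%:E | p in is_path w x y].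

Definition dist_G (x y : vertex) (w : Omega) : \bar R :=
  ereal_inf [set (size p)%:R%:E | p in is_path w x y].

Definition gball (n : nat) (x : vertex) (w : Omega) : set vertex :=
  [set y | (dist_G x y w <= n%:R%:E)%E].

Definition gsphere (n : nat) (x : vertex) (w : Omega) : set vertex :=
  gball n x w `\` (if n is m.+1 then gball m x w else set0).

Definition dist_to_sphere (n : nat) (x : vertex) (w : Omega) : \bar R :=
  ereal_inf [set dist_L x y w | y in gsphere n x w].

(* The sequence is nondecreasing in n when the weights are nonnegative, so the
   limit exists in [0, +oo]. *)
Definition explosion_time (x : vertex) (w : Omega) : \bar R :=
  limn (fun n => dist_to_sphere n x w).

End weighted_scale_free_percolation.

(* Main.v *)
Require Import Defs.
From HB Require Import structures.
From mathcomp Require Import all_boot all_order all_algebra finmap.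
From mathcomp Require Import all_classical all_reals all_analysis measurable_realfun.
From mathcomp Require Import ring lra zify.
Set Implicit Arguments.
Unset Strict Implicit.
Unset Printing Implicit Defensive.
Import Order.TTheory GRing.Theory Num.Theory.
Import numFieldNormedType.Exports.
Local Open Scope classical_set_scope.
Local Open Scope ring_scope.

(** Claim 1. The explosion times of 0 and x are the same measurable functional of
    the configuration of edges and edge weights seen from 0 and from x.
    Integrating out the vertex weights, the probability that finitely many given
    edges are present is invariant under translations and factorises exactly over
    disjoint sets of vertices. By a pi-lambda argument the configuration is
    stationary and mixing, so that P(V_0 in A, V_x in B) tends to
    P(V_0 in A) P(V_0 in B) for all Borel sets A and B, and these rectangles
    determine the weak limit.

    Claim 2. If x is at graph distance more than 2n from 0, a path from 0 to x
    contains disjoint paths from 0 and from x leaving the graph balls of radius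
    n - 1, so d_L(0, x) >= M_n(0) + M_n(x), while M_n(x) increases to V_x with a
    law that does not depend on x. It remains to see that graph balls are almost
    surely finite and that V_0 is almost surely finite.

    Graph balls are finite because gamma > 1: for s with d / alpha < s <= 1 and
    s < tau - 1 the bound 1 - exp(-u) <= u^s makes the degrees summable over
    dyadic shells. V_0 is finite because gamma < 2: vertices of weight N^rho
    with rho slightly above alpha / 2 are still numerous in a box of side N, so
    that along a sequence of boxes whose sides N_k = 2^(n_k) grow
    doubly exponentially one can pass from each such vertex to one in the next box
    along an edge of weight at most the quantile of L of order N_k^(-delta), up to
    a summable error. These quantiles are summable by comparison with I(L), and
    the nearest-neighbour edges join 0 to the resulting path. *)

(** * Paths, balls and spheres in a weighted graph *)

(** By stationarity the probability that M_n(x) is still short of V_x is the same for all x, so n is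
    chosen once and only then does x tend to infinity. The sides of the boxes must grow slowly on
    the doubly exponential scale. Vertices of weights N_k^rho and N_(k+1)^rho lie at distance of
    order N_(k+1), so in base 2 the exponent of an edge is rho (n_k + n_(k+1)) - alpha n_(k+1). With
    rho only slightly above alpha / 2 this is positive only if n_k / n_(k+1) is close to 1, whence a
    growth ratio 1 + 1/K with K large. A box of side N has about N^(d - (tau - 1) rho) such
    vertices, so rho must also stay below d / (tau - 1); gamma < 2 leaves room between the two
    bounds. The quantile of order 2^(- delta n_k) is the integrand of I(L) at y_k = log(delta n_k
    log 2). Geometric growth of n_k keeps the y_k at least a constant apart, so the sum of these
    quantiles is, up to a factor, a lower Riemann sum of I(L). *)

Section weighted_graph.
Context {R : realType} {d : nat}.
Notation vertex := 'rV[int]_d.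
Context {disp : measure_display} {Omega : measurableType disp}.
Variables (conn : {fset vertex} -> Omega -> bool)
          (L : {fset vertex} -> Omega -> R).
Implicit Types (w : Omega) (x y z u v : vertex) (p q : seq vertex) (n m : nat).

Lemma adj_sym w : symmetric (adj conn w).
Proof. by move=> x y; rewrite /adj /= eq_sym fsetUC. Qed.

Lemma adj_pairs w x y : adj conn w x y -> pairs [fset x; y]%fset.
Proof. by move=> /andP[xy _]; rewrite /pairs /= cardfs2 xy. Qed.

Lemma is_path_nil w x : is_path conn w x x [::].
Proof. by split. Qed.

Lemma is_path_cat w x y z p q :
  is_path conn w x y p -> is_path conn w y z q -> is_path conn w x z (p ++ q).
Proof. by move=> [pp <-] [pq <-]; split; rewrite ?cat_path ?pp ?last_cat. Qed.

Lemma is_path_rev w x y p :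
  is_path conn w x y p -> is_path conn w y x (rev (belast x p)).
Proof.
move=> [pp <-]; split.
  by rewrite rev_path; apply: sub_path pp => u v; rewrite adj_sym.
by case: p pp => //= a p _; rewrite rev_cons last_rcons.
Qed.

Lemma path_weight_nil w x : path_weight L w x [::] = 0.
Proof. by rewrite /path_weight big_nil. Qed.

Lemma path_weight_cons w x y p :
  path_weight L w x (y :: p) = L [fset x; y]%fset w + path_weight L w y p.
Proof. by rewrite /path_weight /= big_cons. Qed.

Lemma path_weight_cat w x p q :
  path_weight L w x (p ++ q) = path_weight L w x p + path_weight L w (last x p) q.
Proof.
elim: p x => [|a p IH] x /=; first by rewrite path_weight_nil add0r.
by rewrite !path_weight_cons IH addrA.
Qed.

Lemma path_weight_rev w x p :
  path_weight L w (last x p) (rev (belast x p)) = path_weight L w x p.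
Proof.
elim: p x => [|a p IH] x //=.
rewrite rev_cons -cats1 path_weight_cat IH !path_weight_cons path_weight_nil addr0.
rewrite addrC; congr (L _ w + _).
have -> : last (last a p) (rev (belast a p)) = a.
  by case: p {IH} => //= b p; rewrite rev_cons last_rcons.
by rewrite fsetUC.
Qed.

Lemma gballP n x w y :
  gball (R := R) conn n x w y <->
  exists2 p, is_path conn w x y p & (size p <= n)%N.
Proof.
split=> [|[p pP sp]]; last first.
  rewrite /gball /= (@le_trans _ _ (size p)%:R%:E)//; last first.
    by rewrite lee_fin ler_nat.
  by apply: ereal_inf_lbound; exists p.
rewrite /gball /= /dist_G => H; apply: contrapT => nP.
have : ((n.+1)%:R%:E <= dist_G (R := R) conn x y w)%E.
  apply: le_ereal_inf_tmp => _ [p pP <-]; rewrite lee_fin ler_nat ltnNge.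
  by apply/negP => sp; apply: nP; exists p.
move=> /le_trans /(_ H); rewrite lee_fin ler_nat ltnn //.
Qed.

Lemma gball_refl n x w : gball (R := R) conn n x w x.
Proof. by apply/gballP; exists [::]; [exact: is_path_nil|]. Qed.

Lemma gball_sym n x w y :
  gball (R := R) conn n x w y -> gball (R := R) conn n y w x.
Proof.
move=> /gballP[p pP sp]; apply/gballP; exists (rev (belast x p)).
  exact: is_path_rev.
by rewrite size_rev size_belast.
Qed.

Lemma gball_trans n m x w y z :
  gball (R := R) conn n x w y -> gball (R := R) conn m y w z ->
  gball (R := R) conn (n + m) x w z.
Proof.
move=> /gballP[p pP sp] /gballP[q qP sq]; apply/gballP; exists (p ++ q).
  exact: is_path_cat qP.
by rewrite size_cat leq_add.
Qed.

Lemma gball_adj n x w y z :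
  gball (R := R) conn n x w y -> adj conn w y z -> gball (R := R) conn n.+1 x w z.
Proof.
move=> xy yz; rewrite -addn1; apply: gball_trans xy _.
by apply/gballP; exists [:: z] => //; split; rewrite //= andbT.
Qed.

Lemma gsphereP n x w y : gsphere (R := R) conn n x w y <->
  gball (R := R) conn n x w y /\ forall m, (m < n)%N -> ~ gball (R := R) conn m x w y.
Proof.
case: n => [|n]; split => -[xy nxy]; split => //=.
  move=> m; rewrite ltnS => mn /gballP[p pP sp]; apply: nxy; apply/gballP.
  by exists p => //; exact: leq_trans sp mn.
exact: nxy.
Qed.

(* The path is cut at its first vertex outside the ball of radius n - 1. *)
Lemma path_split_gsphere n x w y p : is_path conn w x y p ->
  (forall m, (m < n)%N -> ~ gball (R := R) conn m x w y) ->
  exists p1 p2, p = p1 ++ p2 /\ gsphere (R := R) conn n x w (last x p1).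
Proof.
case: n => [_ _|n].
  by exists [::], p; split => //; apply/gsphereP; split => //; exact: gball_refl.
elim/last_ind: p y => [|p z IH] y [pp <-] ny.
  by exfalso; apply: (ny 0%N) => //; exact: gball_refl.
have [xl|xl] := pselect (gball (R := R) conn n x w (last x p)).
  exists (rcons p z), [::]; split; first by rewrite cats0.
  apply/gsphereP; split; last exact: ny.
  rewrite last_rcons; apply: gball_adj xl _.
  by move: pp; rewrite rcons_path => /andP[].
have [||p1 [p2 [-> ?]]] := IH (last x p).
- by split => //; move: pp; rewrite rcons_path => /andP[].
- move=> m; rewrite ltnS => mn /gballP[q qP sq]; apply: xl; apply/gballP.
  by exists q => //; exact: leq_trans sq mn.
- by exists p1, (rcons p2 z); rewrite rcons_cat.
Qed.

Section nonnegative_weights.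
Variable w : Omega.
Hypothesis L_ge0 : forall e, pairs e -> 0 <= L e w.

Lemma path_weight_ge0 x p : path (adj conn w) x p -> 0 <= path_weight L w x p.
Proof.
elim: p x => [|y p IH] x /=; first by rewrite path_weight_nil.
move=> /andP[xy pp]; rewrite path_weight_cons addr_ge0 ?IH//.
exact/L_ge0/(adj_pairs xy).
Qed.

Lemma dist_L_ge0 x y : (0 <= dist_L conn L x y w)%E.
Proof.
by apply: le_ereal_inf_tmp => _ [p [pp _] <-]; rewrite lee_fin path_weight_ge0.
Qed.

Lemma dist_to_sphere_ge0 n x : (0 <= dist_to_sphere conn L n x w)%E.
Proof. by apply: le_ereal_inf_tmp => _ [y _ <-]; exact: dist_L_ge0. Qed.

Lemma dist_to_sphere_le n x y p : is_path conn w x y p ->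
  (forall m, (m < n)%N -> ~ gball (R := R) conn m x w y) ->
  (dist_to_sphere conn L n x w <= (path_weight L w x p)%:E)%E.
Proof.
move=> pP /(path_split_gsphere pP)[p1 [p2 [pE sp]]].
have [pp _] := pP; move: pp; rewrite pE cat_path => /andP[pp1 pp2].
apply: (@le_trans _ _ (dist_L conn L x (last x p1) w)).
  by apply: ereal_inf_lbound; exists (last x p1).
apply: (@le_trans _ _ (path_weight L w x p1)%:E).
  by apply: ereal_inf_lbound; exists p1.
by rewrite lee_fin path_weight_cat lerDl path_weight_ge0.
Qed.

Lemma dist_to_sphere_le_dist_L n x y :
  (forall m, (m < n)%N -> ~ gball (R := R) conn m x w y) ->
  (dist_to_sphere conn L n x w <= dist_L conn L x y w)%E.
Proof.
by move=> nxy; apply: le_ereal_inf_tmp => _ [p pP <-]; exact: dist_to_sphere_le pP nxy.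
Qed.

(** The path is cut at a vertex of the sphere of radius [n] about [x]. That vertex is within [n] of
    [x], hence further than [n] from [y], so the rest of the path, read backwards, also leaves the
    balls of radius less than [n] about [y]. *)
Lemma dist_to_sphereD n x y : ~ gball (R := R) conn (n + n) x w y ->
  (dist_to_sphere conn L n x w + dist_to_sphere conn L n y w <=
   dist_L conn L x y w)%E.
Proof.
move=> nxy; apply: le_ereal_inf_tmp => _ [p pP <-].
have [|p1 [p2 [pE sp]]] := @path_split_gsphere n x w y p pP.
  move=> m mn /gballP[q qP sq]; apply: nxy; apply/gballP; exists q => //.
  by apply: (leq_trans sq); rewrite (leq_trans (ltnW mn))// leq_addr.
have [pp pl] := pP; move: pp pl; rewrite pE cat_path last_cat => /andP[pp1 pp2] pl.
rewrite path_weight_cat EFinD; apply: leeD.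
  by apply: (@dist_to_sphere_le _ _ (last x p1)) => //; case/gsphereP : sp.
rewrite -path_weight_rev pl.
apply: (@dist_to_sphere_le _ _ (last x p1)).
  by apply: is_path_rev; split.
move=> m mn /gballP[q qP sq]; apply: nxy.
apply: (@gball_trans _ _ _ _ (last x p1)); first by case/gsphereP : sp.
apply: gball_sym; apply/gballP; exists q => //.
exact: leq_trans sq (ltnW mn).
Qed.

Lemma dist_to_sphere_ndecr x :
  {homo (fun n => dist_to_sphere conn L n x w) : n m / (n <= m)%N >-> (n <= m)%E}.
Proof.
move=> n m nm; apply: le_ereal_inf_tmp => _ [y /gsphereP[_ ny] <-].
apply: dist_to_sphere_le_dist_L => k kn; apply: ny; exact: leq_trans kn nm.
Qed.

Lemma cvg_explosion_time x :
  dist_to_sphere conn L n x w @[n --> \oo] --> explosion_time conn L x w.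
Proof.
by apply: ereal_nondecreasing_is_cvgn; exact: dist_to_sphere_ndecr.
Qed.

Lemma explosion_timeE x : explosion_time conn L x w =
  ereal_sup (range (fun n => dist_to_sphere conn L n x w)).
Proof.
apply/cvg_lim => //; apply: ereal_nondecreasing_cvgn.
exact: dist_to_sphere_ndecr.
Qed.

Lemma dist_to_sphere_le_explosion_time n x :
  (dist_to_sphere conn L n x w <= explosion_time conn L x w)%E.
Proof. by rewrite explosion_timeE; apply: ereal_sup_ubound; exists n. Qed.

Lemma explosion_time_ge0 x : (0 <= explosion_time conn L x w)%E.
Proof.
exact: le_trans (dist_to_sphere_ge0 0 x) (dist_to_sphere_le_explosion_time 0 x).
Qed.

(** Carries a finite explosion time from one vertex to all vertices joined to it by a path. *)
Lemma explosion_time_le_path x y p : is_path conn w x y p ->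
  (explosion_time conn L x w <=
   (path_weight L w x p)%:E + explosion_time conn L y w)%E.
Proof.
move=> pP; rewrite [leLHS]explosion_timeE; apply: ge_ereal_sup => _ [n _ <-].
(* By the triangle inequality, the sphere of radius [n + size p] about [y] lies outside the balls of
   radius less than [n] about [x]; prefixing [p] to a path to that sphere gives a path that leaves
   them. *)
apply: (@le_trans _ _
    ((path_weight L w x p)%:E + dist_to_sphere conn L (n + size p) y w)%E); last first.
  by rewrite leeD2l// dist_to_sphere_le_explosion_time.
rewrite -leeBlDl//; apply: le_ereal_inf_tmp => _ [z /gsphereP[_ nz] <-].
apply: le_ereal_inf_tmp => _ [q qP <-]; rewrite leeBlDl// -EFinD.
have [pp pl] := pP; rewrite -{1}pl -path_weight_cat.
apply: (@dist_to_sphere_le n x z); first exact: is_path_cat qP.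
move=> m mn xz; apply: (nz (m + size p)%N); first by rewrite ltn_add2r.
rewrite addnC; apply: gball_trans xz; apply: gball_sym.
by apply/gballP; exists p.
Qed.

Lemma explosion_time_fin x (s : nat -> vertex) (C : R) : s 0%N = x ->
  (forall k, adj conn w (s k) (s k.+1)) ->
  (forall n, \sum_(k < n) L [fset s k; s k.+1]%fset w <= C) ->
  (forall n, exists k, ~ gball (R := R) conn n x w (s k)) ->
  (explosion_time conn L x w <= C%:E)%E.
Proof.
move=> <- sadj sC sout; rewrite explosion_timeE; apply: ge_ereal_sup => _ [n _ <-].
have [k nk] := sout n.
pose p := [seq s i.+1 | i <- iota 0 k].
have pathp : forall j, is_path conn w (s j) (s (j + k)%N)
    [seq s i.+1 | i <- iota j k].
  elim: {nk p} k => [|k IH] j /=; first by rewrite addn0; split.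
  have [pp pl] := IH j.+1; rewrite addnS -addSn.
  by split; rewrite /= ?pl// sadj.
have weightp : forall j, path_weight L w (s j) [seq s i.+1 | i <- iota j k] =
    \sum_(i < k) L [fset s (j + i)%N; s (j + i).+1]%fset w.
  elim: {nk p pathp} k => [|k IH] j /=; first by rewrite path_weight_nil big_ord0.
  rewrite path_weight_cons IH big_ord_recl /= addn0; congr (_ + _).
  by apply: eq_bigr => i _; rewrite addSnnS.
apply: (@le_trans _ _ (path_weight L w (s 0%N) p)%:E); last first.
  by rewrite lee_fin weightp sC.
apply: (dist_to_sphere_le (pathp 0%N)) => m mn /gballP[q qP sq].
by apply: nk; apply/gballP; exists q => //; exact: leq_trans sq (ltnW mn).
Qed.

End nonnegative_weights.
End weighted_graph.

(** * Invariance under translation, between two sample spaces *)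

Section translation.
Context {R : realType} {d : nat}.
Notation vertex := 'rV[int]_d.
Context {disp : measure_display} {Omega : measurableType disp}
  {disp' : measure_display} {Omega' : measurableType disp'}.
Variables (conn : {fset vertex} -> Omega -> bool)
          (L : {fset vertex} -> Omega -> R).
Variables (conn' : {fset vertex} -> Omega' -> bool)
          (L' : {fset vertex} -> Omega' -> R).
Variables (w : Omega) (w' : Omega') (x : vertex).
Hypothesis conn_shift : forall u v, u != v ->
  conn' [fset u; v]%fset w' = conn [fset (u + x)%R; (v + x)%R]%fset w.
Hypothesis L_shift : forall u v, u != v ->
  L' [fset u; v]%fset w' = L [fset (u + x)%R; (v + x)%R]%fset w.

Let tr := +%R^~ x : vertex -> vertex.

Lemma adj_shift u v : adj conn' w' u v = adj conn w (tr u) (tr v).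
Proof.
rewrite /adj /= (inj_eq (addIr x)); case: eqVneq => //= uv.
exact: conn_shift.
Qed.

Lemma is_path_shift u v p :
  is_path conn' w' u v p <-> is_path conn w (tr u) (tr v) (map tr p).
Proof.
have pathE q : path (adj conn' w') u q = path (adj conn w) (tr u) (map tr q).
  elim: q u => [//|a q IH] u /=; by rewrite IH adj_shift.
rewrite /is_path pathE last_map; split => -[? pl]; split => //.
  by rewrite pl.
exact: (addIr x) pl.
Qed.

Lemma path_weight_shift u p : path (adj conn' w') u p ->
  path_weight L' w' u p = path_weight L w (tr u) (map tr p).
Proof.
elim: p u => [|a p IH] u /=; first by rewrite !path_weight_nil.
move=> /andP[/andP[ua _] pp]; rewrite !path_weight_cons IH//.
by rewrite L_shift.
Qed.

Lemma dist_L_shift u v : dist_L conn' L' u v w' = dist_L conn L (tr u) (tr v) w.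
Proof.
congr (ereal_inf _); rewrite eqEsubset; split => _ [p pP <-].
  exists (map tr p); first exact/is_path_shift.
  by rewrite -path_weight_shift//; case: pP.
have trK : map tr (map (+%R^~ (- x)) p) = p.
  by rewrite -map_comp map_id_in// => a _ /=; rewrite /tr subrK.
exists (map (+%R^~ (- x)) p); first by apply/is_path_shift; rewrite trK.
rewrite path_weight_shift ?trK//.
by have /is_path_shift[] : is_path conn w (tr u) (tr v)
  (map tr (map (+%R^~ (- x)) p)) by rewrite trK.
Qed.

Lemma gball_shift n u v :
  gball (R := R) conn' n u w' v <-> gball (R := R) conn n (tr u) w (tr v).
Proof.
split => /gballP[p pP sp]; apply/gballP.
  by exists (map tr p); [exact/is_path_shift|rewrite size_map].
exists (map (+%R^~ (- x)) p); last by rewrite size_map.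
apply/is_path_shift; rewrite -map_comp map_id_in// => a _ /=.
by rewrite /tr subrK.
Qed.

Lemma dist_to_sphere_shift n u :
  dist_to_sphere conn' L' n u w' = dist_to_sphere conn L n (tr u) w.
Proof.
congr (ereal_inf _); rewrite eqEsubset; split => _ [v /gsphereP[uv nuv] <-].
  exists (tr v); last by rewrite dist_L_shift.
  by apply/gsphereP; split => [|m /nuv]; [exact/gball_shift|
    apply: contra_not => /gball_shift].
have vE : v = tr (v - x) by rewrite /tr subrK.
exists (v - x); last by rewrite dist_L_shift -vE.
apply/gsphereP; split => [|m /nuv]; first by apply/gball_shift; rewrite -vE.
by apply: contra_not => /gball_shift; rewrite -vE.
Qed.

Lemma explosion_time_shift u :
  explosion_time conn' L' u w' = explosion_time conn L (tr u) w.
Proof.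
rewrite /explosion_time; congr (limn _); apply/funext => n.
exact: dist_to_sphere_shift.
Qed.

End translation.

(** * Measurability of distances and explosion times *)

Section countable_infimum.
Context {R : realType} {disp : measure_display} {Omega : measurableType disp}.
Local Open Scope ereal_scope.

(** An infimum is below [r] as soon as one of countably many terms is. The index set may depend on
    [w], as the set of open paths and the spheres do. *)
Lemma measurable_fun_ereal_inf (I : countType) (S : I -> set Omega)
    (F : I -> Omega -> \bar R) :
  (forall i, measurable (S i)) -> (forall i, measurable_fun (S i) (F i)) ->
  measurable_fun setT (fun w => ereal_inf [set F i w | i in [set i | S i w]]).
Proof.
move=> mS mF; apply: (measurability _ (ErealGenInftyO.measurableE R)).
move=> _ [_ [r ->] <-]; rewrite setTI.
rewrite (_ : _ @^-1` _ = \bigcup_i (S i `&` F i @^-1` `]-oo, r%:E[)).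
  apply: countable_bigcupT_measurable => // i.
  exact: (mF i (mS i) _ (emeasurable_itv _)).
rewrite eqEsubset; split => w /=.
  rewrite in_itv /= => /ereal_inf_lt[_ [i Si <-] Fr].
  by exists i => //; split => //; rewrite /= in_itv.
move=> [i _ [Si /=]]; rewrite !in_itv /= => Fr.
by apply: le_lt_trans Fr; apply: ereal_inf_lbound; exists i.
Qed.

End countable_infimum.

Section measurability.
Context {R : realType} {d : nat}.
Notation vertex := 'rV[int]_d.
Context {disp : measure_display} {Omega : measurableType disp}.
Variables (conn : {fset vertex} -> Omega -> bool)
          (L : {fset vertex} -> Omega -> R).
Hypothesis measurable_conn : forall e, measurable_fun setT (conn e).
Hypothesis measurable_L : forall e, measurable_fun setT (L e).
Implicit Types (w : Omega) (x y : vertex) (p : seq vertex).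

Lemma measurable_is_path x y p : measurable [set w | is_path conn w x y p].
Proof.
have mp : measurable_fun setT (fun w => path (adj conn w) x p).
  elim: p x => [|a p IH] x /=; first exact: measurable_cst.
  apply: measurable_and; last exact: IH.
  by apply: measurable_and; [exact: measurable_cst|exact: measurable_conn].
have [pl|pl] := pselect (last x p = y); last first.
  by rewrite (_ : mkset _ = set0)//; apply/seteqP; split => // w [].
rewrite (_ : mkset _ = (fun w => path (adj conn w) x p) @^-1` [set true]).
  by rewrite -[X in measurable X]setTI; exact: mp.
by apply/seteqP; split => w /=; [case|split].
Qed.

Lemma measurable_path_weight x p :
  measurable_fun setT (fun w => path_weight L w x p).
Proof.
elim: p x => [|a p IH] x.
  by under eq_fun do rewrite path_weight_nil; exact: measurable_cst.
under eq_fun do rewrite path_weight_cons.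
by apply: measurable_funD; [exact: measurable_L|exact: IH].
Qed.

Lemma measurable_dist_L x y : measurable_fun setT (dist_L conn L x y).
Proof.
apply: (@measurable_fun_ereal_inf _ _ _ _
  (fun p => [set w | is_path conn w x y p])
  (fun p w => (path_weight L w x p)%:E)) => p; first exact: measurable_is_path.
by apply: measurable_funTS; apply/measurable_EFinP; exact: measurable_path_weight.
Qed.

Lemma measurable_gball n x y : measurable [set w | gball (R := R) conn n x w y].
Proof.
rewrite (_ : mkset _ = \bigcup_p
    (if (size p <= n)%N then [set w | is_path conn w x y p] else set0)).
  apply: countable_bigcupT_measurable => // p; case: ifP => // _.
  exact: measurable_is_path.
apply/seteqP; split => w /=.
  by move=> /gballP[p pP sp]; exists p => //; rewrite sp.
by move=> [p _]; case: ifP => // sp pP; apply/gballP; exists p.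
Qed.

Lemma measurable_gsphere n x y :
  measurable [set w | gsphere (R := R) conn n x w y].
Proof.
case: n => [|n].
  rewrite (_ : mkset _ = [set w | gball (R := R) conn 0 x w y]).
    exact: measurable_gball.
  by apply/seteqP; split => w /=; [case|split].
exact: measurableD (measurable_gball _ _ _) (measurable_gball _ _ _).
Qed.

Lemma measurable_dist_to_sphere n x :
  measurable_fun setT (dist_to_sphere conn L n x).
Proof.
apply: (@measurable_fun_ereal_inf _ _ _ _
  (fun y => [set w | gsphere (R := R) conn n x w y])
  (fun y => dist_L conn L x y)) => y; first exact: measurable_gsphere.
by apply: measurable_funTS; exact: measurable_dist_L.
Qed.

Lemma measurable_explosion_time x :
  (forall e w, pairs e -> 0 <= L e w) ->
  measurable_fun setT (explosion_time conn L x).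
Proof.
move=> L_ge0; apply: (emeasurable_fun_cvg (fun n => dist_to_sphere conn L n x)).
  by move=> n; exact: measurable_dist_to_sphere.
by move=> w _; apply: cvg_explosion_time => e; exact: L_ge0.
Qed.

End measurability.

(** * Independence and mixing *)

Section real_valued_probability.
Context {R : realType} {disp : measure_display} {Omega : measurableType disp}.
Variable P : probability Omega R.
Implicit Types A B : set Omega.

Lemma fineK_prob A : measurable A -> (fine (P A))%:E = P A.
Proof. by move=> mA; rewrite fineK// fin_num_measure. Qed.

Lemma prob_ge0 A : 0 <= fine (P A).
Proof. by rewrite fine_ge0. Qed.

Lemma prob_le1 A : measurable A -> fine (P A) <= 1.
Proof. by move=> mA; rewrite -lee_fin fineK_prob// probability_le1. Qed.

Lemma probT : fine (P setT) = 1.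
Proof. by rewrite probability_setT. Qed.

Lemma le_prob A B : measurable A -> measurable B -> A `<=` B ->
  fine (P A) <= fine (P B).
Proof. by move=> mA mB AB; rewrite -lee_fin !fineK_prob// le_measure ?inE. Qed.

Lemma probD A B : measurable A -> measurable B ->
  fine (P (A `\` B)) = fine (P A) - fine (P (A `&` B)).
Proof.
move=> mA mB; apply: EFin_inj.
rewrite EFinB !fineK_prob//; [|exact: measurableI|exact: measurableD].
by rewrite measureD// ltey_eq fin_num_measure.
Qed.

Lemma probC A : measurable A -> fine (P (~` A)) = 1 - fine (P A).
Proof. by move=> mA; rewrite -setTD probD// setTI probT. Qed.

Lemma cvg_prob (A_ : (set Omega)^nat) : (forall n, measurable (A_ n)) ->
  nondecreasing_seq A_ ->
  fine (P (A_ n)) @[n --> \oo] --> fine (P (\bigcup_n A_ n)).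
Proof.
move=> mA ndA; apply/fine_cvg; rewrite fineK_prob; last exact: bigcupT_measurable.
exact: (nondecreasing_cvg_mu (mu := P) mA (bigcupT_measurable _ mA) ndA).
Qed.

Lemma le_prob_setU A B : measurable A -> measurable B ->
  fine (P (A `|` B)) <= fine (P A) + fine (P B).
Proof.
move=> mA mB; rewrite -lee_fin EFinD !fineK_prob//; last exact: measurableU.
exact: measureU2.
Qed.

Lemma Borel_Cantelli (E : (set Omega)^nat) : (forall n, measurable (E n)) ->
  (\sum_(n <oo) P (E n) < +oo)%E ->
  {ae P, forall w, exists n, forall k, (n <= k)%N -> ~ E k w}.
Proof.
move=> mE sE; exists (lim_sup_set E); split.
- apply: bigcapT_measurable => n; exact: bigcup_measurable.
- exact: lim_sup_set_cvg0.
- move=> w /= nw n _; apply: contrapT => nE; apply: nw; exists n => k nk Ek.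
  by apply: nE; exists k.
Qed.

End real_valued_probability.

(** * Independence, stationarity and mixing extended from a pi-system *)

Section pi_lambda.
Context {R : realType} {disp : measure_display} {Omega : measurableType disp}.
Variable P : probability Omega R.

Lemma independent_g_sigma_algebra (G H : set_system Omega) :
  setI_closed G -> setI_closed H ->
  G `<=` measurable -> H `<=` measurable ->
  independent P G H -> independent P <<s G >> <<s H >>.
Proof.
(* One factor at a time: the sets independent of a fixed [B] form a lambda-system. *)
have half (G' : set_system Omega) (B : set Omega) : setI_closed G' ->
    G' `<=` measurable -> measurable B ->
    (forall A, G' A -> P (A `&` B) = P A * P B)%E ->
    forall A, <<s G' >> A -> measurable A /\ (P (A `&` B) = P A * P B)%E.
  move=> IG GM mB GB; apply: lambda_system_subset => //; last first.
    by move=> A GA; split; [exact: GM|exact: GB].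
  have PE A : measurable A -> (P (A `&` B) = P A * P B)%E <->
      fine (P (A `&` B)) = fine (P A) * fine (P B).
    move=> mA; split => [->|PAB]; first by rewrite fineM ?fin_num_measure.
    rewrite -(fineK_prob P mA) -(fineK_prob P mB).
    by rewrite -(fineK_prob P (measurableI _ _ mA mB)) PAB EFinM.
  split => //.
  - by rewrite /= setTI probability_setT mul1e.
  - move=> A C CA [mA /PE PA] [mC /PE PC]; split; first exact: measurableD.
    apply/PE; first exact: measurableD.
    have -> : (A `\` C) `&` B = (A `&` B) `\` C by rewrite setIC setIDA (setIC B).
    rewrite probD//; last exact: measurableI.
    rewrite PA// probD// (_ : A `&` B `&` C = C `&` B).
      by rewrite PC// (setIidr CA) mulrBl.
    by rewrite setIAC (setIidr CA).
  - move=> F ndF mF; have mFn n : measurable (F n) by case: (mF n).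
    split; first exact: bigcupT_measurable.
    apply/PE; first exact: bigcupT_measurable.
    have c1 : fine (P (F n `&` B)) @[n --> \oo] --> fine (P (\bigcup_n F n `&` B)).
      rewrite setI_bigcupl; apply: cvg_prob => [n|m n mn].
        exact: measurableI.
      by apply/subsetPset; apply: setSI; apply/subsetPset/ndF.
    apply: (cvg_unique (@Rhausdorff R) c1).
    have -> : (fun n => fine (P (F n `&` B))) = fun n => fine (P (F n)) * fine (P B).
      by apply/funext => n; have [mFn' /PE->] := mF n.
    by apply: cvgM; [exact: cvg_prob|exact: cvg_cst].
move=> IG IH GM HM ind A B sA sB.
have mA : measurable A.
  have := sA; apply: (@smallest_sub _ _ _ measurable) => //.
  exact: sigma_algebra_measurable.
suff [_] : measurable B /\ (P (B `&` A) = P B * P A)%E by rewrite setIC muleC.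
apply: (half H A IH HM mA _ B sB) => C HC.
have [_] : measurable A /\ (P (A `&` C) = P A * P C)%E.
  by apply: (half G C IG GM (HM _ HC) _ A sA) => D GD; exact: ind.
by rewrite setIC muleC.
Qed.

Section mixing.
Context {T : Type} {I : Type} (F : set_system I) {FF : Filter F}.
Variables (G : set_system T) (X : I -> Omega -> T) (i0 : I).
Hypothesis GI : setI_closed G.
Hypothesis mG : forall i S, G S -> measurable (X i @^-1` S).
Hypothesis stationaryG :
  forall i S, G S -> P (X i @^-1` S) = P (X i0 @^-1` S).

Lemma g_sigma_algebra_measurable_preimage i S :
  <<s G >> S -> measurable (X i @^-1` S).
Proof.
move: S; apply: smallest_sub; last by move=> S; exact: mG.
split => /=; first by rewrite preimage_set0.
- by move=> S mS; rewrite setTD preimage_setC; exact: measurableC.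
- by move=> S mS; rewrite preimage_bigcup; exact: bigcupT_measurable.
Qed.

Lemma g_sigma_algebra_stationary i S :
  <<s G >> S -> P (X i @^-1` S) = P (X i0 @^-1` S).
Proof.
suff H : <<s G >> `<=` [set S | measurable (X i @^-1` S) /\
    measurable (X i0 @^-1` S) /\
    fine (P (X i @^-1` S)) = fine (P (X i0 @^-1` S))].
  by move=> /H [mS [mS0 PS]]; rewrite -(fineK_prob P mS) PS fineK_prob.
apply: lambda_system_subset => //; last first.
  by move=> A GA; split; [exact: mG|split; [exact: mG|rewrite stationaryG]].
split => //.
- by rewrite /= !preimage_setT.
- move=> A B BA /= [mA [mA0 PA]] [mB [mB0 PB]].
  have BiA j : X j @^-1` A `&` X j @^-1` B = X j @^-1` B.
    by apply: setIidr => w; exact: BA.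
  do 2 (split; first exact: measurableD).
  by rewrite !probD// !BiA PA PB.
- move=> A ndA mA.
  rewrite /= !preimage_bigcup; split; first by apply: bigcupT_measurable => n; case: (mA n).
  split; first by apply: bigcupT_measurable => n; case: (mA n) => _ [].
  have nd j : nondecreasing_seq (fun n => X j @^-1` A n).
    by move=> m n mn; apply/subsetPset => w; have /subsetPset := ndA _ _ mn; apply.
  apply: (cvg_unique (@Rhausdorff R) (cvg_prob (P := P) _ (nd i))).
    by move=> n; case: (mA n).
  rewrite (_ : (fun n => _) = fun n => fine (P (X i0 @^-1` A n))).
    by apply: (cvg_prob _ (nd i0)) => n; case: (mA n) => _ [].
  by apply/funext => n; case: (mA n) => _ [].
Qed.

(* The approximation error [p (A i `\` B n i)] is controlled uniformly in [i],
   which is what allows the exchange of the limits in [i] and in [n]. *)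
Lemma mixing_limit (A : I -> set Omega) (B : nat -> I -> set Omega)
    (C : I -> set Omega) (a c : R) (b delta : nat -> R) :
  (forall i, measurable (A i)) -> (forall n i, measurable (B n i)) ->
  (forall i, measurable (C i)) -> (forall n i, B n i `<=` A i) ->
  (forall n i, fine (P (A i `\` B n i)) <= delta n) ->
  delta n @[n --> \oo] --> (0 : R) ->
  (forall n, `|a - b n| <= delta n) -> 0 <= c <= 1 ->
  (forall n, fine (P (B n i `&` C i)) @[i --> F] --> b n * c) ->
  fine (P (A i `&` C i)) @[i --> F] --> a * c.
Proof.
move=> mA mB mC BA PAB d0 ab /andP[c0 c1] cB; apply/cvgrPdist_lt => e e0.
have e30 : 0 < e / 3 by rewrite divr_gt0.
have [n dn] : exists n, delta n < e / 3.
  move/cvgrPdist_lt : d0 => /(_ _ e30)[n _ /(_ n (leqnn n))] /=.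
  by rewrite sub0r normrN => dn; exists n; exact: le_lt_trans (ler_norm _) dn.
near=> i.
have h1 : `|b n * c - fine (P (B n i `&` C i))| < e / 3.
  by near: i; move/cvgrPdist_lt : (cB n); apply.
have h2 : `|fine (P (A i `&` C i)) - fine (P (B n i `&` C i))| <= delta n.
  have mAC : measurable (A i `&` C i) by exact: measurableI.
  have mBC : measurable (B n i `&` C i) by exact: measurableI.
  have BAC : A i `&` C i `&` (B n i `&` C i) = B n i `&` C i.
    by apply: setIidr; apply: setSI.
  rewrite -BAC -probD// ger0_norm ?prob_ge0//.
  apply: le_trans (PAB n i); apply: le_prob.
  - exact: measurableD.
  - exact: measurableD.
  - by move=> w [[Aw Cw] nBC]; split => // Bw; exact: nBC.
have h3 : `|a * c - b n * c| <= delta n.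
  rewrite -mulrBl normrM (ger0_norm c0); apply: le_trans (ab n).
  by rewrite ler_piMr.
rewrite (_ : _ - _ = (a * c - b n * c) + (b n * c - fine (P (B n i `&` C i)))
  - (fine (P (A i `&` C i)) - fine (P (B n i `&` C i)))); last first.
  by ring.
have -> : e = e / 3 + e / 3 + e / 3 by field.
apply: le_lt_trans (ler_normB _ _) _; apply: ltrD; last exact: le_lt_trans h2 dn.
apply: le_lt_trans (ler_normD _ _) _; apply: ltrD => //.
exact: le_lt_trans h3 dn.
Unshelve. all: by end_near. Qed.

Let p S := fine (P (X i0 @^-1` S)).

Hypothesis mixingG : forall S S', G S -> G S' ->
  fine (P (X i0 @^-1` S `&` X i @^-1` S')) @[i --> F] --> p S * p S'.

(** The lambda-system argument is run first in [S], with the other set in [G], then in [S']. Closure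
    under increasing unions is an exchange of limits: by stationarity the mass of the union that a
    term misses does not depend on [i], as [mixing_limit] requires. *)
Lemma g_sigma_algebra_mixing S S' : <<s G >> S -> <<s G >> S' ->
  fine (P (X i0 @^-1` S `&` X i @^-1` S')) @[i --> F] --> p S * p S'.
Proof.
have mS := g_sigma_algebra_measurable_preimage.
have sS := g_sigma_algebra_stationary.
have nd (A : (set T)^nat) j : nondecreasing_seq A ->
    nondecreasing_seq (fun n => X j @^-1` A n).
  by move=> ndA m n mn; apply/subsetPset => w; have /subsetPset := ndA _ _ mn; apply.
have p01 A : <<s G >> A -> 0 <= p A <= 1.
  by move=> GA; rewrite prob_ge0 prob_le1//; exact: mS.
have pD A B : <<s G >> A -> <<s G >> B -> B `<=` A -> forall j,
    fine (P (X j @^-1` A `\` X j @^-1` B)) = p A - p B.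
  move=> GA GB BA j; rewrite probD; [|exact: mS..].
  rewrite (_ : _ `&` _ = X j @^-1` B); first by rewrite /p !(sS j).
  by apply: setIidr => w; exact: BA.
have sG : sigma_algebra setT <<s G >> by exact: smallest_sigma_algebra.
have sigT : <<s G >> setT by have [s0 sC _] := sG; rewrite -[X in <<s G >> X]setD0; exact: sC.
have sigD A B : <<s G >> A -> <<s G >> B -> <<s G >> (A `\` B).
  have [s0 sC sU] := sG.
  move=> GA GB; rewrite setDE -(setCK A) -setCU -setTD; apply: (sC).
  rewrite -bigcup2E; apply: sU => -[|[|n]] //=.
  by rewrite -setTD; exact: sC.
have cvgp (A : (set T)^nat) : (forall n, <<s G >> (A n)) -> nondecreasing_seq A ->
    p (\bigcup_n A n) - p (A n) @[n --> \oo] --> (0 : R).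
  move=> GA ndA; rewrite -(subrr (p (\bigcup_n A n))); apply: cvgB; first exact: cvg_cst.
  rewrite {2}/p preimage_bigcup; apply: cvg_prob; last exact: nd.
  by move=> n; exact: mS.
have incl (A : (set T)^nat) n : A n `<=` \bigcup_n A n by exact: bigcup_sup.
have sigU (A : (set T)^nat) : (forall n, <<s G >> (A n)) -> <<s G >> (\bigcup_n A n).
  by case: sG => _ _; apply.
have step1 B : G B -> <<s G >> `<=` [set S | <<s G >> S /\
    fine (P (X i0 @^-1` S `&` X i @^-1` B)) @[i --> F] --> p S * p B].
  move=> GB; have sB : <<s G >> B by exact: sub_sigma_algebra.
  apply: lambda_system_subset => //; last first.
    by move=> A GA; split; [exact: sub_sigma_algebra|exact: mixingG].
  split => //.
  - split; first exact: sigT.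
    rewrite /p preimage_setT probT mul1r.
    under eq_fun do rewrite setTI sS//.
    exact: cvg_cst.
  - move=> A C CA [sA cA] [sC cC]; split; first exact: sigD.
    rewrite (_ : p (A `\` C) * p B = p A * p B - p C * p B); last first.
      by rewrite -mulrBl -(pD A C sA sC CA i0).
    rewrite (_ : (fun i => _) = fun i =>
        fine (P (X i0 @^-1` A `&` X i @^-1` B)) - fine (P (X i0 @^-1` C `&` X i @^-1` B))).
      exact: cvgB.
    apply/funext => i; rewrite (_ : _ `&` _ =
      (X i0 @^-1` A `&` X i @^-1` B) `\` X i0 @^-1` C); last first.
      by apply/seteqP; split => w [[? ?] ?].
    rewrite probD; last 2 first.
    + by apply: measurableI; exact: mS.
    + exact: mS.
    rewrite setIAC; congr (_ - fine (P _)); congr (_ `&` _).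
    by apply: setIidr => w; exact: CA.
  - move=> A ndA HA; have sA n : <<s G >> (A n) by case: (HA n).
    split; first exact: sigU.
    apply: (mixing_limit (A := fun=> X i0 @^-1` (\bigcup_n A n))
      (B := fun n _ => X i0 @^-1` A n) (C := fun i => X i @^-1` B)
      (b := fun n => p (A n)) (delta := fun n => p (\bigcup_n A n) - p (A n))).
    + by move=> _; apply: mS; exact: sigU.
    + by move=> n _; exact: mS.
    + by move=> i; exact: mS.
    + by move=> n _ w Aw; exact: (@incl A n).
    + by move=> n _; rewrite pD//; exact: sigU.
    + exact: cvgp.
    + move=> n; rewrite ger0_norm// subr_ge0; apply: le_prob.
      * exact: mS.
      * by apply: mS; exact: sigU.
      * by move=> w Aw; exact: (@incl A n).
    + exact: p01.
    + by move=> n; case: (HA n).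
move=> sA; move: S'.
suff H : <<s G >> `<=` [set S' | <<s G >> S' /\
    fine (P (X i0 @^-1` S `&` X i @^-1` S')) @[i --> F] --> p S * p S'].
  by move=> S' /H [].
apply: lambda_system_subset => //; last first.
  by move=> B GB; split; [exact: sub_sigma_algebra|case: (step1 B GB S sA)].
split => //.
- split; first exact: sigT.
  rewrite /p preimage_setT probT mulr1.
  under eq_fun do rewrite preimage_setT setIT.
  exact: cvg_cst.
- move=> B C CB [sB cB] [sC cC]; split; first exact: sigD.
  rewrite (_ : p S * p (B `\` C) = p S * p B - p S * p C); last first.
    by rewrite -mulrBr -(pD B C sB sC CB i0).
  rewrite (_ : (fun i => _) = fun i =>
      fine (P (X i0 @^-1` S `&` X i @^-1` B)) - fine (P (X i0 @^-1` S `&` X i @^-1` C))).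
    exact: cvgB.
  apply/funext => i; rewrite -[X i @^-1` (B `\` C)]/(X i @^-1` B `\` X i @^-1` C) setIDA probD; last 2 first.
  + by apply: measurableI; exact: mS.
  + exact: mS.
  rewrite -setIA; congr (_ - fine (P (_ `&` _))).
  by apply: setIidr => w; exact: CB.
- move=> B ndB HB; have sB n : <<s G >> (B n) by case: (HB n).
  split; first exact: sigU.
  under eq_fun do rewrite setIC.
  rewrite mulrC.
  apply: (mixing_limit (A := fun i => X i @^-1` (\bigcup_n B n))
    (B := fun n i => X i @^-1` B n) (C := fun i => X i0 @^-1` S)
    (b := fun n => p (B n)) (delta := fun n => p (\bigcup_n B n) - p (B n))).
  + by move=> i; apply: mS; exact: sigU.
  + by move=> n i; exact: mS.
  + by move=> _; exact: mS.
  + by move=> n i w Bw; exact: (@incl B n).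
  + by move=> n i; rewrite pD//; exact: sigU.
  + exact: cvgp.
  + move=> n; rewrite ger0_norm// subr_ge0; apply: le_prob.
    * exact: mS.
    * by apply: mS; exact: sigU.
    * by move=> w Bw; exact: (@incl B n).
  + exact: p01.
  + by move=> n; under eq_fun do rewrite setIC; rewrite mulrC; case: (HB n).
Qed.

End mixing.
End pi_lambda.

(** * Products of integrals and complements under independence *)

Section independence.
Context {R : realType} {disp : measure_display} {Omega : measurableType disp}.
Variable P : probability Omega R.

Section integral_product.
Context {d1 d2 : measure_display} {T1 : measurableType d1} {T2 : measurableType d2}.
Variables (X : {RV P >-> T1}) (Y : {RV P >-> T2}).
Hypothesis XY : forall A B, measurable A -> measurable B ->
  P (X @^-1` A `&` Y @^-1` B) = (P (X @^-1` A) * P (Y @^-1` B))%E.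
Local Open Scope ereal_scope.

(** Independence identifies the law of the pair with the product of the two laws, and Tonelli's
    theorem separates the variables. *)
Lemma ge0_integral_independentM (g : T1 -> \bar R) (h : T2 -> \bar R) :
  measurable_fun setT g -> measurable_fun setT h ->
  (forall x, 0 <= g x) -> (forall y, 0 <= h y) ->
  \int[P]_w (g (X w) * h (Y w)) = \int[P]_w g (X w) * \int[P]_w h (Y w).
Proof.
move=> mg mh g0 h0.
pose XYf : Omega -> T1 * T2 := fun w => (X w, Y w).
have mXY : measurable_fun setT XYf by apply: measurable_fun_pair.
pose Z : {RV P >-> (T1 * T2)%type} := HB.pack XYf (isMeasurableFun.Build _ _ _ _ XYf mXY).
pose f (z : T1 * T2) := g z.1 * h z.2.
have mf : measurable_fun setT f.
  apply: emeasurable_funM.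
    exact: (measurableT_comp mg measurable_fst).
  exact: (measurableT_comp mh measurable_snd).
have f0 z : 0 <= f z by rewrite mule_ge0.
transitivity (\int[distribution P Z]_z f z).
  by rewrite ge0_integral_distribution.
transitivity (\int[distribution P X \x distribution P Y]_z f z).
  apply: eq_measure_integral => A mA _; apply/esym.
  by apply: product_measure_unique mA => A1 A2 mA1 mA2; rewrite /= /distribution /pushforward -XY.
rewrite fubini_tonelli1//.
transitivity (\int[distribution P X]_x (g x * \int[distribution P Y]_y h y)).
  by apply: eq_integral => x _; rewrite /fubini_F /f /= ge0_integralZl.
rewrite ge0_integralZr//; last exact: integral_ge0.
by rewrite !ge0_integral_distribution.
Qed.

End integral_product.

Section complements.
Context {I : eqType}.
Variable U : I -> set Omega.
Hypothesis mU : forall i, measurable (U i).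

Lemma independent_setC (s t : seq I) : uniq (s ++ t) ->
  (forall r, uniq r -> {subset r <= s ++ t} ->
    fine (P (\big[setI/setT]_(i <- r) U i)) = \prod_(i <- r) fine (P (U i))) ->
  fine (P (\big[setI/setT]_(i <- s) U i `&` \big[setI/setT]_(i <- t) ~` U i)) =
  \prod_(i <- s) fine (P (U i)) * \prod_(i <- t) (1 - fine (P (U i))).
Proof.
elim: t s => [|a t IH] s us indU.
  by move: us indU; rewrite cats0 !big_nil setIT mulr1 => us; apply.
have ust : perm_eq (s ++ a :: t) ((a :: s) ++ t) by rewrite -cat1s perm_catCA.
rewrite !big_cons setICA setIC -setDE probD//; last first.
  by apply: measurableI; apply: bigsetI_measurable => i _ //; exact: measurableC.
rewrite IH; last 2 first.
- by move: us; rewrite (perm_uniq ust) => /andP[].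
- move=> r ur rs; apply: indU => // x /rs; rewrite !mem_cat inE => /orP[->//|->].
  by rewrite !orbT.
rewrite setIC setIA -(big_cons _ _ _ _ xpredT) IH ?big_cons; last 2 first.
- by rewrite -(perm_uniq ust).
- by move=> r ur rs; apply: indU => // x /rs; rewrite (perm_mem ust).
by rewrite mulrBl mul1r mulrBr; congr (_ - _); rewrite mulrCA mulrA.
Qed.

End complements.
End independence.

Definition config (I : Type) (T : pointedType) := I -> T.
HB.instance Definition _ (I : Type) (T : pointedType) :=
  Pointed.copy (config I T) (forall i : I, (fun=> T) i).

Lemma perm_fsetU (I : choiceType) (A B : {fset I}) :
  [disjoint A & B]%fset -> perm_eq (A `|` B)%fset (A ++ B).
Proof.
move=> dAB; apply: uniq_perm => //; last by move=> x; rewrite mem_cat inE.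
rewrite cat_uniq !fset_uniq andbT /=; apply/hasPn => x xB; apply/negP => xA.
by move/fdisjointP : dAB => /(_ x xA) /negP; exact.
Qed.

Lemma ae_forall_countable {d} {T : measurableType d} {R : realType}
    (mu : {measure set T -> \bar R}) (I : countType) (Q : I -> T -> Prop) :
  (forall i, {ae mu, forall x, Q i x}) -> {ae mu, forall x, forall i, Q i x}.
Proof.
move=> H.
have {}H n : {ae mu, forall x, forall i : I, choice.pickle i = n -> Q i x}.
  have [[i <-]|ni] := pselect (exists i : I, choice.pickle i = n).
    by apply: filterS (H i) => x Qx j /(pcan_inj (@choice.pickleK I)) ->.
  by apply: nearW => x i ipn; exfalso; apply: ni; exists i.
by apply: filterS (ae_foralln H) => x Qx i; exact: (Qx (choice.pickle i)).
Qed.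

Section cylinders.
Context {I : choiceType} {dT : measure_display} {T : measurableType dT}.

(** The sides are defined for every index and are the whole space off [J], so that two cylinders are
    intersected side by side. *)
Definition cylinder (D : set I) : set_system (config I T) :=
  [set S | exists (J : {fset I}) (A : I -> set T),
    [/\ forall i, i \in J -> D i, forall i, measurable (A i),
        forall i, i \notin J -> A i = setT &
        S = [set f | forall i, A i (f i)] ] ].

Lemma setI_closed_cylinder D : setI_closed (cylinder D).
Proof.
move=> _ _ [J [A [JD mA AT ->]]] [J' [A' [JD' mA' AT' ->]]].
exists (J `|` J')%fset, (fun i => A i `&` A' i); split.
- by move=> i; rewrite inE => /orP[/JD|/JD'].
- by move=> i; exact: measurableI.
- by move=> i; rewrite inE negb_or => /andP[/AT-> /AT'->]; rewrite setIT.
- apply/seteqP; split => f /=; first by move=> [Af A'f] i; split.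
  by move=> AA'f; split => i; case: (AA'f i).
Qed.

Lemma measurable_coordinate D i : D i ->
  measurable_fun setT (fun f : g_sigma_algebraType (cylinder D) => f i).
Proof.
move=> Di _ A mA; rewrite setTI; apply: sub_sigma_algebra.
exists [fset i]%fset, (fun j => if j == i then A else setT); split.
- by move=> j; rewrite inE => /eqP ->.
- by move=> j; case: ifP.
- by move=> j; rewrite inE => /negbTE ->.
- apply/seteqP; split => f /=; first by move=> Af j; case: eqP => // ->.
  by move=> /(_ i); rewrite eqxx.
Qed.

Lemma preimage_cylinder {Omega : Type} (X : Omega -> config I T) (J : {fset I})
    (A : I -> set T) : (forall i, i \notin J -> A i = setT) ->
  X @^-1` [set f | forall i, A i (f i)] =
  \bigcap_(i in [set` J]) ((fun w => X w i) @^-1` A i).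
Proof.
move=> AT; apply/seteqP; split => w /=; first by move=> Aw i _; exact: Aw.
by move=> Aw i; have [/Aw//|/AT ->] := boolP (i \in J).
Qed.

Context {disp : measure_display} {Omega : measurableType disp}.

Lemma measurable_config D (X : Omega -> config I T) :
  (forall i, D i -> measurable_fun setT (fun w => X w i)) ->
  measurable_fun setT (X : Omega -> g_sigma_algebraType (cylinder D)).
Proof.
move=> mX; apply: (@measurability _ _ Omega (g_sigma_algebraType (cylinder D)) _ _
  (cylinder D)) => //.
move=> _ [_ [J [A [JD mA AT ->]]] <-]; rewrite setTI (preimage_cylinder X AT).
rewrite bigcap_seq big_seq; apply: bigsetI_measurable => i iJ.
by rewrite -[X in measurable X]setTI; apply: mX => //; exact: JD.
Qed.

Lemma prob_cylinder {R : realType} (P : probability Omega R) (D : set I)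
    (X : I -> Omega -> T) (J : {fset I}) (A : I -> set T) :
  mutually_independent P D (fun i => g_sigma_algebra_preimage (X i)) ->
  (forall i, i \in J -> D i) -> (forall i, measurable (A i)) ->
  P (\bigcap_(i in [set` J]) (X i @^-1` A i)) =
  (\prod_(i <- J) P (X i @^-1` A i))%E.
Proof.
move=> indX JD mA; apply: indX => i iJ; split; first exact: JD.
by exists (A i) => //; rewrite setTI.
Qed.

Lemma has_law_preimage {R : realType} (P : probability Omega R)
    (D : set I) (X : I -> Omega -> T) mu i (A : set T) :
  iid P D X mu -> D i -> measurable A -> P (X i @^-1` A) = mu A.
Proof. by move=> [lawX _] Di mA; exact: lawX. Qed.

Lemma independent_config {R : realType} (P : probability Omega R)
    (D D1 D2 : set I) (X : I -> Omega -> T) :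
  (forall i, measurable_fun setT (X i)) ->
  mutually_independent P D (fun i => g_sigma_algebra_preimage (X i)) ->
  D1 `<=` D -> D2 `<=` D -> D1 `&` D2 = set0 ->
  forall S1 S2, <<s cylinder D1 >> S1 -> <<s cylinder D2 >> S2 ->
  P ((fun w i => X i w) @^-1` S1 `&` (fun w i => X i w) @^-1` S2) =
  (P ((fun w i => X i w) @^-1` S1) * P ((fun w i => X i w) @^-1` S2))%E.
Proof.
move=> mX indX D1D D2D D12 S1 S2 s1 s2.
pose X' : Omega -> config I T := fun w i => X i w.
pose G E := preimage_set_system setT X' (cylinder E).
have GI E : setI_closed (G E).
  move=> _ _ [A cA <-] [B cB <-]; exists (A `&` B).
    exact: setI_closed_cylinder.
  by rewrite !setTI.
have GM E : G E `<=` measurable.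
  move=> _ [A cA <-].
  have mX' : measurable_fun setT (X' : Omega -> g_sigma_algebraType (cylinder E)).
    by apply: measurable_config => i _; exact: mX.
  by apply: mX' => //; exact: sub_sigma_algebra.
have sG E S : <<s cylinder E >> S -> <<s G E >> (X' @^-1` S).
  by move=> sS; rewrite g_sigma_preimageE; exists S => //; rewrite setTI.
apply: (@independent_g_sigma_algebra _ _ _ P (G D1) (G D2)) => //; last 2 first.
- exact: sG.
- exact: sG.
move=> _ _ [_ [J1 [A1 [J1D mA1 AT1 ->]]] <-] [_ [J2 [A2 [J2D mA2 AT2 ->]]] <-].
rewrite !setTI (preimage_cylinder X' AT1) (preimage_cylinder X' AT2) /X' /=.
have dJ : [disjoint J1 & J2]%fset.
  apply/fdisjointP => i /J1D i1; apply/negP => /J2D i2.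
  by have : (D1 `&` D2) i by []; rewrite D12.
(* As [J1] and [J2] are disjoint, their sides glue into one family, and mutual independence is
   applied once to the union. *)
pose A i := if i \in J1 then A1 i else A2 i.
have mA i : measurable (A i) by rewrite /A; case: ifP.
rewrite (_ : _ `&` _ = \bigcap_(i in [set` (J1 `|` J2)%fset]) (X i @^-1` A i)); last first.
  apply/seteqP; split => w /=.
    move=> [w1 w2] i /=; rewrite inE /A; have [iJ1 _|iJ1 /= iJ2] := boolP (i \in J1).
      exact: w1.
    exact: w2.
  move=> wA; split => i /= iJ.
    by have := wA i; rewrite /= inE iJ /A iJ; apply.
  have := wA i; rewrite /= inE iJ orbT /A ifF; first by apply.
  apply/negbTE; apply/negP => iJ1.
  by move/fdisjointP : dJ => /(_ i iJ1); rewrite iJ.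
rewrite (prob_cylinder indX)//; last first.
  by move=> i; rewrite inE => /orP[/J1D/D1D|/J2D/D2D].
rewrite (prob_cylinder indX)//; last by move=> i /J1D/D1D.
rewrite (prob_cylinder indX)//; last by move=> i /J2D/D2D.
rewrite (perm_big _ (perm_fsetU dJ)) big_cat /=; congr (_ * _)%E.
  by rewrite !big_seq; apply: eq_bigr => i iJ; rewrite /A iJ.
rewrite !big_seq; apply: eq_bigr => i iJ; rewrite /A ifF//.
apply/negbTE; apply/negP => iJ1.
by move/fdisjointP : dJ => /(_ i iJ1); rewrite iJ.
Qed.

End cylinders.

(** * Joint laws of finitely many edges *)

Section edges.
Context {R : realType} {d : nat}.
Notation vertex := 'rV[int]_d.
Implicit Types (x y u v : vertex) (e : {fset vertex}) (f : vertex -> R).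

Lemma pairsP e : pairs e -> exists x y, x != y /\ e = [fset x; y]%fset.
Proof.
rewrite /pairs /= => se; have [x [y eE]] : exists x y, enum_fset e = [:: x; y].
  by move: se; case: (enum_fset e) => [|x [|y [|z s]]] // _; exists x, y.
exists x, y; split.
  by have := fset_uniq e; rewrite eE /= inE andbT.
by apply/fsetP => z; rewrite !inE -[z \in e]/(z \in enum_fset e) eE !inE.
Qed.

Lemma enum_fset2 x y : x != y ->
  enum_fset [fset x; y]%fset = [:: x; y] \/ enum_fset [fset x; y]%fset = [:: y; x].
Proof.
move=> xy; have : pairs [fset x; y]%fset by rewrite /pairs /= cardfs2 xy.
rewrite /pairs /=; have := fset_uniq [fset x; y]%fset.
case E : (enum_fset _) => [|a [|b [|]]] //= ab _.
have abE z : (z \in [:: a; b]) = (z == x) || (z == y).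
  by transitivity (z \in [fset x; y]%fset); [rewrite -E|rewrite !inE].
have := abE a; have := abE b; move: ab; rewrite !inE !eqxx andbT orbT => ab.
by move=> /esym/orP[]/eqP bE /esym/orP[]/eqP aE; subst a b;
  rewrite ?eqxx // in ab *; [right|left].
Qed.

Lemma enormN x : enorm (R := R) (- x) = enorm x.
Proof.
by congr Num.sqrt; apply: eq_bigr => i _; rewrite mxE rmorphN sqrrN.
Qed.

Lemma enormBC x y : enorm (R := R) (x - y) = enorm (y - x).
Proof. by rewrite -enormN opprB. Qed.

Lemma edge_probE alpha lambda f x y : x != y ->
  edge_prob alpha lambda f [fset x; y]%fset =
  if enorm (x - y) == 1 :> R then 1
  else 1 - expR (- (lambda * f x * f y / enorm (x - y) `^ alpha)).
Proof.
move=> xy; rewrite /edge_prob; cbv zeta.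
have [[-> ->]|[-> ->]] : let e := enum_fset [fset x; y]%fset in
    (e`_0 = x /\ e`_1 = y) \/ (e`_0 = y /\ e`_1 = x).
  by case: (enum_fset2 xy) => ->; [left|right].
- by [].
- by rewrite (enormBC y x) (mulrAC lambda).
Qed.

Definition fshift x e : {fset vertex} := [fset (v + x)%R | v in e]%fset.

Lemma fshift2 x u v : fshift x [fset u; v]%fset = [fset (u + x)%R; (v + x)%R]%fset.
Proof. by rewrite /fshift imfsetU !imfset_fset1. Qed.

Lemma fshiftK x : cancel (fshift x) (fshift (- x)).
Proof.
move=> e; rewrite /fshift -imfset_comp -[RHS]imfset_id.
by apply: eq_imfset => // v /=; rewrite addrK.
Qed.

Lemma fshift_inj x : injective (fshift x).
Proof. exact: can_inj (fshiftK x). Qed.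

Lemma pairs_fshift x e : pairs e -> pairs (fshift x e).
Proof.
move=> /pairsP[u [v [uv ->]]].
by rewrite fshift2 /pairs /= cardfs2 (inj_eq (addIr x)) uv.
Qed.

Lemma edge_prob_fshift alpha lambda f x e : pairs e ->
  edge_prob alpha lambda f (fshift x e) =
  edge_prob alpha lambda (fun v => f (v + x)) e.
Proof.
move=> /pairsP[u [v [uv ->]]]; rewrite fshift2 (edge_probE _ _ _ uv) edge_probE.
  by rewrite opprD addrACA subrr addr0.
by rewrite (inj_eq (addIr x)).
Qed.

Lemma edge_prob_ge0 alpha lambda f e : pairs e -> 0 <= lambda ->
  (forall v, 0 <= f v) -> 0 <= edge_prob alpha lambda f e.
Proof.
move=> /pairsP[u [v [uv ->]]] l0 f0; rewrite edge_probE//; case: ifP => // _.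
rewrite subr_ge0 -expR0 ler_expR oppr_le0.
by rewrite divr_ge0 ?powR_ge0// !mulr_ge0.
Qed.

Lemma measurable_edge_prob {disp : measure_display} {Omega : measurableType disp}
    alpha lambda (W : vertex -> Omega -> R) e : pairs e ->
  (forall v, v \in e -> measurable_fun setT (W v)) ->
  measurable_fun setT (fun w => edge_prob alpha lambda (W^~ w) e).
Proof.
move=> /pairsP[u [v [uv ->]]] mW; under eq_fun do rewrite (edge_probE _ _ _ uv).
have [E|E] := boolP (enorm (u - v) == 1 :> R); first exact: measurable_cst.
apply: measurable_funB; first exact: measurable_cst.
suff mE : measurable_fun setT
    (fun w => - (lambda * W u w * W v w / enorm (u - v) `^ alpha)).
  exact: (measurableT_comp (@measurable_expR R) mE).
apply: measurable_funN; apply: measurable_funM; last exact: measurable_cst.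
apply: measurable_funM; last by apply: mW; rewrite !inE eqxx orbT.
apply: measurable_funM; first exact: measurable_cst.
by apply: mW; rewrite !inE eqxx.
Qed.

End edges.

Lemma measurable_prod_edge_prob {R : realType} {d : nat} {disp : measure_display}
    {Omega : measurableType disp} (alpha lambda : R) (f : 'rV[int]_d -> Omega -> R)
    (s : seq {fset 'rV[int]_d}) :
  (forall e, e \in s -> pairs e) ->
  (forall e v, e \in s -> v \in e -> measurable_fun setT (f v)) ->
  measurable_fun setT (fun w => \prod_(e <- s) edge_prob alpha lambda (f^~ w) e).
Proof.
elim: s => [|e s IH] ps mf.
  by under eq_fun do rewrite big_nil; exact: measurable_cst.
under eq_fun do rewrite big_cons.
have es : e \in e :: s by rewrite inE eqxx.
apply: measurable_funM.
  by apply: measurable_edge_prob; [exact: ps|move=> v; exact: mf].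
by apply: IH => [e' e's|e' v e's]; [apply: ps|apply: mf]; rewrite inE e's orbT.
Qed.

Section percolation.
Context {R : realType} {d : nat} {alpha lambda : R} {lawW lawL : probability R R}
  {disp : measure_display} {Omega : measurableType disp}
  {P : probability Omega R} {W : 'rV[int]_d -> {RV P >-> R}}
  {conn : {fset 'rV[int]_d} -> {RV P >-> bool}}
  {L : {fset 'rV[int]_d} -> {RV P >-> R}}.
Notation vertex := 'rV[int]_d.
Hypothesis lambda_gt0 : 0 < lambda.
Hypothesis lawW_ge1 : lawW `[1, +oo[%classic = 1%E.
Hypothesis sfp : is_SFP alpha lambda lawW lawL W conn L.
Implicit Types (E F : {fset {fset vertex}}) (e : {fset vertex}) (x : vertex).

Lemma ae_W_ge1 : {ae P, forall w v, 1 <= W v w}.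
Proof.
apply: ae_forall_countable => v.
have mA : measurable (W v @^-1` `[1, +oo[).
  by rewrite -[X in measurable X]setTI; exact: measurable_funPT.
exists (~` (W v @^-1` `[1, +oo[)); split.
- exact: measurableC.
- have : P (~` (W v @^-1` `[1, +oo[)) = 0%E; last exact.
  by rewrite probability_setC// (has_law_preimage (sfp_W sfp))// lawW_ge1 subee.
- by move=> w /= nw; rewrite in_itv /= andbT.
Qed.

(* Absolute values make this nonnegative for all weights, not only for almost all. *)
Definition edges_prob E (f : vertex -> R) : R :=
  \prod_(e <- E) edge_prob alpha lambda (fun v => `|f v|) e.

Lemma edges_prob_ge0 E f : (forall e, e \in E -> pairs e) -> 0 <= edges_prob E f.
Proof.
move=> pE; rewrite /edges_prob big_seq prodr_ge0// => e eE.
by apply: edge_prob_ge0 => //; [exact: pE|exact: ltW].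
Qed.

Lemma measurable_edges_prob {disp' : measure_display}
    {Omega' : measurableType disp'} (f : vertex -> Omega' -> R) E :
  (forall e, e \in E -> pairs e) ->
  (forall e v, e \in E -> v \in e -> measurable_fun setT (f v)) ->
  measurable_fun setT (fun w => edges_prob E (f^~ w)).
Proof.
move=> pE mf; apply: (measurable_prod_edge_prob _ _ (f := fun v w => `|f v w|)) => //.
move=> e v eE ve; apply: (measurableT_comp (@normr_measurable R setT)).
exact: mf eE ve.
Qed.

Lemma prob_edges A E : sigma_family setT (fun x => W x : Omega -> R) A ->
  (forall e, e \in E -> pairs e) ->
  P (A `&` \bigcap_(e in [set` E]) [set w | conn e w]) =
  (\int[P]_(w in A) (edges_prob E (fun x => W x w))%:E)%E.
Proof.
move=> sA pE; rewrite (sfp_conn sfp)//.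
have mA : measurable A.
  move: A sA; apply: smallest_sub; first exact: sigma_algebra_measurable.
  move=> _ [v _ [B mB <-]]; rewrite setTI -[X in measurable X]setTI.
  exact: measurable_funPT.
apply: ae_eq_integral => //.
- apply/measurable_EFinP/measurable_funTS.
  by apply: (measurable_prod_edge_prob _ _ (f := fun v w => W v w)).
- apply/measurable_EFinP/measurable_funTS; apply: measurable_edges_prob => //.
- apply: filterS ae_W_ge1 => w W1 _; congr EFin.
  apply: eq_bigr => e _; congr edge_prob; apply/funext => v.
  by rewrite ger0_norm// (le_trans ler01).
Qed.

(** The annealed probability of the edges of [E]: the vertex weights are averaged out. *)
Definition prob_conn E : \bar R := (\int[P]_w (edges_prob E (fun x => W x w))%:E)%E.

Lemma prob_connE E : (forall e, e \in E -> pairs e) ->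
  P (\bigcap_(e in [set` E]) [set w | conn e w]) = prob_conn E.
Proof.
move=> pE; rewrite /prob_conn -(prob_edges _ pE) ?setTI//.
by have [s0 sC _] : sigma_algebra setT
    (sigma_family setT (fun x => W x : Omega -> R)) by [exact: smallest_sigma_algebra];
  rewrite -[X in sigma_family _ _ X]setD0; exact: sC.
Qed.

(** Edges are correlated only through the weights of common endpoints. Here the two products depend
    on disjoint families of independent weights, so the factorisation is exact. *)
Lemma prob_connM E F : (forall e, e \in E -> pairs e) ->
  (forall e, e \in F -> pairs e) ->
  (forall e e', e \in E -> e' \in F -> [disjoint e & e']%fset) ->
  prob_conn (E `|` F)%fset = (prob_conn E * prob_conn F)%E.
Proof.
move=> pE pF dEF.
have dfset : [disjoint E & F]%fset.
  apply/fdisjointP => e eE; apply/negP => eF.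
  have /pairsP[u [v [uv eE']]] := pE _ eE.
  have /fdisjointP/(_ u) := dEF _ _ eE eF; rewrite eE' !inE eqxx /=.
  by move=> /(_ isT).
pose DE : set vertex := [set v | exists2 e, e \in E & v \in e].
pose DF : set vertex := [set v | exists2 e, e \in F & v \in e].
have DEF : DE `&` DF = set0.
  apply/seteqP; split => // v [[e eE ve] [e' e'F ve']].
  by have /fdisjointP/(_ v ve) := dEF _ _ eE e'F; rewrite ve'.
pose X : Omega -> config vertex R := fun w v => W v w.
have mX D : measurable_fun setT (X : Omega -> g_sigma_algebraType (cylinder D)).
  by apply: measurable_config => v _; exact: measurable_funPT.
pose X1 : {RV P >-> g_sigma_algebraType (cylinder DE)} :=
  HB.pack X (isMeasurableFun.Build _ _ _ _ _ (mX DE)).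
pose X2 : {RV P >-> g_sigma_algebraType (cylinder DF)} :=
  HB.pack X (isMeasurableFun.Build _ _ _ _ _ (mX DF)).
have mprob E' D : (forall e, e \in E' -> pairs e) ->
    (forall e v, e \in E' -> v \in e -> D v) ->
    measurable_fun setT (fun f : g_sigma_algebraType (cylinder D) =>
      (edges_prob E' f)%:E).
  move=> pE' E'D; apply/measurable_EFinP.
  apply: (measurable_edges_prob (f := fun v (f : g_sigma_algebraType (cylinder D)) => f v)) => //.
  by move=> e v eE' ve; apply: measurable_coordinate; exact: E'D ve.
have := @ge0_integral_independentM _ _ _ P _ _ _ _ X1 X2 _
  (fun f => (edges_prob E f)%:E) (fun f => (edges_prob F f)%:E).
rewrite /prob_conn => <-.
- apply: eq_integral => w _; rewrite -EFinM; congr EFin.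
  by rewrite /edges_prob (perm_big _ (perm_fsetU dfset)) big_cat.
- move=> A B mA mB; have [_ indW] := sfp_W sfp.
  exact: (independent_config (D := setT) _ indW _ _ DEF).
- by apply: mprob => // e v eE ve; exists e.
- by apply: mprob => // e v eF ve; exists e.
- by move=> f; rewrite lee_fin edges_prob_ge0.
- by move=> f; rewrite lee_fin edges_prob_ge0.
Qed.

Definition fshifts x E : {fset {fset vertex}} := [fset fshift x e | e in E]%fset.

Lemma pairs_fshifts x E : (forall e, e \in E -> pairs e) ->
  forall e, e \in fshifts x E -> pairs e.
Proof. by move=> pE _ /imfsetP[e eE ->]; apply/pairs_fshift/pE. Qed.

Lemma edges_prob_fshifts x E f : (forall e, e \in E -> pairs e) ->
  edges_prob (fshifts x E) f = edges_prob E (fun v => f (v + x)).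
Proof.
move=> pE; rewrite /edges_prob big_imfset /=; last by move=> e e' _ _ /fshift_inj.
apply: eq_big_seq => e eE.
by rewrite (edge_prob_fshift _ _ _ _ (pE _ eE)).
Qed.

(** Shifting the edges amounts to shifting the weights, and a shifted i.i.d. family has the same
    law, which is checked on cylinders. *)
Lemma prob_conn_fshifts x E : (forall e, e \in E -> pairs e) ->
  prob_conn (fshifts x E) = prob_conn E.
Proof.
move=> pE; pose X x : Omega -> config vertex R := fun w v => W (v + x) w.
pose T := g_sigma_algebraType (cylinder (T := R) [set: vertex]).
have mX y : measurable_fun setT (X y : Omega -> T).
  by apply: measurable_config => v _; exact: measurable_funPT.
pose Y y : {RV P >-> T} := HB.pack (X y) (isMeasurableFun.Build _ _ _ _ _ (mX y)).
have mg : measurable_fun setT (fun f : T => (edges_prob E f)%:E).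
  apply/measurable_EFinP.
  apply: (measurable_edges_prob (f := fun v (f : T) => f v)) => //.
  by move=> e v _ _; exact: measurable_coordinate.
have g0 (f : T) : (0 <= (edges_prob E f)%:E)%E by rewrite lee_fin edges_prob_ge0.
have distE y : (\int[P]_w (edges_prob E (X y w))%:E =
    \int[distribution P (Y y)]_f (edges_prob E f)%:E)%E.
  by rewrite ge0_integral_distribution.
rewrite /prob_conn; under eq_integral do rewrite edges_prob_fshifts//.
transitivity (\int[P]_w (edges_prob E (X 0 w))%:E)%E; last first.
  by apply: eq_integral => w _; congr (edges_prob E _)%:E; apply/funext => v; rewrite /X addr0.
rewrite -[LHS]/(\int[P]_w (edges_prob E (X x w))%:E)%E !distE.
apply: eq_measure_integral => A mA _.
apply: (g_sigma_algebra_stationary (G := cylinder [set: vertex]) (X := X)) => //.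
- exact: setI_closed_cylinder.
- move=> y S cS; rewrite -[X in measurable X]setTI; apply: (mX y) => //.
  exact: sub_sigma_algebra.
move=> y _ [J [B [_ mB BT ->]]]; rewrite !(preimage_cylinder _ BT).
have [lawWE indW] := sfp_W sfp.
have XE z : \bigcap_(v in [set` J]) ((fun w => X z w v) @^-1` B v) =
    \bigcap_(v in [set` [fset (v + z)%R | v in J]%fset]) (W v @^-1` B (v - z)).
  apply/seteqP; split => w Hw v /=.
    by move=> /imfsetP[u uJ ->]; rewrite addrK; exact: Hw.
  move=> vJ; rewrite /X /= -{1}(addrK z v); apply: (Hw (v + z)) => /=.
  by apply/imfsetP; exists v.
rewrite !XE !(prob_cylinder indW)//; do ?[by move=> v; exact: mB].
rewrite !big_imfset /=; do ?[by move=> u v _ _ /addIr].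
apply: eq_bigr => v _; rewrite !addrK.
by rewrite !(has_law_preimage (sfp_W sfp)).
Qed.

End percolation.

Lemma near_enorm_infty_notin {R : realType} {d : nat} (s : seq 'rV[int]_d) :
  \forall x \near enorm_infty R d, x \notin s.
Proof.
elim: s => [|v s IH]; first by exists 0.
have v_near : \forall x \near enorm_infty R d, x != v.
  by exists (enorm v) => x; apply: contraTN => /eqP ->; rewrite ltxx.
near=> x; rewrite inE negb_or; apply/andP; split.
  by near: x.
by near: x.
Unshelve. all: by end_near. Qed.

(** * The configuration seen from a vertex *)

Section field.
Context {R : realType} {d : nat}.
Notation vertex := 'rV[int]_d.
Implicit Types (E F : {fset {fset vertex}}) (e : {fset vertex}) (x : vertex).

(* Only events asking edges to be present are used: they form a pi-system whose
   probabilities are given directly by [sfp_conn]. *)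
Definition field_cylinder : set_system (config {fset vertex} (bool * R)%type) :=
  [set S | exists E F (A : {fset vertex} -> set R),
    [/\ forall e, e \in E -> pairs e, forall e, e \in F -> pairs e,
        forall e, measurable (A e), forall e, e \notin F -> A e = setT &
        S = [set c : config {fset vertex} (bool * R)%type | (forall e, e \in E -> (c e).1) /\ forall e, A e (c e).2] ] ].

Lemma setI_closed_field_cylinder : setI_closed field_cylinder.
Proof.
move=> _ _ [E [F [A [pE pF mA AT ->]]]] [E' [F' [A' [pE' pF' mA' AT' ->]]]].
exists (E `|` E')%fset, (F `|` F')%fset, (fun e => A e `&` A' e); split.
- by move=> e; rewrite inE => /orP[/pE|/pE'].
- by move=> e; rewrite inE => /orP[/pF|/pF'].
- by move=> e; exact: measurableI.
- by move=> e; rewrite inE negb_or => /andP[/AT-> /AT'->]; rewrite setIT.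
apply/seteqP; split => c /=.
  move=> [[c1 c2] [c3 c4]]; split => e; last by split.
  by rewrite inE => /orP[/c1|/c3].
move=> [c1 c2]; split; split => e.
- by move=> eE; apply: c1; rewrite inE eE.
- by case: (c2 e).
- by move=> eE; apply: c1; rewrite inE eE orbT.
- by case: (c2 e).
Qed.

Definition field_config := g_sigma_algebraType field_cylinder.

(** The cylinders constrain coordinates in [pairs] only, so the other coordinates get a constant
    value to keep the maps measurable; [field_L] is guarded in the same way. *)
Definition field_conn e (c : field_config) : bool := (#|` e|%fset == 2%N) && (c e).1.

(* The absolute value makes the weights of the abstract configuration nonnegative
   everywhere; those of the percolation are nonnegative already. *)
Definition field_L e (c : field_config) : R :=
  if (#|` e|%fset == 2%N) then `|(c e).2| else 0.

Lemma measurable_field_conn e : measurable_fun setT (field_conn e).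
Proof.
rewrite /field_conn; have [pe|pe] := boolP (#|` e|%fset == 2%N); last exact: measurable_cst.
apply: (measurable_fun_bool true) => /=; rewrite setTI.
apply: sub_sigma_algebra; exists [fset e]%fset, fset0, (fun=> setT); split => //.
  by move=> e'; rewrite inE => /eqP ->; exact/eqP.
apply/seteqP; split => c /=; first by move=> ce; split => // e'; rewrite inE => /eqP ->.
by move=> [+ _]; apply; rewrite inE.
Qed.

Lemma measurable_field_L e : measurable_fun setT (field_L e).
Proof.
rewrite /field_L; have [pe|pe] := boolP (#|` e|%fset == 2%N); last exact: measurable_cst.
suff mc : measurable_fun setT (fun c : field_config => (c e).2).
  exact: (measurableT_comp (@normr_measurable R setT)).
move=> _ A mA; rewrite setTI.
apply: sub_sigma_algebra.
exists fset0, [fset e]%fset, (fun e' => if e' == e then A else setT); split => //.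
- by move=> e'; rewrite inE => /eqP ->; exact/eqP.
- by move=> e'; case: ifP.
- by move=> e'; rewrite inE => /negbTE ->.
apply/seteqP; split => c /=; first by move=> Ac; split => // e'; case: eqP => // ->.
by move=> [_ /(_ e)]; rewrite eqxx.
Qed.

Lemma field_L_ge0 e (c : field_config) : pairs e -> 0 <= field_L e c.
Proof. by rewrite /field_L /pairs /= => ->; rewrite eqxx. Qed.

End field.

Section percolation_field.
Context {R : realType} {d : nat} {alpha lambda : R} {lawW lawL : probability R R}
  {disp : measure_display} {Omega : measurableType disp}
  {P : probability Omega R} {W : 'rV[int]_d -> {RV P >-> R}}
  {conn : {fset 'rV[int]_d} -> {RV P >-> bool}}
  {L : {fset 'rV[int]_d} -> {RV P >-> R}}.
Notation vertex := 'rV[int]_d.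
Hypothesis lambda_gt0 : 0 < lambda.
Hypothesis lawW_ge1 : lawW `[1, +oo[%classic = 1%E.
Hypothesis sfp : is_SFP alpha lambda lawW lawL W conn L.
Implicit Types (E F : {fset {fset vertex}}) (e : {fset vertex}) (x : vertex).
Notation prob_conn := (@prob_conn R d alpha lambda disp Omega P W).

Definition conn_event E : set Omega := \bigcap_(e in [set` E]) [set w | conn e w].

Definition weight_event F (A : {fset vertex} -> set R) : set Omega :=
  \bigcap_(e in [set` F]) (L e @^-1` A e).

Lemma measurable_conn_event E : measurable (conn_event E).
Proof.
rewrite /conn_event bigcap_seq; apply: bigsetI_measurable => e _.
rewrite (_ : mkset _ = conn e @^-1` [set true])//.
by rewrite -[X in measurable X]setTI; exact: measurable_funPT.
Qed.

Lemma measurable_weight_event F A : (forall e, measurable (A e)) ->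
  measurable (weight_event F A).
Proof.
move=> mA; rewrite /weight_event bigcap_seq; apply: bigsetI_measurable => e _.
by rewrite -[X in measurable X]setTI; exact: measurable_funPT.
Qed.

Lemma prob_field_event E F A : (forall e, e \in E -> pairs e) ->
  (forall e, e \in F -> pairs e) -> (forall e, measurable (A e)) ->
  P (conn_event E `&` weight_event F A) =
  (prob_conn E * \prod_(e <- F) lawL (A e))%E.
Proof.
move=> pE pF mA; rewrite setIC (sfp_L_indep sfp).
- rewrite (prob_connE lawW_ge1 sfp)// muleC; congr (_ * _)%E.
  have [lawLE indL] := sfp_L sfp.
  rewrite /weight_event (prob_cylinder indL)//.
  apply: eq_big_seq => e eF; exact: (lawLE _ (pF _ eF)).
- pose M := g_sigma_algebraType (\bigcup_(e in pairs) g_sigma_algebra_preimage (L e)).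
  rewrite /weight_event bigcap_seq big_seq.
  apply: (@bigsetI_measurable _ M) => e eF.
  apply: sub_sigma_algebra; exists e; first exact: pF.
  by exists (A e) => //; rewrite setTI.
- pose G := sigma_family setT (fun x => W x : Omega -> R) `|`
    sigma_family pairs (fun e => conn e : Omega -> bool).
  pose M := g_sigma_algebraType G.
  rewrite /conn_event bigcap_seq big_seq.
  apply: (@bigsetI_measurable _ M) => e eE.
  apply: sub_sigma_algebra; right.
  apply: sub_sigma_algebra; exists e; first exact: pE.
  by exists [set true] => //; rewrite setTI.
Qed.

Definition field x : Omega -> config {fset vertex} (bool * R)%type :=
  fun w e => (conn (fshift x e) w, L (fshift x e) w).

Lemma preimage_field x E F (A : {fset vertex} -> set R) :
  (forall e, e \notin F -> A e = setT) ->
  field x @^-1` [set c : config {fset vertex} (bool * R)%type | (forall e, e \in E -> (c e).1) /\ forall e, A e (c e).2] =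
  conn_event (fshifts x E) `&` weight_event (fshifts x F) (A \o fshift (- x)).
Proof.
move=> AT; apply/seteqP; split => w /=.
  move=> [wE wA]; split => e /= /imfsetP[e' /= e'E ->]; first exact: wE.
  by rewrite fshiftK; exact: wA.
move=> [wE wA]; split => e.
  by move=> eE; apply: wE; apply/imfsetP; exists e.
have [eF|/AT ->//] := boolP (e \in F).
have := wA (fshift x e); rewrite /= fshiftK; apply.
by apply/imfsetP; exists e.
Qed.

Lemma measurable_field_cylinder x S : field_cylinder S -> measurable (field x @^-1` S).
Proof.
move=> [E [F [A [pE pF mA AT ->]]]]; rewrite (preimage_field _ _ AT).
apply: measurableI; first exact: measurable_conn_event.
by apply: measurable_weight_event => e; exact: mA.
Qed.

Lemma prob_field_cylinder x E F (A : {fset vertex} -> set R) :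
  (forall e, e \in E -> pairs e) -> (forall e, e \in F -> pairs e) ->
  (forall e, measurable (A e)) ->
  P (conn_event (fshifts x E) `&` weight_event (fshifts x F) (A \o fshift (- x))) =
  (prob_conn E * \prod_(e <- F) lawL (A e))%E.
Proof.
move=> pE pF mA; rewrite prob_field_event//; do ?exact: pairs_fshifts.
rewrite (prob_conn_fshifts lambda_gt0 sfp)//; congr (_ * _)%E.
rewrite big_imfset /=; last by move=> e e' _ _ /fshift_inj.
  by apply: eq_bigr => e _; rewrite fshiftK.
by move=> e; exact: mA.
Qed.

Lemma field_cylinder_stationary x S : field_cylinder S ->
  P (field x @^-1` S) = P (field 0 @^-1` S).
Proof.
move=> [E [F [A [pE pF mA AT ->]]]]; rewrite !(preimage_field _ _ AT).
by rewrite !prob_field_cylinder.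
Qed.

Lemma pairs_disjoint E F : (forall e, e \in E -> pairs e) ->
  (forall e e', e \in E -> e' \in F -> [disjoint e & e']%fset) ->
  [disjoint E & F]%fset.
Proof.
move=> pE dEF; apply/fdisjointP => e eE; apply/negP => eF.
have /pairsP[u [v [uv eE']]] := pE _ eE.
have /fdisjointP/(_ u) := dEF _ _ eE eF; rewrite eE' !inE eqxx /=.
by move=> /(_ isT).
Qed.

(** Translates can meet only if [x] is one of the finitely many differences of a vertex of [E] and a
    vertex of [F]. *)
Lemma fshift_disjoint_near E F : \forall x \near enorm_infty R d,
  forall e e', e \in fshifts 0 E -> e' \in fshifts x F -> [disjoint e & e']%fset.
Proof.
pose vs (G : {fset {fset vertex}}) : seq vertex := flatten [seq enum_fset e | e <- enum_fset G].
have vsP (G : {fset {fset vertex}}) e v : e \in G -> v \in e -> v \in vs G.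
  by move=> eG ve; apply/flattenP; exists (enum_fset e) => //; apply: map_f.
apply: filterS (near_enorm_infty_notin [seq u - v | u <- vs E, v <- vs F]) => x xN.
move=> _ _ /imfsetP[e eE ->] /imfsetP[e' e'F ->].
apply/fdisjointP => _ /imfsetP[u /= ue ->]; apply/negP => /imfsetP[v /= ve'].
rewrite addr0 => uE; move/negP : xN; apply; apply/allpairsP; exists (u, v) => /=.
by split; [exact: vsP ue|exact: vsP ve'|rewrite uE addrAC subrr add0r].
Qed.

(** Two cylinders see finitely many vertices. Once [x] is far enough for these to be disjoint the
    probability factorises, so the function is eventually constant. *)
Lemma field_cylinder_mixing S S' : field_cylinder S -> field_cylinder S' ->
  fine (P (field 0 @^-1` S `&` field x @^-1` S')) @[x --> enorm_infty R d] -->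
  fine (P (field 0 @^-1` S)) * fine (P (field 0 @^-1` S')).
Proof.
move=> [E [F [A [pE pF mA AT ->]]]] [E' [F' [A' [pE' pF' mA' AT' ->]]]].
apply: cvg_near_cst; near=> x.
have dE : forall e e', e \in fshifts 0 E -> e' \in fshifts x E' -> [disjoint e & e']%fset.
  by near: x; exact: fshift_disjoint_near.
have dF : forall e e', e \in fshifts 0 F -> e' \in fshifts x F' -> [disjoint e & e']%fset.
  by near: x; exact: fshift_disjoint_near.
rewrite !(preimage_field _ _ AT) !(preimage_field _ _ AT').
rewrite !prob_field_cylinder// setIACA.
have dFs := pairs_disjoint (pairs_fshifts pF) dF.
pose B e := if e \in fshifts 0 F then A (fshift (- 0) e) else A' (fshift (- x) e).
have mB e : measurable (B e) by rewrite /B; case: ifP.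
rewrite (_ : conn_event _ `&` conn_event _ =
    conn_event (fshifts 0 E `|` fshifts x E')%fset); last first.
  apply/seteqP; split => w /=.
    by move=> [w1 w2] e /=; rewrite inE => /orP[/w1|/w2].
  by move=> wE; split => e /= eE; apply: wE; rewrite /= inE eE ?orbT.
rewrite (_ : weight_event _ _ `&` weight_event _ _ =
    weight_event (fshifts 0 F `|` fshifts x F')%fset B); last first.
  apply/seteqP; split => w /=.
    move=> [w1 w2] e /=; rewrite inE /B; have [eF _|eF /= eF'] := boolP (e \in fshifts 0 F).
      exact: w1.
    exact: w2.
  move=> wB; split => e /= eF.
    by have := wB e; rewrite /= inE eF /B eF; apply.
  have := wB e; rewrite /= inE eF orbT /B ifF; first by apply.
  apply/negbTE; apply/negP => eF0.
  by move/fdisjointP : dFs => /(_ e eF0); rewrite eF.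
rewrite prob_field_event//; last 2 first.
- by move=> e; rewrite inE => /orP[]; exact: pairs_fshifts.
- by move=> e; rewrite inE => /orP[]; exact: pairs_fshifts.
rewrite (prob_connM lambda_gt0 sfp)//; do ?exact: pairs_fshifts.
rewrite !(prob_conn_fshifts lambda_gt0 sfp)//.
rewrite (perm_big _ (perm_fsetU dFs)) big_cat /=.
rewrite (_ : \prod_(e <- fshifts 0 F) lawL (B e) = \prod_(e <- F) lawL (A e))%E; last first.
  rewrite [RHS](_ : _ = \prod_(e <- fshifts 0 F) lawL (A (fshift (- 0) e)))%E.
    by apply: eq_big_seq => e eF; rewrite /B eF.
  rewrite big_imfset /=; last by move=> e e' _ _ /fshift_inj.
  by apply: eq_bigr => e _; rewrite fshiftK.
rewrite (_ : \prod_(e <- fshifts x F') lawL (B e) = \prod_(e <- F') lawL (A' e))%E; last first.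
  rewrite [RHS](_ : _ = \prod_(e <- fshifts x F') lawL (A' (fshift (- x) e)))%E.
    apply: eq_big_seq => e eF; rewrite /B ifF//; apply/negbTE; apply/negP => eF0.
    by move/fdisjointP : dFs => /(_ e eF0); rewrite eF.
  rewrite big_imfset /=; last by move=> e e' _ _ /fshift_inj.
  by apply: eq_bigr => e _; rewrite fshiftK.
rewrite muleACA -(prob_field_cylinder 0 pE pF mA) -(prob_field_cylinder 0 pE' pF' mA').
rewrite fineM//; apply: fin_num_measure; apply: measurableI.
- exact: measurable_conn_event.
- by apply: measurable_weight_event => e; exact: mA.
- exact: measurable_conn_event.
- by apply: measurable_weight_event => e; exact: mA'.
Unshelve. all: by end_near. Qed.

Lemma field_stationary x (S : set field_config) : measurable S ->
  P (field x @^-1` S) = P (field 0 @^-1` S).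
Proof.
exact: (g_sigma_algebra_stationary setI_closed_field_cylinder
  measurable_field_cylinder field_cylinder_stationary).
Qed.

Lemma field_mixing (S S' : set field_config) : measurable S -> measurable S' ->
  fine (P (field 0 @^-1` S `&` field x @^-1` S')) @[x --> enorm_infty R d] -->
  fine (P (field 0 @^-1` S)) * fine (P (field 0 @^-1` S')).
Proof.
exact: (g_sigma_algebra_mixing setI_closed_field_cylinder
  measurable_field_cylinder field_cylinder_stationary field_cylinder_mixing).
Qed.

Lemma explosion_time_field x w :
  explosion_time conn L x w = explosion_time field_conn field_L 0 (field x w).
Proof.
rewrite (@explosion_time_shift _ _ _ _ _ _ conn L field_conn field_L w (field x w) x).
- by rewrite add0r.
- by move=> u v uv; rewrite /field_conn cardfs2 uv /= fshift2.
- move=> u v uv; rewrite /field_L cardfs2 uv /= fshift2 ger0_norm//.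
  by apply: (sfp_L_ge0 sfp); rewrite /pairs /= cardfs2 (inj_eq (addIr x)) uv.
Qed.

Lemma dist_to_sphere_field n x w :
  dist_to_sphere conn L n x w = dist_to_sphere field_conn field_L n 0 (field x w).
Proof.
rewrite (@dist_to_sphere_shift _ _ _ _ _ _ conn L field_conn field_L w (field x w) x).
- by rewrite add0r.
- by move=> u v uv; rewrite /field_conn cardfs2 uv /= fshift2.
- move=> u v uv; rewrite /field_L cardfs2 uv /= fshift2 ger0_norm//.
  by apply: (sfp_L_ge0 sfp); rewrite /pairs /= cardfs2 (inj_eq (addIr x)) uv.
Qed.

End percolation_field.

(** * Weak convergence from mixing *)

Section continuous_on_plane.
Context {R : realType}.

Lemma compact_modulus (f : R * R -> R) (K : set (R * R)) (eta : R) :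
  continuous f -> compact K -> 0 < eta -> exists2 delta : R, 0 < delta &
  forall x y, K x -> ball x delta y -> `|f x - f y| < eta.
Proof.
move=> cf /compact_near_coveringP cK eta0.
have eta20 : 0 < eta / 2 by rewrite divr_gt0.
have := cK R (0^'+) (fun delta x => forall y, ball x delta y -> `|f x - f y| < eta) _.
have nK x : K x -> \forall x' \near x & s \near 0^'+,
    forall y, ball x' s y -> `|f x' - f y| < eta.
  move=> _; have /cvgrPdist_lt/(_ _ eta20) := cf x.
  rewrite -nbhs_ballE => -[r /= r0 fr].
  have r20 : 0 < r / 2 by rewrite divr_gt0.
  exists (ball x (r / 2), [set s | s < r / 2]) => /=.
    split; first exact: nbhsx_ballx.
    exact: nbhs_right_lt.
  move=> [x' s] /= [xx' sr] y x'y.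
  have h1 : `|f x - f x'| < eta / 2.
    by apply: fr; apply: le_ball xx'; lra.
  have h2 : `|f x - f y| < eta / 2.
    apply: fr; rewrite (splitr r); apply: ball_triangle xx' _.
    exact: le_ball (ltW sr) _ x'y.
  rewrite (_ : f x' - f y = - (f x - f x') + (f x - f y)); last by ring.
  by rewrite (splitr eta) (le_lt_trans (ler_normD _ _))// normrN ltrD.
move=> /(_ _ nK) H.
have : \forall s \near (0 : R)^'+, 0 < s /\ K `<=` (fun x => forall y, ball x s y -> `|f x - f y| < eta).
  near=> s; split; first by near: s; exact: nbhs_right_gt.
  by near: s.
move=> /filter_ex[s [s0 sK]]; exists s => // x y Kx; exact: sK.
Unshelve. all: by end_near. Qed.

(** Boxes with rational centres and radii form a countable base, and each is measurable for the
    product sigma-algebra. Continuous test functions are therefore measurable for it. *)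
Lemma measurable_open_prod (U : set (R * R)) : open U -> measurable U.
Proof.
move=> oU; pose box (q : rat * rat * rat) : set (R * R) :=
  ball (ratr q.1.1 : R) (ratr q.2) `*` ball (ratr q.1.2 : R) (ratr q.2).
rewrite (_ : U = \bigcup_q (if `[< box q `<=` U >] then box q else set0)).
  apply: countable_bigcupT_measurable => // q; case: ifP => // _.
  by apply: measurableX; exact: measurable_ball.
apply/seteqP; split => [x Ux|x [q _]]; last by case: ifP => // /asboolP + ?; exact.
have [e /= e0 xeU] : nbhs_ball x U by rewrite nbhs_ballE; exact: open_nbhs_nbhs.
have e20 : 0 < e / 2 by rewrite divr_gt0.
have [r] := rat_in_itvoo e20; rewrite in_itv /= => /andP[r0 re].
have near_rat (a : R) : exists q : rat, ball (ratr q : R) (ratr r) a.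
  have : a - ratr r < a + ratr r by lra.
  move=> /rat_in_itvoo[q]; rewrite in_itv /= => /andP[q1 q2]; exists q.
  rewrite /ball /= ltr_norml; apply/andP; split; lra.
have tri (a q b : R) : ball q (ratr r) a -> ball q (ratr r) b -> ball a e b.
  rewrite /ball /= !ltr_norml => /andP[? ?] /andP[? ?]; apply/andP; split; lra.
have [q1 xq1] := near_rat x.1; have [q2 xq2] := near_rat x.2.
exists (q1, q2, r) => //; rewrite ifT//; apply/asboolP => y [y1 y2]; apply: xeU.
by split; [exact: tri xq1 y1|exact: tri xq2 y2].
Qed.

Lemma measurable_continuous_prod (f : R * R -> R) :
  continuous f -> measurable_fun setT f.
Proof.
move=> cf; apply: (measurability _ (RGenOInfty.measurableE R)).
move=> _ [_ [r ->] <-]; rewrite setTI; apply: measurable_open_prod.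
by apply: open_comp => // x _; exact: cf.
Qed.

End continuous_on_plane.

Section bounded_integrals.
Context {R : realType} {disp : measure_display} {Omega : measurableType disp}.
Variable P : probability Omega R.

Lemma bounded_integrable (h : Omega -> R) (M : R) : measurable_fun setT h ->
  (forall w, `|h w| <= M) -> P.-integrable setT (EFin \o h).
Proof.
move=> mh hM; apply: measurable_bounded_integrable => //.
  by have PT : (P setT < +oo)%E; [rewrite probability_setT ltry|exact: PT].
by exists M; split; [exact: num_real|move=> N MN w _ /=; rewrite (le_trans (hM w))// ltW].
Qed.

Lemma Rintegral_indic (A : set Omega) : measurable A ->
  \int[P]_w (\1_A w : R) = fine (P A).
Proof. by move=> mA; rewrite /Rintegral integral_indic// setIT. Qed.

Lemma expectation_bounded (f : R * R -> R) (M : R) (Y : Omega -> R * R) :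
  measurable_fun setT f -> (forall z, `|f z| <= M) -> measurable_fun setT Y ->
  ('E_P[f \o Y] = (\int[P]_w f (Y w))%:E)%E.
Proof.
move=> mf fM mY; rewrite unlock /Rintegral fineK//.
have := @bounded_integrable (f \o Y) M.
by move=> /(_ (measurableT_comp mf mY) (fun w => fM (Y w)))/integrable_fin_num; apply.
Qed.

End bounded_integrals.

(** * From rectangles to bounded continuous functions *)

Section weak_convergence.
Context {R : realType} {disp : measure_display} {Omega : measurableType disp}
  {disp' : measure_display} {Omega' : measurableType disp'}.
Variables (P : probability Omega R) (P' : probability Omega' R).
Context {I : Type} (F : set_system I) {FF : Filter F}.
Variables (Z : I -> Omega -> R * R) (Z' : Omega' -> R * R).
Hypothesis mZ : forall i, measurable_fun setT (Z i).
Hypothesis mZ' : measurable_fun setT Z'.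
Hypothesis cvg_rectangle : forall A B, measurable A -> measurable B ->
  fine (P (Z i @^-1` (A `*` B))) @[i --> F] --> fine (P' (Z' @^-1` (A `*` B))).

(** The bounded test functions whose expectations converge: a class closed under sums and containing
    the multiples of indicators of rectangles, hence the step functions on a grid. *)
Let H (h : R * R -> R) := [/\ measurable_fun setT h,
  exists M, forall z, `|h z| <= M &
  \int[P]_w h (Z i w) @[i --> F] --> \int[P']_w h (Z' w)].

Let H0 : H (cst 0).
Proof.
split; [exact: measurable_cst|by exists 0 => z; rewrite normr0|].
by rewrite !Rintegral_cst// mul0r; under eq_fun do rewrite Rintegral_cst// mul0r;
  exact: cvg_cst.
Qed.

Let HD h1 h2 : H h1 -> H h2 -> H (h1 \+ h2).
Proof.
move=> [m1 [M1 b1] c1] [m2 [M2 b2] c2]; split.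
- exact: measurable_funD.
- by exists (M1 + M2) => z; rewrite (le_trans (ler_normD _ _))// lerD.
rewrite RintegralD//; last 2 first.
- by apply: bounded_integrable => [|w]; [exact: measurableT_comp m1 mZ'|exact: b1].
- by apply: bounded_integrable => [|w]; [exact: measurableT_comp m2 mZ'|exact: b2].
rewrite (_ : (fun i => _) = (fun i => \int[P]_w h1 (Z i w) + \int[P]_w h2 (Z i w))).
  exact: cvgD.
apply/funext => i; rewrite RintegralD//.
- by apply: bounded_integrable => [|w]; [exact: measurableT_comp m1 (mZ i)|exact: b1].
- by apply: bounded_integrable => [|w]; [exact: measurableT_comp m2 (mZ i)|exact: b2].
Qed.

Let H_rectangle (c : R) A B : measurable A -> measurable B ->
  H (fun z => c * \1_(A `*` B) z).
Proof.
move=> mA mB; have mAB : measurable (A `*` B) by exact: measurableX.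
have m1 : measurable_fun setT (\1_(A `*` B) : R * R -> R) by exact: measurable_indic.
have b1 z : `|\1_(A `*` B) z : R| <= 1.
  by rewrite indicE; case: (_ \in _); rewrite ?normr1 ?normr0.
split.
- by apply: measurable_funM => //; exact: measurable_cst.
- by exists `|c| => z; rewrite normrM ler_piMr.
rewrite RintegralZl//; last first.
  by apply: bounded_integrable => [|w]; [exact: measurableT_comp m1 mZ'|exact: b1].
rewrite [in X in _ --> X](_ : \int[P']_w _ = fine (P' (Z' @^-1` (A `*` B)))); last first.
  by rewrite -Rintegral_indic// -[X in measurable X]setTI; exact: mZ'.
rewrite (_ : (fun i => _) = (fun i => c * fine (P (Z i @^-1` (A `*` B))))).
  by apply: cvgM; [exact: cvg_cst|exact: cvg_rectangle].
apply/funext => i; rewrite RintegralZl//; last first.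
  by apply: bounded_integrable => [|w]; [exact: measurableT_comp m1 (mZ i)|exact: b1].
by rewrite -Rintegral_indic// -[X in measurable X]setTI; exact: mZ.
Qed.

Let H_sum (J : Type) (s : seq J) (h : J -> R * R -> R) :
  (forall j, H (h j)) -> H (fun z => \sum_(j <- s) h j z).
Proof.
move=> Hh; elim: s => [|j s IH].
  by under [X in H X]funext do rewrite big_nil; exact: H0.
by under [X in H X]funext do rewrite big_cons; exact: HD.
Qed.

(** Off the square [g] vanishes and the error is at most [M]; the complement of the square is
    covered by two strips. The probability space is arbitrary because the bound serves both the
    limit law and the approaching laws. *)
Lemma Rintegral_grid_error {d0 : measure_display} {T : measurableType d0}
    (Q : probability T R) (Y : T -> R * R) (f g : R * R -> R) (J : set R) (eta M : R) :
  measurable J -> measurable_fun setT Y ->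
  measurable_fun setT f -> measurable_fun setT g ->
  (forall z, `|f z| <= M) -> (forall z, `|g z| <= M) -> 0 <= eta ->
  (forall z, J z.1 -> J z.2 -> `|f z - g z| <= eta) ->
  (forall z, ~ (J z.1 /\ J z.2) -> g z = 0) ->
  `|\int[Q]_w f (Y w) - \int[Q]_w g (Y w)| <=
  eta + M * (fine (Q (Y @^-1` (~` J `*` setT))) + fine (Q (Y @^-1` (setT `*` ~` J)))).
Proof.
move=> mJ mY mf mg fM gM eta0 fg g0.
have M0 : 0 <= M by apply: le_trans (fM 0).
have mJ1 : measurable (Y @^-1` (~` J `*` setT)).
  by rewrite -[X in measurable X]setTI; apply: mY => //; apply: measurableX => //; exact: measurableC.
have mJ2 : measurable (Y @^-1` (setT `*` ~` J)).
  by rewrite -[X in measurable X]setTI; apply: mY => //; apply: measurableX => //; exact: measurableC.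
have If : Q.-integrable setT (EFin \o (f \o Y)).
  by apply: bounded_integrable => [|w]; [exact: measurableT_comp mf mY|exact: fM].
have Ig : Q.-integrable setT (EFin \o (g \o Y)).
  by apply: bounded_integrable => [|w]; [exact: measurableT_comp mg mY|exact: gM].
have mfg : measurable_fun setT (fun w => f (Y w) - g (Y w)).
  by apply: measurable_funB; [exact: measurableT_comp mf mY|exact: measurableT_comp mg mY].
have bfg w : `|f (Y w) - g (Y w)| <= M + M by rewrite (le_trans (ler_normB _ _))// lerD.
rewrite -RintegralB//.
apply: (le_trans (le_normr_Rintegral _ _)) => //.
  exact: bounded_integrable mfg bfg.
pose i1 := \1_(Y @^-1` (~` J `*` setT)) : T -> R.
pose i2 := \1_(Y @^-1` (setT `*` ~` J)) : T -> R.
have mi1 : measurable_fun setT i1 by exact: measurable_indic.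
have mi2 : measurable_fun setT i2 by exact: measurable_indic.
have bi1 w : `|i1 w| <= 1 by rewrite /i1 indicE; case: (_ \in _); rewrite ?normr1 ?normr0.
have bi2 w : `|i2 w| <= 1 by rewrite /i2 indicE; case: (_ \in _); rewrite ?normr1 ?normr0.
have bi w : `|i1 w + i2 w| <= 1 + 1 by rewrite (le_trans (ler_normD _ _))// lerD.
have mi : measurable_fun setT (fun w => i1 w + i2 w) by exact: measurable_funD.
apply: (@le_trans _ _ (\int[Q]_w (eta + M * (i1 w + i2 w)))).
  apply: le_Rintegral => //.
  - apply: (@bounded_integrable _ _ _ Q _ (M + M)) => [|w]; last by rewrite normr_id.
    exact: (measurableT_comp (@normr_measurable R setT) mfg).
  - apply: (@bounded_integrable _ _ _ Q _ (eta + M * (1 + 1))) => [|w].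
      by apply: measurable_funD => //; apply: measurable_funM.
    by rewrite (le_trans (ler_normD _ _))// ger0_norm// normrM (ger0_norm M0) lerD2l ler_wpM2l.
  move=> w _; have [J1|J1] := pselect (J (Y w).1); last first.
    have -> : i1 w = 1 by rewrite /i1 indicE mem_set.
    rewrite (g0 (Y w)); last by case.
    rewrite subr0 (le_trans (fM _))// -[leLHS]add0r lerD// ler_peMr// lerDl.
    by rewrite /i2 indicE.
  have [J2|J2] := pselect (J (Y w).2); last first.
    have -> : i2 w = 1 by rewrite /i2 indicE mem_set.
    rewrite (g0 (Y w)); last by case.
    rewrite subr0 (le_trans (fM _))// -[leLHS]add0r lerD// ler_peMr// lerDr.
    by rewrite /i1 indicE.
  by rewrite -[leLHS]addr0 lerD ?fg// mulr_ge0// addr_ge0// /i1 /i2 indicE.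
rewrite RintegralD//; last 2 first.
- by apply: (@bounded_integrable _ _ _ Q _ (eta)) => [|w]; rewrite ?ger0_norm.
- apply: (@bounded_integrable _ _ _ Q _ (M * (1 + 1))) => [|w]; first exact: measurable_funM.
  by rewrite normrM (ger0_norm M0) ler_wpM2l.
rewrite [X in X + _](_ : _ = eta); last first.
  by rewrite Rintegral_cst// -[RHS]mulr1; congr (_ * _); exact: probT.
rewrite lerD2l.
rewrite RintegralZl//; last exact: bounded_integrable mi bi.
rewrite RintegralD//; last 2 first.
- exact: bounded_integrable mi1 bi1.
- exact: bounded_integrable mi2 bi2.
by rewrite !Rintegral_indic.
Qed.

(* [f] is approximated within [eta] by a step function on a grid of a large
   square, whose expectations converge by the rectangle hypothesis. *)
Lemma cvg_in_distribution_rectangle (f : R * R -> R) : continuous f ->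
  (exists M : R, forall z, `|f z| <= M) ->
  ('E_P[f \o Z i] @[i --> F] --> 'E_P'[f \o Z'])%E.
Proof.
move=> cf [M fM]; have mf := measurable_continuous_prod cf.
have M0 : 0 <= M by apply: le_trans (fM 0).
rewrite (expectation_bounded _ mf fM)//; under eq_fun do rewrite (expectation_bounded _ mf fM)//.
apply: cvg_EFin; first exact: nearW.
rewrite [X in X @ _ --> _](_ : _ = fun i => \int[P]_w f (Z i w)); last by [].
apply/cvgrPdist_le => e e0.
(* Each of the two grid errors will cost [3 * eta] and the convergence for the step function one
   more [eta], seven in all. *)
pose eta := e / 8; have eta0 : 0 < eta by rewrite divr_gt0.
pose J (K : nat) : set R := `[- K%:R, K%:R[%classic.
have mJ K : measurable (J K) by exact: measurable_itv.
have ndJ m n : (m <= n)%N -> J m `<=` J n.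
  move=> mn a; rewrite /J /= !in_itv /= => /andP[a1 a2].
  have : m%:R <= n%:R :> R by rewrite ler_nat.
  by move=> ?; apply/andP; split; lra.
have JT a : exists K, J K a.
  exists (Num.truncn `|a|).+1; rewrite /J /= in_itv /=.
  have := truncnS_gt `|a|; rewrite ltr_norml => /andP[/ltW -> ->] //.
have mpre (B : set (R * R)) : measurable B -> measurable (Z' @^-1` B).
  by move=> mB; rewrite -[X in measurable X]setTI; exact: mZ'.
(* Tightness of the limit law. The factor [M + 1] avoids a division by zero when [M] is 0. *)
have [K [K1 K2]] : exists K,
    fine (P' (Z' @^-1` (~` J K `*` setT))) < eta / (M + 1) /\
    fine (P' (Z' @^-1` (setT `*` ~` J K))) < eta / (M + 1).
  have eM : 0 < eta / (M + 1) by rewrite divr_gt0// ltr_wpDl.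
  have c1 : fine (P' (Z' @^-1` (J K `*` setT))) @[K --> \oo] --> (1 : R).
    rewrite -(probT P') (_ : setT = \bigcup_K (Z' @^-1` (J K `*` setT))); last first.
      by apply/seteqP; split => // w _; have [K JK] := JT (Z' w).1; exists K.
    apply: cvg_prob => [K|m n mn]; first by apply: mpre; exact: measurableX.
    by apply/subsetPset => w [/(ndJ _ _ mn) Jn _].
  have c2 : fine (P' (Z' @^-1` (setT `*` J K))) @[K --> \oo] --> (1 : R).
    rewrite -(probT P') (_ : setT = \bigcup_K (Z' @^-1` (setT `*` J K))); last first.
      by apply/seteqP; split => // w _; have [K JK] := JT (Z' w).2; exists K.
    apply: cvg_prob => [K|m n mn]; first by apply: mpre; exact: measurableX.
    by apply/subsetPset => w [_ /(ndJ _ _ mn) Jn].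
  have [K _ HK] : \forall K \near \oo,
      `|1 - fine (P' (Z' @^-1` (J K `*` setT)))| < eta / (M + 1) /\
      `|1 - fine (P' (Z' @^-1` (setT `*` J K)))| < eta / (M + 1).
    near=> K; split; near: K; [move/cvgrPdist_lt : c1|move/cvgrPdist_lt : c2]; exact.
  exists K; have [h1 h2] := HK K (leqnn K); split.
    rewrite (_ : Z' @^-1` _ = ~` (Z' @^-1` (J K `*` setT))); last first.
      apply/seteqP; split => w /=; first by move=> [nJ _] [].
      by move=> nJ; split => // JK; apply: nJ.
    rewrite probC; first exact: le_lt_trans (ler_norm _) h1.
    by apply: mpre; exact: measurableX.
  rewrite (_ : Z' @^-1` _ = ~` (Z' @^-1` (setT `*` J K))); last first.
    apply/seteqP; split => w /=; first by move=> [_ nJ] [].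
    by move=> nJ; split => // JK; apply: nJ.
  rewrite probC; first exact: le_lt_trans (ler_norm _) h2.
  by apply: mpre; exact: measurableX.
have [delta delta0 fdelta] : exists2 delta : R, 0 < delta & forall x y : R * R,
    ((`[- K%:R, K%:R]%classic : set R) `*` (`[- K%:R, K%:R]%classic : set R)) x ->
    ball x delta y -> `|f x - f y| < eta.
  by apply: compact_modulus => //; apply: compact_setX; exact: segment_compact.
(* With a mesh below [delta], every point of a cell is within [delta] of the left end, where [g]
   samples [f]. *)
pose s := delta / 2; have s0 : 0 < s by rewrite divr_gt0.
pose N := (Num.truncn ((K%:R + K%:R) / s)).+1.
pose c (k : nat) : R := - K%:R + s * k%:R.
pose cell (k : 'I_N) : set R := J K `&` `[c k, c k.+1[%classic.
have mcell k : measurable (cell k) by apply: measurableI => //; exact: measurable_itv.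
have cellP a : J K a -> exists k : 'I_N, cell k a.
  move=> JKa; have := JKa; rewrite /J /= in_itv /= => /andP[a1 a2].
  have as0 : 0 <= (a + K%:R) / s by rewrite divr_ge0 ?(ltW s0)//; lra.
  have kN : (Num.truncn ((a + K%:R) / s) < N)%N.
    by rewrite ltnS le_truncn// ler_pM2r ?invr_gt0//; lra.
  exists (Ordinal kN); split => //=; rewrite in_itv /= /c.
  have /andP[k1 k2] := truncn_itv as0.
  move: k1 k2; rewrite ler_pdivlMr// ltr_pdivrMr// => k1 k2.
  by rewrite (mulrC s) (mulrC s); apply/andP; split; lra.
have cell_uniq a (k l : 'I_N) : cell k a -> cell l a -> k = l.
  move=> [_ +] [_ +]; rewrite /= !in_itv /= /c => /andP[k1 k2] /andP[l1 l2].
  have kl : s * k%:R < s * l.+1%:R by lra.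
  have lk : s * l%:R < s * k.+1%:R by lra.
  move: kl lk; rewrite !ltr_pM2l// !ltr_nat !ltnS => kl lk.
  by apply/val_inj/eqP; rewrite eqn_leq kl.
have cellc a (k : 'I_N) : cell k a -> ball a delta (c k).
  move=> [_ +]; rewrite /= !in_itv /= /c => /andP[k1 k2].
  rewrite /ball /= ger0_norm; last by lra.
  by move: k2; rewrite -natr1 mulrDr mulr1 /s => k2; lra.
pose g (z : R * R) := \sum_(k <- enum 'I_N) \sum_(l <- enum 'I_N)
  f (c k, c l) * \1_(cell k `*` cell l) z.
have Hg : H g.
  by apply: H_sum => k; apply: H_sum => l; exact: H_rectangle.
have gE z (k l : 'I_N) : cell k z.1 -> cell l z.2 -> g z = f (c k, c l).
  move=> zk zl; rewrite /g !big_enum /= (bigD1 k)//= big_enum (bigD1 l)//=.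
  rewrite indicE mem_set// mulr1 big1 ?addr0 ?big1 ?addr0// => [k' k'k|l' l'l].
    rewrite big1// => l' _; rewrite indicE memNset ?mulr0// => -[zk' _].
    by move/eqP : k'k; apply; exact: cell_uniq zk' zk.
  rewrite indicE memNset ?mulr0// => -[_ zl'].
  by move/eqP : l'l; apply; exact: cell_uniq zl' zl.
have g0 z : ~ (J K z.1 /\ J K z.2) -> g z = 0.
  move=> nJ; rewrite /g big1// => k _; rewrite big1// => l _.
  by rewrite indicE memNset ?mulr0// => -[[zJ _] [zJ' _]]; apply: nJ.
have gM z : `|g z| <= M.
  have [[/cellP[k zk] /cellP[l zl]]|nJ] := pselect (J K z.1 /\ J K z.2).
    by rewrite (gE _ _ _ zk zl).
  by rewrite (g0 _ nJ) normr0.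
have fg z : J K z.1 -> J K z.2 -> `|f z - g z| <= eta.
  move=> J1 J2; have [k zk] := cellP _ J1; have [l zl] := cellP _ J2.
  rewrite (gE _ _ _ zk zl) ltW//; apply: fdelta; last by split; exact: cellc.
  by split => /=; [move: J1|move: J2]; rewrite /J /= !in_itv /= => /andP[-> /ltW].
have [mg _ cg] := Hg.
have eM : M * (eta / (M + 1)) <= eta.
  have M10 : 0 < M + 1 by rewrite ltr_wpDl.
  rewrite mulrCA ler_piMr ?(ltW eta0)// ler_pdivrMr// mul1r; lra.
near=> i.
have h1 : `|\int[P']_w g (Z' w) - \int[P]_w g (Z i w)| <= eta.
  by near: i; move/cvgrPdist_le : cg; apply.
have h2 := Rintegral_grid_error P' (mJ K) mZ' mf mg fM gM (ltW eta0) fg g0.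
have h3 := Rintegral_grid_error P (mJ K) (mZ i) mf mg fM gM (ltW eta0) fg g0.
(* The strips are themselves rectangles, so the tightness of the limit passes to [Z i] for late
   [i]. *)
have i1 : fine (P (Z i @^-1` (~` J K `*` setT))) < eta / (M + 1).
  near: i; apply: (cvgr_lt _ (cvg_rectangle _ _)) => //; exact: measurableC.
have i2 : fine (P (Z i @^-1` (setT `*` ~` J K))) < eta / (M + 1).
  near: i; apply: (cvgr_lt _ (cvg_rectangle _ _)) => //; exact: measurableC.
have bound (a b : R) : a < eta / (M + 1) -> b < eta / (M + 1) ->
    eta + M * (a + b) <= eta *+ 3.
  move=> /ltW ha /ltW hb; rewrite mulrDr.
  have := ler_wpM2l M0 ha; have := ler_wpM2l M0 hb.
  by rewrite mulrSr mulr2n; lra.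
have {}h2 := le_trans h2 (bound _ _ K1 K2).
have {}h3 := le_trans h3 (bound _ _ i1 i2).
move: h1 h2 h3; rewrite !ler_norml => /andP[? ?] /andP[? ?] /andP[? ?].
have etaE : e = eta * 8 by rewrite /eta divfK.
by apply/andP; split; lra.
Unshelve. all: by end_near. Qed.

End weak_convergence.

Lemma cvg_in_distribution_mixing {R : realType} {disp : measure_display}
    {Omega : measurableType disp} (P : probability Omega R)
    {I : Type} (F : set_system I) {FF : Filter F} (X0 : Omega -> R) (X : I -> Omega -> R)
    {disp' : measure_display} {Omega' : measurableType disp'}
    (P' : probability Omega' R) (V1 V2 : {RV P' >-> R}) :
  measurable_fun setT X0 -> (forall i, measurable_fun setT (X i)) ->
  (forall A B, measurable A -> measurable B ->
    fine (P (X0 @^-1` A `&` X i @^-1` B)) @[i --> F] -->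
    fine (P (X0 @^-1` A)) * fine (P (X0 @^-1` B))) ->
  independent_copies P X0 V1 V2 ->
  cvg_in_distribution P F (fun i w => (X0 w, X i w)) P' (fun w => (V1 w, V2 w)).
Proof.
move=> mX0 mX mix [law1 law2 indV] f cf bf.
apply: (cvg_in_distribution_rectangle (P := P) (P' := P')) => //.
- by move=> i; exact: measurable_fun_pair.
- by apply: measurable_fun_pair.
move=> A B mA mB.
rewrite (_ : fine (P' _) = fine (P (X0 @^-1` A)) * fine (P (X0 @^-1` B))).
  exact: mix.
rewrite -[_ @^-1` _]/(V1 @^-1` A `&` V2 @^-1` B).
rewrite indV; last 2 first.
- by exists A => //; rewrite setTI.
- by exists B => //; rewrite setTI.
rewrite law1// law2// fineM//; apply: fin_num_measure.
- by rewrite -[X in measurable X]setTI; exact: mX0.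
- by rewrite -[X in measurable X]setTI; exact: mX0.
Qed.

(** * Tails of the vertex weights *)

Section real_estimates.
Context {R : realType}.
Implicit Types (p u : nat -> R) (r s x : R).

Lemma ratio_le_geometric p r r' : (forall m, 0 < p m) -> 0 <= r -> r < r' ->
  p m.+1 / p m @[m --> \oo] --> r ->
  exists2 C, 0 < C & forall m, p m <= C * r' ^+ m.
Proof.
move=> p0 r0 rr' pr; have r'0 : 0 < r' by exact: le_lt_trans rr'.
have [N _ HN] : \forall m \near \oo, p m.+1 / p m < r' by apply: (cvgr_lt r).
(* [C] dominates each of the first [N.+1] normalised terms; beyond [N] the bound on the ratio
   propagates. *)
pose C := \sum_(m < N.+1) p m / r' ^+ m.
have pC m : (m <= N)%N -> p m <= C * r' ^+ m.
  move=> mN; rewrite -ler_pdivrMr ?exprn_gt0// /C.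
  rewrite (bigD1 (Ordinal (mN : (m < N.+1)%N)))//= lerDl sumr_ge0// => i _.
  by rewrite divr_ge0 ?exprn_ge0// ltW.
exists C.
  by have := pC 0%N isT; rewrite expr0 mulr1; exact: lt_le_trans.
elim=> [|m IH]; first exact: pC.
have [mN|Nm] := leqP m.+1 N; first exact: pC.
have := HN m Nm; rewrite ltr_pdivrMr// => /ltW /le_trans; apply.
by rewrite exprS mulrCA ler_pM2l.
Qed.

Lemma ratio_ge_geometric p r r' : (forall m, 0 < p m) -> 0 < r' -> r' < r ->
  p m.+1 / p m @[m --> \oo] --> r ->
  exists2 c, 0 < c & forall m, c * r' ^+ m <= p m.
Proof.
move=> p0 r'0 r'r pr; have r0 : 0 < r by exact: lt_trans r'r.
have [||||C C0 HC] := @ratio_le_geometric (fun m => (p m)^-1) r^-1 r'^-1.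
- by move=> m; rewrite invr_gt0.
- by rewrite invr_ge0 ltW.
- by rewrite ltf_pV2.
- rewrite (_ : (fun m => _) = (fun m => (p m.+1 / p m)^-1)).
    by apply: cvgV => //; rewrite gt_eqF.
  by apply/funext => m; rewrite invf_div invrK mulrC.
exists C^-1; first by rewrite invr_gt0.
move=> m; rewrite -lef_pV2 ?posrE ?mulr_gt0 ?invr_gt0 ?exprn_gt0//.
by rewrite invfM invrK -exprVn.
Qed.

Lemma nneseries_geometric_lty u (C q : R) : 0 <= C -> 0 <= q -> q < 1 ->
  (forall n, 0 <= u n <= C * q ^+ n) -> (\sum_(n <oo) (u n)%:E < +oo)%E.
Proof.
move=> C0 q0 q1 uq; apply: (@le_lt_trans _ _ (C / (1 - q))%:E); last exact: ltry.
apply: lime_le.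
  by apply: is_cvg_nneseries => n _ _; rewrite lee_fin; case/andP : (uq n).
apply: nearW => n; rewrite sumEFin lee_fin big_mkord.
have h : \sum_(i < n) C * q ^+ i = C / (1 - q) - C / (1 - q) * q ^+ n.
  elim: n => [|n IH]; first by rewrite big_ord0 expr0 mulr1 subrr.
  rewrite big_ord_recr /= IH exprS; field.
  by rewrite subr_eq0 gt_eqF.
apply: (@le_trans _ _ (\sum_(i < n) C * q ^+ i)).
  by apply: ler_sum => i _; case/andP : (uq i).
have : 0 <= C / (1 - q) * q ^+ n.
  by rewrite !mulr_ge0 ?exprn_ge0// invr_ge0 subr_ge0 ltW.
by rewrite h; lra.
Qed.

(** The left side is at most the minimum of [x] and 1, which is at most the power. *)
Lemma one_minus_expR_le_powR x s : 0 <= x -> 0 <= s -> s <= 1 ->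
  1 - expR (- x) <= x `^ s.
Proof.
rewrite le_eqVlt => /predU1P[<- _ _|x0 s0 s1].
  by rewrite oppr0 expR0 subrr powR_ge0.
rewrite /powR gt_eqF//.
have [x1|x1] := leP x 1.
  apply: (@le_trans _ _ x); first by have := expR_ge1Dx (- x); lra.
  rewrite -[leLHS]lnK ?posrE// ler_expR.
  have := ln_le0 x1; nra.
apply: (@le_trans _ _ 1); first by rewrite lerBlDr lerDl expR_ge0.
by rewrite -expR0 ler_expR mulr_ge0// ln_ge0// ltW.
Qed.

Lemma ltr2_powR (a b : R) : a < b -> 2 `^ a < 2 `^ b.
Proof.
by move=> ab; rewrite /powR pnatr_eq0 /= ltr_expR ltr_pM2r// ln_gt0// ltr1n.
Qed.

(** A dyadic layer-cake bound: with [m] minimal, the last term of the sum alone dominates the power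
    when [m] is positive. Taking expectations turns the indicators into dyadic tails. *)
Lemma powR_sum_dyadic x s : 1 <= x -> 0 <= s ->
  exists2 m, x <= 2 ^+ m & x `^ s <= 1 + \sum_(k < m) (2 `^ s) ^+ k.+1 * (2 ^+ k < x)%R%:R.
Proof.
move=> x1 s0.
have ex : exists m, x <= 2 ^+ m.
  exists (Num.truncn x).+1; apply: ltW; apply: (lt_le_trans (truncnS_gt _)).
  by rewrite -natrX ler_nat ltnW// ltn_expl.
have h0 k : 0 <= (2 `^ s) ^+ k.+1 * (2 ^+ k < x)%R%:R :> R.
  by rewrite mulr_ge0// exprn_ge0// powR_ge0.
have [m xm mmin] := ex_minnP ex; exists m => //.
case: m xm mmin => [|m] xm mmin.
  rewrite big_ord0 addr0 (_ : x = 1) ?powR1//; apply/eqP; rewrite eq_le x1 andbT.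
  by move: xm; rewrite expr0.
have mx : 2 ^+ m < x by rewrite ltNge; apply/negP => /mmin; rewrite ltnn.
apply: (@le_trans _ _ ((2 `^ s) ^+ m.+1)).
  rewrite -powR_mulrn ?powR_ge0// -powRrM mulrC powRrM powR_mulrn//.
  by rewrite ge0_ler_powR// nnegrE ?exprn_ge0// (le_trans ler01).
rewrite big_ord_recr /= mx mulr1 addrA lerDr addr_ge0//.
by apply: sumr_ge0 => k _; exact: h0.
Qed.

Lemma cvg_expr2_pinfty : (2 ^+ m : R) @[m --> \oo] --> +oo%R.
Proof.
apply/cvgryPge => A; exists (Num.truncn A).+1 => // m /= Am.
apply: ltW; apply: (lt_le_trans (truncnS_gt A)); rewrite -natrX ler_nat.
exact: leq_trans Am (ltnW (ltn_expl _ _)).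
Qed.

End real_estimates.

Section tails.
Context {R : realType}.
Variables (tau : R) (l : R -> R) (lawW : probability R R).
Hypothesis l_slow : slowly_varying l.
Hypothesis lawW_tail : forall t : R, 0 < t ->
  lawW `]t, +oo[%classic = (l t / t `^ (tau - 1))%:E.

(* Slow variation enters only through the ratio of consecutive dyadic tails, so
   that no uniformity in the slowly varying function is needed. *)
Definition dyadic_tail (m : nat) : R := fine (lawW `]2 ^+ m, +oo[%classic).

Lemma dyadic_tailE m : dyadic_tail m = l (2 ^+ m) / (2 ^+ m) `^ (tau - 1).
Proof. by rewrite /dyadic_tail lawW_tail// exprn_gt0. Qed.

Lemma dyadic_tail_gt0 m : 0 < dyadic_tail m.
Proof.
have [_ l0 _] := l_slow.
by rewrite dyadic_tailE divr_gt0 ?powR_gt0 ?exprn_gt0// l0 ?exprn_gt0.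
Qed.

Lemma dyadic_tail_ratio :
  dyadic_tail m.+1 / dyadic_tail m @[m --> \oo] --> 2 `^ (- (tau - 1)).
Proof.
have [_ l0 l2] := l_slow.
have c : l (2 * 2 ^+ m) / l (2 ^+ m) @[m --> \oo] --> (1 : R).
  exact: (cvg_comp _ _ cvg_expr2_pinfty (l2 2 (ltr0Sn _ _))).
rewrite (_ : (fun m => _) = (fun m => l (2 * 2 ^+ m) / l (2 ^+ m) * 2 `^ (- (tau - 1)))).
  by rewrite -[X in _ --> X]mul1r; apply: cvgM => //; exact: cvg_cst.
apply/funext => m; rewrite !dyadic_tailE -exprS exprS powRM ?exprn_ge0// powRN.
have := l0 (2 ^+ m); rewrite exprn_gt0// => /(_ isT) lm.
field.
by rewrite !gt_eqF ?powR_gt0 ?exprn_gt0.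
Qed.

(** A Potter bound along the powers of 2: an arbitrarily small loss in the exponent absorbs the
    slowly varying factor. *)
Lemma dyadic_tail_le (b : R) : b < tau - 1 ->
  exists2 C, 0 < C & forall m, dyadic_tail m <= C * (2 `^ (- b)) ^+ m.
Proof.
move=> b1; apply: ratio_le_geometric dyadic_tail_ratio => //.
  exact: dyadic_tail_gt0.
by apply: ltr2_powR; rewrite ltrN2.
Qed.

Lemma dyadic_tail_ge (b : R) : tau - 1 < b ->
  exists2 c, 0 < c & forall m, c * (2 `^ (- b)) ^+ m <= dyadic_tail m.
Proof.
move=> b1; apply: ratio_ge_geometric dyadic_tail_ratio => //.
  exact: dyadic_tail_gt0.
by apply: ltr2_powR; rewrite ltrN2.
Qed.

Lemma moment_lty {disp : measure_display} {Omega : measurableType disp}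
    (P : probability Omega R) (X : {RV P >-> R}) (s : R) :
  (forall A, measurable A -> P (X @^-1` A) = lawW A) ->
  0 <= s -> s < tau - 1 ->
  (\int[P]_(w in [set w | (1 <= X w)%R]) (X w `^ s)%R%:E < +oo)%E.
Proof.
move=> lawX s0 s1; have mX : measurable_fun setT X by [].
have mA : measurable [set w | 1 <= X w].
  rewrite (_ : mkset _ = X @^-1` `[1, +oo[).
    by rewrite -[X in measurable X]setTI; exact: mX.
  by apply/seteqP; split => w /=; rewrite in_itv /= andbT.
(* The midpoint of [s] and [tau - 1]: below [tau - 1] for the tail bound, above [s] for the
   geometric series to converge. *)
have [C C0 HC] := @dyadic_tail_le ((s + (tau - 1)) / 2) ltac:(lra).
pose g (k : nat) (w : Omega) : \bar R := ((2 `^ s) ^+ k.+1 * \1_(X @^-1` `]2 ^+ k, +oo[) w)%:E.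
have mB k : measurable (X @^-1` `]2 ^+ k, +oo[).
  by rewrite -[X in measurable X]setTI; exact: mX.
have g0 k w : (0 <= g k w)%E by rewrite lee_fin mulr_ge0// exprn_ge0// powR_ge0.
have mg k : measurable_fun setT (g k).
  by apply/measurable_EFinP; apply: measurable_funM => //; exact: measurable_indic.
have m1 : measurable_fun setT (fun w => (1 + \sum_(k <oo) g k w)%E).
  by apply: emeasurable_funD => //; exact: ge0_emeasurable_sum.
have s1_ge0 w : (0 <= 1 + \sum_(k <oo) g k w)%E.
  by rewrite adde_ge0// nneseries_ge0.
apply: (@le_lt_trans _ _ (\int[P]_w (1 + \sum_(k <oo) g k w))%E).
  apply: (@le_trans _ _ (\int[P]_(w in [set w | (1 <= X w)%R]) (1 + \sum_(k <oo) g k w))%E).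
    apply: ge0_le_integral => //.
    - by move=> w _; rewrite lee_fin powR_ge0.
    - apply/measurable_EFinP/measurable_funTS.
      exact: (measurableT_comp (measurable_powR s) mX).
    - exact: measurable_funTS.
    move=> w /= X1; have [m _ Xm] := powR_sum_dyadic X1 s0.
    apply: (@le_trans _ _ (1 + \sum_(0 <= k < m) g k w)%E).
      rewrite big_mkord sumEFin -EFinD lee_fin; apply: (le_trans Xm).
      rewrite lerD2l; apply: ler_sum => k _; rewrite indicE.
      rewrite ler_wpM2l ?exprn_ge0 ?powR_ge0// ler_nat.
      by case: (ltP (2 ^+ k) (X w)) => // kX; rewrite mem_set//= in_itv /= kX.
    by rewrite leeD2l//; apply: nneseries_lim_ge => k _ _.
  by apply: ge0_subset_integral.
rewrite ge0_integralD//; last first.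
  exact: ge0_emeasurable_sum.
  by move=> w _; rewrite nneseries_ge0.
rewrite integral_cst//= mul1e probability_setT integral_nneseries//.
rewrite lte_add_pinfty ?ltry//.
rewrite (eq_eseriesr (g := fun k => ((2 `^ s) ^+ k.+1 * dyadic_tail k)%:E)); last first.
  move=> k _; rewrite /g.
  under eq_integral do rewrite EFinM.
  rewrite ge0_integralZl//; last first.
    by apply/measurable_EFinP; exact: measurable_indic.
  rewrite integral_indic// setIT EFinM; congr (_ * _)%E.
  by rewrite /dyadic_tail fineK ?fin_num_measure//; exact: lawX.
apply: (@nneseries_geometric_lty _ _ (2 `^ s * C) (2 `^ s * 2 `^ (- ((s + (tau - 1)) / 2)))).
- by rewrite mulr_ge0 ?powR_ge0// ltW.
- by rewrite mulr_ge0 ?powR_ge0.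
- rewrite -powRD; last by apply/implyP.
  have e0 : s + - ((s + (tau - 1)) / 2) < 0 by lra.
  by have := ltr2_powR e0; rewrite powRr0.
move=> k; rewrite mulr_ge0 ?exprn_ge0 ?powR_ge0 ?(ltW (dyadic_tail_gt0 k))//=.
rewrite exprMn exprS -!mulrA ler_wpM2l ?powR_ge0// mulrCA ler_wpM2l ?exprn_ge0 ?powR_ge0//.
Qed.

End tails.

(** * Local finiteness *)

Section cubes.
Context {d : nat}.
Notation vertex := 'rV[int]_d.

(** Parametrises the cube of side [N] and lowest corner (a, ..., a) by a finite type, over which
    unions, intersections and sums are finite big operators. *)
Definition cube_vertex (N : nat) (a : int) (k : 'rV['I_N]_d) : vertex :=
  \row_i ((k ord0 i : nat)%:Z + a).

Lemma cube_vertexP (N : nat) (a : int) (z : vertex) :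
  (forall i, a <= z ord0 i < a + N%:Z) -> exists k : 'rV['I_N]_d, z = cube_vertex a k.
Proof.
move=> za; have zN i : (`|(z ord0 i - a)%R|%N < N)%N by have := za i; lia.
exists (\row_i Ordinal (zN i)); apply/rowP => i; rewrite !mxE /=.
have -> : z 0 i = z ord0 i by congr (z _ _); exact: val_inj.
by have := za i; lia.
Qed.

Lemma cube_vertex_itv (N : nat) (a : int) (k : 'rV['I_N]_d) i :
  a <= cube_vertex a k ord0 i < a + N%:Z.
Proof. by rewrite mxE; have := ltn_ord (k ord0 i); lia. Qed.

Lemma cube_vertex_inj (N : nat) (a : int) : injective (@cube_vertex N a).
Proof.
move=> k k' /rowP kk'; apply/rowP => i; have := kk' i; rewrite !mxE => /addIr [] ?.
exact: val_inj.
Qed.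

Lemma finite_cube (N : nat) (v : vertex) :
  finite_set [set y : vertex | forall i, (`|((y - v) ord0 i)%R|%N < N)%N].
Proof.
apply: (sub_finite_set (B := [set v + cube_vertex (- N%:Z) k | k in [set: 'rV['I_(N + N)]_d]])).
  move=> y /= yN; have [|k ky] := @cube_vertexP (N + N) (- N%:Z) (y - v).
    by move=> i; have := yN i; lia.
  by exists k => //; rewrite -ky addrC subrK.
apply: finite_image; exact: finite_finset.
Qed.

Context {R : realType}.

Lemma enorm_ge_coord (z : vertex) i : `|(z ord0 i)%:~R| <= enorm z :> R.
Proof.
rewrite -sqrtr_sqr ler_wsqrtr// (bigD1 i)//= lerDl sumr_ge0// => j _.
exact: sqr_ge0.
Qed.

Lemma enorm_le_coord (z : vertex) (r : R) : 0 <= r ->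
  (forall i, `|(z ord0 i)%:~R| <= r) -> enorm z <= d%:R * r.
Proof.
move=> r0 zr; rewrite -[leRHS]ger0_norm ?mulr_ge0// -sqrtr_sqr ler_wsqrtr//.
apply: (@le_trans _ _ (\sum_(i < d) r ^+ 2)).
  by apply: ler_sum => i _; rewrite -real_normK ?num_real// lerXn2r ?nnegrE.
rewrite [leLHS](_ : _ = d%:R * r ^+ 2); last by rewrite sumr_const card_ord mulr_natl.
rewrite exprMn ler_wpM2r ?sqr_ge0//.
rewrite -natrX ler_nat expnS expn1.
by have [->|d0] := posnP d; rewrite // leq_pmulr.
Qed.

End cubes.

Lemma le_prob_bigsetU {R : realType} {disp : measure_display}
    {Omega : measurableType disp} (P : probability Omega R) (I : Type) (s : seq I)
    (E : I -> set Omega) : (forall i, measurable (E i)) ->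
  fine (P (\big[setU/set0]_(i <- s) E i)) <= \sum_(i <- s) fine (P (E i)).
Proof.
move=> mE; elim: s => [|i s IH]; first by rewrite !big_nil measure0.
rewrite !big_cons; apply: (le_trans (le_prob_setU _ _ _)) => //.
  exact: bigsetU_measurable.
by rewrite lerD2l.
Qed.

Section local_finiteness.
Context {R : realType} {d : nat} {alpha lambda tau : R} {l : R -> R}
  {lawW lawL : probability R R}
  {disp : measure_display} {Omega : measurableType disp}
  {P : probability Omega R} {W : 'rV[int]_d -> {RV P >-> R}}
  {conn : {fset 'rV[int]_d} -> {RV P >-> bool}}
  {L : {fset 'rV[int]_d} -> {RV P >-> R}}.
Notation vertex := 'rV[int]_d.
Notation edges_prob := (@edges_prob R d alpha lambda).
Hypothesis d_gt0 : (1 <= d)%N.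
Hypothesis d_lt_alpha : d%:R < alpha.
Hypothesis lambda_gt0 : 0 < lambda.
Hypothesis tau_gt1 : 1 < tau.
Hypothesis lawW_ge1 : lawW `[1, +oo[%classic = 1%E.
Hypothesis l_slow : slowly_varying l.
Hypothesis lawW_tail : forall t : R, 0 < t ->
  lawW `]t, +oo[%classic = (l t / t `^ (tau - 1))%:E.
Hypothesis gamma_gt1 : 1 < alpha * (tau - 1) / d%:R.
Hypothesis sfp : is_SFP alpha lambda lawW lawL W conn L.

Lemma edges_prob1 (f : vertex -> R) (x y : vertex) : x != y ->
  enorm (x - y) != 1 :> R ->
  edges_prob [fset [fset x; y]%fset]%fset f =
  1 - expR (- (lambda * `|f x| * `|f y| / enorm (x - y) `^ alpha)).
Proof.
move=> xy nxy; rewrite /edges_prob big_seq_fset1 (edge_probE _ _ _ xy).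
by rewrite (negbTE nxy).
Qed.

Lemma sigma_family_W v (B : set R) : measurable B ->
  sigma_family setT (fun x => W x : Omega -> R) (W v @^-1` B).
Proof.
move=> mB; apply: sub_sigma_algebra; exists v => //.
by exists B => //; rewrite setTI.
Qed.

Lemma sigma_family_setI {I : Type} (D : set I) (X : I -> Omega -> R) (A B : set Omega) :
  sigma_family D X A -> sigma_family D X B -> sigma_family D X (A `&` B).
Proof.
pose M := g_sigma_algebraType (\bigcup_(i in D) g_sigma_algebra_preimage (X i)).
exact: (@measurableI _ M).
Qed.

Lemma prob_conn1 (A : set Omega) x y : x != y ->
  sigma_family setT (fun x => W x : Omega -> R) A ->
  P (A `&` [set w | conn [fset x; y]%fset w]) =
  (\int[P]_(w in A)
     (edges_prob [fset [fset x; y]%fset]%fset (fun v => W v w))%:E)%E.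
Proof.
move=> xy sA; rewrite -(prob_edges lawW_ge1 sfp sA).
  by congr (P (_ `&` _)); apply/seteqP; split => w /=;
    [move=> cw e /=; rewrite inE => /eqP ->|apply; rewrite /= inE].
by move=> e; rewrite inE => /eqP ->; rewrite /pairs /= cardfs2 xy.
Qed.

Lemma moment_bound (s : R) : 0 <= s -> s < tau - 1 ->
  exists2 K : R, 0 <= K & forall v,
  (\int[P]_(w in [set w | (1 <= W v w)%R]) (W v w `^ s)%R%:E <= K%:E)%E.
Proof.
move=> s0 s1.
(* The moment is computed for the identity under [lawW], which makes the bound the same for all
   [v]. *)
pose idR : {RV lawW >-> R} := HB.pack (@id R) (isMeasurableFun.Build _ _ _ _ _ (@measurable_id _ R setT)).
have Klty := moment_lty l_slow lawW_tail (P := lawW) (X := idR) (fun A _ => erefl) s0 s1.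
have K0 : (0 <= \int[lawW]_(t in [set t | (1 <= t)%R]) (t `^ s)%R%:E)%E.
  by apply: integral_ge0 => t _; rewrite lee_fin powR_ge0.
exists (fine (\int[lawW]_(t in [set t | (1 <= t)%R]) (t `^ s)%R%:E)%E).
  exact: fine_ge0.
move=> v; rewrite fineK ?ge0_fin_numE//.
have mD : measurable [set t : R | 1 <= t].
  rewrite (_ : mkset _ = `[1, +oo[%classic); first exact: measurable_itv.
  by apply/seteqP; split => t /=; rewrite in_itv /= andbT.
rewrite -(@ge0_integral_pushforward _ _ _ _ _ (W v) _ P [set t : R | 1 <= t]
  (fun t => (t `^ s)%:E))//; last 2 first.
- by apply/measurable_EFinP/measurable_funTS; exact: measurable_powR.
- by move=> t _; rewrite lee_fin powR_ge0.
rewrite (eq_measure_integral lawW)// => A mA _.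
exact: (has_law_preimage (sfp_W sfp)).
Qed.

(** With the weight of [x] capped, the s-th power of the exponent is at most a constant times that
    of the weight of [y], whose expectation is finite. The cap costs nothing in the end, as almost
    surely every weight is below some [2 ^+ m]. *)
Lemma prob_long_edge (s : R) (m : nat) : 0 < s <= 1 -> s < tau - 1 ->
  exists2 C : R, 0 <= C & forall (x y : vertex) (r : R), 1 < r -> r <= enorm (x - y) ->
  fine (P ((W x @^-1` `[1, 2 ^+ m]) `&` (W y @^-1` `[1, +oo[) `&`
           [set w | conn [fset x; y]%fset w])) <= C * (r `^ alpha `^ s)^-1.
Proof.
move=> /andP[s0 s1] s1tau; have [K K0 HK] := moment_bound (ltW s0) s1tau.
exists ((lambda * 2 ^+ m) `^ s * K); first by rewrite mulr_ge0 ?powR_ge0.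
move=> x y r r1 rxy.
have xy : x != y.
  apply/eqP => xy; move: rxy; rewrite xy subrr /enorm big1 ?sqrtr0; first by lra.
  by move=> i _; rewrite mxE expr0n.
have nxy : enorm (x - y) != 1 :> R by rewrite gt_eqF// (lt_le_trans r1).
set A := _ `&` (W y @^-1` _).
have mpre v (B : set R) : measurable B -> measurable (W v @^-1` B).
  by move=> mB; rewrite -[X in measurable X]setTI; exact: measurable_funPT.
have mA : measurable A by apply: measurableI; apply: mpre.
have sA : sigma_family setT (fun x => W x : Omega -> R) A.
  apply: sigma_family_setI; exact: sigma_family_W.
have mconn : measurable [set w | conn [fset x; y]%fset w].
  rewrite (_ : mkset _ = conn [fset x; y]%fset @^-1` [set true])//.
  by rewrite -[X in measurable X]setTI; exact: measurable_funPT.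
rewrite -lee_fin fineK_prob; last exact: measurableI.
rewrite prob_conn1//.
pose c := (lambda * 2 ^+ m / r `^ alpha) `^ s.
have r0 : 0 < r by apply: lt_trans r1.
have mprob : measurable_fun setT (fun w =>
    (edges_prob [fset [fset x; y]%fset]%fset (fun v => W v w))%:E).
  apply/measurable_EFinP; apply: (measurable_edges_prob (f := fun v w => W v w)) => //.
  by move=> e; rewrite inE => /eqP ->; rewrite /pairs /= cardfs2 xy.
have mWs : measurable_fun setT (fun w => (W y w `^ s)%:E).
  by apply/measurable_EFinP; exact: (measurableT_comp (measurable_powR s)).
have mD : measurable [set w | 1 <= W y w].
  rewrite (_ : mkset _ = W y @^-1` `[1, +oo[); first exact: mpre.
  by apply/seteqP; split => w /=; rewrite in_itv /= andbT.
apply: (@le_trans _ _ (\int[P]_(w in A) (c%:E * (W y w `^ s)%R%:E))%E).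
  apply: ge0_le_integral => //.
  - move=> w _; rewrite lee_fin edges_prob_ge0//.
    by move=> e; rewrite inE => /eqP ->; rewrite /pairs /= cardfs2 xy.
  - exact: measurable_funTS.
  - by apply: measurable_funTS; apply: measurable_funeM.
  move=> w [/=]; rewrite !in_itv /= andbT => /andP[Wx1 Wx2] Wy1.
  rewrite -EFinM lee_fin edges_prob1// !ger0_norm ?(le_trans ler01)//.
  have Wx0 : 0 <= W x w by exact: le_trans Wx1.
  have Wy0 : 0 <= W y w by exact: le_trans Wy1.
  apply: (le_trans (one_minus_expR_le_powR _ (ltW s0) s1)).
    by rewrite divr_ge0 ?powR_ge0// !mulr_ge0// ltW.
  rewrite /c -powRM//; last by rewrite divr_ge0 ?powR_ge0// mulr_ge0// ltW.
  rewrite ge0_ler_powR ?nnegrE ?(ltW s0)//.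
  - by rewrite divr_ge0 ?powR_ge0// !mulr_ge0// ltW.
  - by rewrite mulr_ge0// divr_ge0 ?powR_ge0// mulr_ge0// ltW.
  rewrite mulrAC -!mulrA ler_wpM2l ?(ltW lambda_gt0)//.
  rewrite mulrA [leRHS]mulrA [leRHS]mulrAC mulrAC.
  apply: ler_pM => //.
  - by rewrite mulr_ge0.
  - by rewrite invr_ge0 powR_ge0.
  - by rewrite ler_wpM2r.
  - rewrite lef_pV2 ?posrE ?powR_gt0//; last exact: lt_le_trans rxy.
    rewrite ge0_ler_powR ?nnegrE ?(ltW r0)//; last by rewrite (le_trans (ltW r0)).
    by rewrite (le_trans _ (ltW d_lt_alpha)).
apply: (@le_trans _ _ (\int[P]_(w in [set w | (1 <= W y w)%R]) (c%:E * (W y w `^ s)%R%:E))%E).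
  apply: ge0_subset_integral => //.
  - by apply: measurable_funTS; apply: measurable_funeM.
  - by move=> w _; rewrite mule_ge0 ?lee_fin ?powR_ge0.
  - by move=> w [_ /=]; rewrite in_itv /= andbT.
rewrite ge0_integralZl//; last 3 first.
- exact: measurable_funTS.
- by move=> w _; rewrite lee_fin powR_ge0.
- by rewrite lee_fin powR_ge0.
apply: (@le_trans _ _ (c%:E * K%:E)%E); first by rewrite lee_wpmul2l ?lee_fin ?powR_ge0.
rewrite -EFinM lee_fin /c powRM ?invr_ge0 ?powR_ge0 ?mulr_ge0 ?(ltW lambda_gt0)//.
rewrite (_ : (r `^ alpha)^-1 `^ s = (r `^ alpha `^ s)^-1); first by rewrite mulrAC.
by rewrite -(powR_inv1 (powR_ge0 _ _)) -powRrM mulN1r powRN.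
Qed.

Definition shell (j : nat) : set vertex := [set z | exists i, (2 ^ j.+1 <= `|z ord0 i|)%N].

(** The cube, of side [2 ^ j.+3], contains all displacements with coordinates below [2 ^ j.+2] in
    absolute value, and [shell j] removes those of sup norm less than [2 ^ j.+1]. As [2 ^ j.+1]
    exceeds 1, nearest-neighbour edges are excluded already for [j = 0]. *)
Definition long_edge_event (v : vertex) (m j : nat) : set Omega :=
  \big[setU/set0]_(k <- enum [set: 'rV['I_(2 ^ j.+3)]_d]%SET)
    (let z := cube_vertex (- (2 ^ j.+2)%:Z) k in
     if `[< shell j z >] then
       (W v @^-1` `[1, 2 ^+ m]) `&` (W (v + z) @^-1` `[1, +oo[) `&`
       [set w | conn [fset v; (v + z)%R]%fset w]
     else set0).

Lemma measurable_long_edge_event v m j : measurable (long_edge_event v m j).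
Proof.
apply: bigsetU_measurable => k _; cbv zeta; case: ifP => // _.
have mpre u (B : set R) : measurable B -> measurable (W u @^-1` B).
  by move=> mB; rewrite -[X in measurable X]setTI; exact: measurable_funPT.
apply: measurableI; first by apply: measurableI; exact: mpre.
rewrite (_ : mkset _ = conn [fset v; (v + cube_vertex (- (2 ^ j.+2)%:Z) k)%R]%fset @^-1` [set true])//.
by rewrite -[X in measurable X]setTI; exact: measurable_funPT.
Qed.

(* With such an [s], [1 - exp (- u) <= u ^ s] has finite expectation in the weight
   of the far endpoint, and the bound is summable over the lattice. *)
Lemma moment_exponent : exists s : R, [/\ 0 < s <= 1, s < tau - 1 & d%:R < alpha * s].
Proof.
have d0 : 0 < d%:R :> R by rewrite ltr0n.
have a0 : 0 < alpha by exact: lt_trans d_lt_alpha.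
have h1 : d%:R / alpha < 1 by rewrite ltr_pdivrMr// mul1r.
have h2 : d%:R / alpha < tau - 1.
  rewrite ltr_pdivrMr// mulrC; move: gamma_gt1.
  by rewrite ltr_pdivlMr// mul1r.
pose s := (d%:R / alpha + Num.min 1 (tau - 1)) / 2.
have h3 : d%:R / alpha < Num.min 1 (tau - 1) by rewrite lt_min h1.
have h4 : 0 < d%:R / alpha by rewrite divr_gt0.
have m1 : Num.min 1 (tau - 1) <= 1 by rewrite ge_min lexx.
have m2 : Num.min 1 (tau - 1) <= tau - 1 by rewrite ge_min lexx orbT.
exists s; split.
- by apply/andP; split; rewrite /s; lra.
- by rewrite /s; lra.
- by rewrite mulrC -ltr_pdivrMr// /s; lra.
Qed.

Lemma long_edge_summable v m :
  (\sum_(j <oo) P (long_edge_event v m j) < +oo)%E.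
Proof.
have [s [/andP[s0 s1] s2 s3]] := moment_exponent.
have [||C C0 HC] := @prob_long_edge s m; first by rewrite s0.
  by [].
rewrite (eq_eseriesr (g := fun j => (fine (P (long_edge_event v m j)))%:E)); last first.
  by move=> j _; rewrite fineK_prob//; exact: measurable_long_edge_event.
pose q : R := 2 `^ (d%:R - alpha * s).
have q1 : q < 1.
  have : d%:R - alpha * s < 0 by lra.
  by move=> /ltr2_powR; rewrite powRr0.
(* At most 2^((j + 3) d) displacements, each of probability at most C 2^(- (j + 1) alpha s): the
   shifts 3 and 1 make up the constant. *)
apply: (@nneseries_geometric_lty _ _ (2 `^ (3 * d%:R - alpha * s) * C) q).
- by rewrite mulr_ge0 ?powR_ge0.
- exact: powR_ge0.
- exact: q1.
move=> j; rewrite prob_ge0/=.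
apply: (le_trans (le_prob_bigsetU _ _ _)).
  move=> k; cbv zeta; case: ifP => // _.
  have mpre u (B : set R) : measurable B -> measurable (W u @^-1` B).
    by move=> mB; rewrite -[X in measurable X]setTI; exact: measurable_funPT.
  apply: measurableI; first by apply: measurableI; exact: mpre.
  rewrite (_ : mkset _ = conn [fset v; (v + cube_vertex (- (2 ^ j.+2)%:Z) k)%R]%fset @^-1` [set true])//.
  by rewrite -[X in measurable X]setTI; exact: measurable_funPT.
pose r : R := 2 ^+ j.+1.
apply: (@le_trans _ _ (\sum_(k <- enum [set: 'rV['I_(2 ^ j.+3)]_d]%SET) C * (r `^ alpha `^ s)^-1)).
  apply: ler_sum => k _; cbv zeta; case: ifP => [/asboolP[i zi]|_]; last first.
    by rewrite measure0 mulr_ge0// invr_ge0 powR_ge0.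
  apply: HC; first by rewrite /r exprn_egt1 ?ltr1n.
  rewrite opprD addrA subrr add0r enormN.
  apply: le_trans (enorm_ge_coord _ i); rewrite /r -natrX.
  by rewrite -intr_norm -abszE ler_nat.
rewrite big_const_seq count_predT -cardE cardsT card_mx card_ord mul1n.
rewrite iter_addr_0 -[leLHS]mulr_natl.
have E1 : ((2 ^ j.+3) ^ d)%:R = 2 `^ (j.+3%:R * d%:R) :> R.
  by rewrite -natrM powR_mulrn// exprM !natrX.
have E2 : (r `^ alpha `^ s)^-1 = 2 `^ (- (j.+1%:R * alpha * s)).
  by rewrite /r -powR_mulrn// -!powRrM powRN ?mulrA.
have E3 : q ^+ j = 2 `^ ((d%:R - alpha * s) * j%:R).
  by rewrite -powR_mulrn ?powR_ge0// /q -powRrM.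
rewrite E1 E2 E3 mulrCA [leRHS]mulrAC [leRHS]mulrC ler_wpM2l//.
rewrite -!powRD; do ?by apply/implyP.
rewrite le_eqVlt; apply/orP; left; apply/eqP; congr (2 `^ _).
by rewrite -(addn3 j) -(addn1 j) !natrD; ring.
Qed.

(** Borel-Cantelli is applied for each [v] and each cap [m], and [m] is chosen afterwards from the
    actual weight of [v]. An edge with a large coordinate then realises [long_edge_event] in the
    dyadic shell of its sup norm. *)
Lemma ae_locally_finite : {ae P, forall w, forall v, exists N : nat,
  forall y, adj conn w v y -> forall i, (`|((y - v) ord0 i)%R| < N)%N}.
Proof.
apply: ae_forall_countable => v.
have H : {ae P, forall w, forall m, exists n, forall j, (n <= j)%N ->
    ~ long_edge_event v m j w}.
  apply: ae_foralln => m; apply: Borel_Cantelli; last exact: long_edge_summable.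
  exact: measurable_long_edge_event.
apply: filterS2 H (ae_W_ge1 lawW_ge1 sfp) => w Hw W1.
have [m Wm] : exists m, W v w <= 2 ^+ m.
  by have [m Wm _] := powR_sum_dyadic (W1 v) (lexx 0); exists m.
have [n Hn] := Hw m; exists (2 ^ n.+1)%N => y vy i; rewrite ltnNge; apply/negP => yi.
pose z := y - v.
pose b := \max_(i < d) `|(z ord0 i)%R|%N.
have zb k : (`|z ord0 k| <= b)%N by exact: (leq_bigmax k).
have [k0 bE] : exists k0, b = `|z ord0 k0|%N.
  have cd : (0 < #|'I_d|)%N by rewrite card_ord.
  by have [k bk] := bigop.eq_bigmax (fun k : 'I_d => `|z ord0 k|%N) cd; exists k.
have nb : (2 ^ n.+1 <= b)%N by exact: leq_trans yi (zb i).
have b0 : (0 < b)%N by apply: leq_trans nb; rewrite expn_gt0.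
have [j /andP[bj1 bj2]] : exists j, (2 ^ j.+1 <= b < 2 ^ j.+2)%N.
  have := trunc_log_bounds (isT : (1 < 2)%N) b0.
  have : (n.+1 <= trunc_log 2 b)%N by rewrite trunc_log_max.
  by case: (trunc_log 2 b) => // j _ H; exists j.
have nj : (n <= j)%N.
  have : (2 ^ n.+1 < 2 ^ j.+2)%N by exact: leq_ltn_trans bj2.
  by rewrite ltn_exp2l.
apply: (Hn j nj); rewrite /long_edge_event -bigcup_seq.
have [k zk] : exists k : 'rV['I_(2 ^ j.+3)]_d, z = cube_vertex (- (2 ^ j.+2)%:Z) k.
  apply: cube_vertexP => i'; have := leq_ltn_trans (zb i') bj2.
  by rewrite (expnS 2 j.+2); move: (2 ^ j.+2)%N (z ord0 i') => M t; lia.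
exists k => /=; first by rewrite mem_enum inE.
have vz : v + z = y by rewrite /z addrC subrK.
rewrite -zk ifT; last by apply/asboolP; exists k0; rewrite -bE.
rewrite vz; split; last by move: vy => /andP[].
by split; rewrite /= in_itv /= ?W1// Wm.
Qed.

Lemma finite_set_gball w : (forall v, exists N : nat,
    forall y, adj conn w v y -> forall i, (`|((y - v) ord0 i)%R| < N)%N) ->
  forall n v, finite_set (gball (R := R) conn n v w).
Proof.
move=> fin; elim=> [|n IH] v.
  apply: (sub_finite_set (B := [set v])); last exact: finite_set1.
  move=> y /gballP[[|a p] [_ /= pl]] //.
apply: (sub_finite_set (B := [set v] `|`
    \bigcup_(z in gball (R := R) conn n v w) [set y | adj conn w z y])).
  move=> y /gballP[p]; elim/last_ind: p => [[_ /= <-] _|p z _ [pp <-] sp]; first by left.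
  right; exists (last v p); last by rewrite /= last_rcons; move: pp; rewrite rcons_path => /andP[].
  apply/gballP; exists p; last by move: sp; rewrite size_rcons.
  by split => //; move: pp; rewrite rcons_path => /andP[].
rewrite finite_setU; split; first exact: finite_set1.
apply: bigcup_finite => // z _; have [N HN] := fin z.
by apply: (sub_finite_set _ (finite_cube N z)) => y /= /HN.
Qed.

Lemma ae_finite_gball : {ae P, forall w, forall n v, finite_set (gball (R := R) conn n v w)}.
Proof. by apply: filterS ae_locally_finite => w; exact: finite_set_gball. Qed.

End local_finiteness.

(** * Fast paths through dyadic boxes *)

Section quantiles.
Context {R : realType}.
Variable mu : probability R R.
Hypothesis mu_ge0 : mu `[0, +oo[%classic = 1%E.
Implicit Types q t y h : R.

Let cdf_set q := [set t : R | (q%:E <= mu `]-oo, t]%classic)%E].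

Let cdf_set_neq0 q : q < 1 -> cdf_set q !=set0.
Proof.
move=> q1.
have c : fine (mu `]-oo, n%:R]%classic) @[n --> \oo] --> (1 : R).
  rewrite -[X in _ --> X](probT mu) (_ : setT = \bigcup_n `]-oo, n%:R]%classic); last first.
    apply/seteqP; split => // t _; exists (Num.truncn t).+1 => //=.
    by rewrite in_itv /= ltW// truncnS_gt.
  apply: cvg_prob => [n|n m nm]; first exact: measurable_itv.
  apply/subsetPset => t /=; rewrite !in_itv /= => /le_trans; apply.
  by rewrite ler_nat.
have [n _ /(_ n (leqnn n)) /= qn] : \forall n \near \oo, q < fine (mu `]-oo, n%:R]%classic).
  exact: (cvgr_gt _ c).
by exists n%:R; rewrite /cdf_set /= -fineK_prob ?lee_fin ?ltW.
Qed.

Let cdf_set_ge0 q t : 0 < q -> cdf_set q t -> 0 <= t.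
Proof.
move=> q0 qt; rewrite leNgt; apply/negP => t0.
suff z : mu `]-oo, t]%classic = 0%E.
  by move: qt; rewrite /cdf_set /= z lee_fin leNgt q0.
apply: (@subset_measure0 _ _ _ mu _ (~` `[0, +oo[%classic)) => //.
- exact: measurableC.
- move=> s /=; rewrite !in_itv /= andbT => st; apply/negP; rewrite -ltNge.
  exact: le_lt_trans st t0.
- have : mu (~` `[0, +oo[%classic) = 0%E; last exact.
  by rewrite probability_setC// mu_ge0 subee.
Qed.

Let has_inf_cdf_set q : 0 < q -> q < 1 -> has_inf (cdf_set q).
Proof.
by move=> q0 q1; split; [exact: cdf_set_neq0|exists 0 => t; exact: cdf_set_ge0].
Qed.

Lemma quantile_ge0 q : 0 < q -> q < 1 -> 0 <= quantile mu q.
Proof.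
by move=> q0 q1; apply: lb_le_inf; [exact: cdf_set_neq0|move=> t; exact: cdf_set_ge0].
Qed.

Lemma quantile_ndecr q q' : 0 < q -> q <= q' -> q' < 1 ->
  quantile mu q <= quantile mu q'.
Proof.
move=> q0 qq' q'1; apply: lb_le_inf; first exact: cdf_set_neq0.
move=> t q't; apply: ge_inf; first by exists 0 => s; exact: cdf_set_ge0.
by rewrite /cdf_set /= in q't *; apply: le_trans q't; rewrite lee_fin.
Qed.

Lemma le_cdf_quantile q e : 0 < q -> q < 1 -> 0 < e ->
  q <= fine (mu `]-oo, quantile mu q + e]%classic).
Proof.
move=> q0 q1 e0; have [t qt te] := inf_adherent e0 (has_inf_cdf_set q0 q1).
rewrite -lee_fin fineK_prob//; apply: (le_trans qt); apply: le_measure; rewrite ?inE//.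
by move=> s /=; rewrite !in_itv /= => /le_trans; apply; exact: ltW.
Qed.

Let Q y := quantile mu (expR (- expR y)).

Let q01 y : 0 < expR (- expR y) < 1.
Proof. by rewrite expR_gt0 -[ltRHS]expR0 ltr_expR oppr_lt0 expR_gt0. Qed.

(** The integrand is nonincreasing and the gaps are at least [h], so [h] times the sum, sampled at
    right ends, is below the explosion integral; [y 0] nonnegative keeps the intervals inside its
    domain. *)
Lemma quantile_sum_bounded (y : nat -> R) h : 0 < h -> 0 <= y 0%N ->
  (forall k, y k + h <= y k.+1) -> (explosion_integral mu < +oo)%E ->
  exists T : R, forall n, \sum_(k < n) Q (y k.+1) <= T.
Proof.
move=> h0 y0 yh Ifin.
have Q0 x : 0 <= Q x by have /andP[? ?] := q01 x; exact: quantile_ge0.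
have Qni x x' : x <= x' -> Q x' <= Q x.
  move=> xx'; have /andP[q0 _] := q01 x'; have /andP[_ q1] := q01 x.
  by apply: quantile_ndecr => //; rewrite ler_expR lerN2 ler_expR.
have mQ : measurable_fun setT Q.
  by apply: nonincreasing_measurable => // x x'; exact: Qni.
have yn n : y 0%N <= y n.
  by elim: n => // n IH; apply: (le_trans IH); apply: le_trans (yh n); rewrite lerDl ltW.
have step n : ((h * \sum_(k < n) Q (y k.+1))%:E <=
    \int[lebesgue_measure]_(x in `]y 0%N, y n]%classic) (Q x)%:E)%E.
  elim: n => [|n IH].
    by rewrite big_ord0 mulr0; apply: integral_ge0 => x _; rewrite lee_fin.
  have yn1 : y n <= y n.+1 by apply: le_trans (yh n); rewrite lerDl ltW.
  rewrite (_ : `]y 0%N, y n.+1]%classic = `]y 0%N, y n]%classic `|` `]y n, y n.+1]%classic); last first.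
    apply/seteqP; split => x /=; rewrite !in_itv /=.
      by move=> /andP[x1 x2]; have [xn|xn] := leP x (y n); [left|right]; rewrite ?x1 ?xn.
    by move=> [/andP[x1 x2]|/andP[x1 x2]]; apply/andP; split => //;
      [exact: le_trans x2 yn1|exact: le_lt_trans x1].
  rewrite ge0_integral_setU//; last 3 first.
  - by apply: measurable_funTS; exact/measurable_EFinP.
  - by move=> x _; rewrite lee_fin.
  - apply/disj_setPS => x [/=]; rewrite !in_itv /= => /andP[_ x1] /andP[x2 _].
    by have := le_lt_trans x1 x2; rewrite ltxx.
  rewrite big_ord_recr /= mulrDr EFinD; apply: leeD => //.
  apply: (@le_trans _ _ (\int[lebesgue_measure]_(x in `]y n, y n.+1]%classic) (Q (y n.+1))%:E)%E).
    apply: (@le_trans _ _ ((Q (y n.+1))%:E *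
        lebesgue_measure (`]y n, y n.+1]%classic : set R))%E); last first.
      by rewrite integral_cst.
    rewrite lebesgue_measure_itv /= lte_fin ifT; last first.
      by apply: lt_le_trans (yh n); rewrite ltrDl.
    rewrite -EFinB -EFinM lee_fin mulrC ler_wpM2l//.
    by rewrite lerBrDr addrC.
  apply: ge0_le_integral.
  - exact: measurable_itv.
  - by move=> x _; rewrite lee_fin.
  - exact: measurable_cst.
  - by apply: measurable_funTS; exact/measurable_EFinP.
  - by move=> x /=; rewrite in_itv /= lee_fin => /andP[_]; exact: Qni.
exists (fine (explosion_integral mu) / h) => n.
rewrite ler_pdivlMr// mulrC -lee_fin fineK; last first.
  by rewrite ge0_fin_numE//; apply: integral_ge0 => x _; rewrite lee_fin; exact: Q0.
apply: (le_trans (step n)); apply: ge0_subset_integral => //.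
- by apply: measurable_funTS; exact/measurable_EFinP.
- by move=> x _; rewrite lee_fin.
- by move=> x /=; rewrite !in_itv /= andbT => /andP[x1 _]; exact: le_lt_trans x1.
Qed.

End quantiles.

(** * Integer exponents of geometric growth *)

Section scales.
Context {R : realType}.
Variable K : nat.
Hypothesis K_gt0 : (0 < K)%N.

(* An integer version of geometric growth with ratio [1 + 1 / K]; starting at
   [2 * K] keeps the rounding error below half of the increment. *)
Fixpoint scale (k : nat) : nat :=
  if k is j.+1 then (scale j + scale j %/ K)%N else (2 * K)%N.

Lemma scale_ge k : (2 * K <= scale k)%N.
Proof. by elim: k => //= k IH; rewrite (leq_trans IH)// leq_addr. Qed.

Lemma scale_lt k : (scale k + 2 <= scale k.+1)%N.
Proof. by rewrite /= leq_add2l leq_divRL// scale_ge. Qed.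

Lemma scale_mono i j : (i < j)%N -> (scale i < scale j)%N.
Proof.
elim: j => // j IH; rewrite ltnS leq_eqVlt => /predU1P[->|/IH].
  by apply: leq_trans (scale_lt j); rewrite addn2 ltnS leqnSn.
by move=> /leq_trans; apply; apply: leq_trans (scale_lt j); rewrite leq_addr.
Qed.

Lemma scale_ge_id k : (k <= scale k)%N.
Proof. by elim: k => // k IH; apply: leq_trans (scale_lt k); lia. Qed.

(** Because (1 + 1/K) (1 - 1/K) is at most 1. It controls the loss due to the smaller threshold in
    [edge_exponent_ge]. *)
Lemma scale_ratio_le k : (scale k.+1)%:R * (1 - K%:R^-1) <= (scale k)%:R :> R.
Proof.
have K0 : 0 < K%:R :> R by rewrite ltr0n.
have : ((scale k %/ K) * K)%:R <= (scale k)%:R :> R by rewrite ler_nat leq_divM.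
rewrite natrM -ler_pdivlMr// => q.
rewrite /= natrD; set s := (scale k)%:R in q *; set r := _%:R in q *.
have r0 : 0 <= r by rewrite ler0n.
have K1 : K%:R^-1 * s = s / K%:R by rewrite mulrC.
have : 0 <= r * K%:R^-1 by rewrite mulr_ge0// invr_ge0 ltW.
by lra.
Qed.

Lemma scale_ratio_ge k : (scale k)%:R * (1 + (2 * K%:R)^-1) <= (scale k.+1)%:R :> R.
Proof.
have K0 : 0 < K%:R :> R by rewrite ltr0n.
rewrite /= natrD mulrDr mulr1 lerD2l ler_pdivrMr ?mulr_gt0// -natrM -natrM ler_nat.
have q2 : (2 <= scale k %/ K)%N by rewrite leq_divRL// scale_ge.
have := divn_eq (scale k) K; have := ltn_pmod (scale k) K_gt0.
by move: (scale k %/ K)%N (scale k %% K)%N q2 => q r q2 rK ->; nia.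
Qed.

End scales.

Lemma fine_prod {R : realType} (I : Type) (r : seq I) (x : I -> \bar R) :
  (forall i, x i \is a fin_num) ->
  (\prod_(i <- r) x i)%E = (\prod_(i <- r) fine (x i))%:E.
Proof.
move=> xf; elim: r => [|i r IH]; first by rewrite !big_nil.
by rewrite !big_cons IH EFinM fineK.
Qed.

Lemma prob_bigsetI {R : realType} {disp : measure_display} {Omega : measurableType disp}
    (P : probability Omega R) (J I : choiceType) (D : set I)
    (G : I -> set_system Omega) (h : J -> I) (r : seq J) (A : I -> set Omega) :
  mutually_independent P D G -> injective h -> uniq r ->
  (forall j, D (h j)) -> (forall j, G (h j) (A (h j))) ->
  P (\big[setI/setT]_(j <- r) A (h j)) = (\prod_(j <- r) P (A (h j)))%E.
Proof.
move=> indG h_inj ur Dh GA.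
have pr : perm_eq [fset h j | j in r]%fset (map h r).
  apply: uniq_perm => //; first by rewrite map_inj_uniq.
  by move=> i; apply/imfsetP/mapP => -[j jr ->]; exists j.
rewrite -(big_map h xpredT A) -(perm_big _ pr) /= -bigcap_seq.
rewrite (indG [fset h j | j in r]%fset A); last first.
  by move=> _ /imfsetP[j /= _ ->]; split.
by rewrite (perm_big _ pr) big_map.
Qed.

(** One term of the exponential series. It lets exponentially small probabilities in a power of the
    side beat any polynomial number of vertices. *)
Lemma expR_le_inv_exp {R : realType} (j : nat) (x : R) : 0 < x ->
  expR (- x) <= (j.+1)`!%:R / x ^+ j.+1.
Proof.
move=> x0; have := expR_ge1Dxn j (ltW x0) => h.
rewrite expRN ler_pdivlMr ?exprn_gt0// mulrC ler_pdivrMr ?expR_gt0//.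
rewrite mulrC -ler_pdivrMr ?ltr0n ?fact_gt0//.
by apply: le_trans h; rewrite lerDr.
Qed.

Lemma expR_opp_ln2 {R : realType} (a : R) : expR (- (a * ln 2)) = 2 `^ (- a).
Proof. by rewrite /powR pnatr_eq0 /= mulNr. Qed.

(** * Good vertices, missing edges and slow steps *)

Section dyadic_boxes.
Context {R : realType} {d : nat} {alpha lambda tau : R} {l : R -> R}
  {lawW lawL : probability R R}
  {disp : measure_display} {Omega : measurableType disp}
  {P : probability Omega R} {W : 'rV[int]_d -> {RV P >-> R}}
  {conn : {fset 'rV[int]_d} -> {RV P >-> bool}}
  {L : {fset 'rV[int]_d} -> {RV P >-> R}}.
Notation vertex := 'rV[int]_d.
Notation edges_prob := (@edges_prob R d alpha lambda).
Hypothesis d_gt0 : (1 <= d)%N.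
Hypothesis lambda_gt0 : 0 < lambda.
Hypothesis alpha_gt0 : 0 < alpha.
Hypothesis lawW_ge1 : lawW `[1, +oo[%classic = 1%E.
Hypothesis l_slow : slowly_varying l.
Hypothesis lawW_tail : forall t : R, 0 < t ->
  lawW `]t, +oo[%classic = (l t / t `^ (tau - 1))%:E.
Hypothesis lawL_ge0 : lawL `[0, +oo[%classic = 1%E.
Hypothesis sfp : is_SFP alpha lambda lawW lawL W conn L.

Variables (rho delta b : R) (K : nat).
Hypothesis K_gt0 : (0 < K)%N.
Hypothesis rho_gt0 : 0 < rho.
Hypothesis delta_gt0 : 0 < delta.
Hypothesis b_gt0 : 0 < b.
Hypothesis b_tau : tau - 1 < b.
Hypothesis many_good : 2 * delta <= d%:R - b * rho.
Hypothesis edges_likely : alpha + delta <= rho * (2 - K%:R^-1).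

(* The k-th box is the cube [[2 ^ n k, 2 ^ (n k).+1 [^d]. It has about
   [2 ^ ((d - b * rho) * n k)] vertices of weight above [2 ^ (rho * n k)], and two
   such vertices in consecutive boxes are joined with probability close to 1. *)
Let n k := scale K k.
Let N k := (2 ^ n k)%N.
(** The power of 2 obtained by rounding down the exponent [rho * n k], so that its tail is a
    [dyadic_tail]; the rounding loses a factor of at most 2. *)
Let threshold k : R := 2 ^+ Num.truncn (rho * (n k)%:R).
Let pos k (u : 'rV['I_(N k)]_d) : vertex := cube_vertex (N k)%:Z u.

Definition good_event k v : set Omega := W v @^-1` `]threshold k, +oo[.

(** First coordinates differ: they lie in [N i, 2 N i) and in [N j, 2 N j), and the sides at least
    double from one scale to the next. *)
Lemma box_vertex_neq i j u v : (i < j)%N -> @pos i u != @pos j v.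
Proof.
move=> ij; apply/eqP => /rowP/(_ (Ordinal d_gt0)).
have := cube_vertex_itv (N i)%:Z u (Ordinal d_gt0).
have := cube_vertex_itv (N j)%:Z v (Ordinal d_gt0).
have : (N i + N i <= N j)%N.
  by rewrite addnn -mul2n /N -expnS leq_exp2l// scale_mono.
have -> : pos u 0 (Ordinal d_gt0) = cube_vertex (N i)%:Z u ord0 (Ordinal d_gt0).
  by congr (cube_vertex _ _ _ _); exact: val_inj.
have -> : pos v 0 (Ordinal d_gt0) = cube_vertex (N j)%:Z v ord0 (Ordinal d_gt0).
  by congr (cube_vertex _ _ _ _); exact: val_inj.
by lia.
Qed.

Lemma box_vertex_dist k u v :
  enorm (@pos k u - @pos k.+1 v) <= d%:R * (2 * 2 ^+ n k.+1) :> R.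
Proof.
apply: enorm_le_coord; first by rewrite mulr_ge0// exprn_ge0.
move=> i; rewrite -intr_norm -natrX -natrM -[leRHS]mulrz_nat ler_int.
have := cube_vertex_itv (N k)%:Z u i; have := cube_vertex_itv (N k.+1)%:Z v i.
have : (N k <= N k.+1)%N by rewrite leq_exp2l// ltnW// scale_mono.
have -> : (pos u - pos v) ord0 i = pos u ord0 i - pos v ord0 i by rewrite !mxE.
have -> : (2 ^ n k.+1 = N k.+1)%N by [].
rewrite natz; have G (p q : int) (a c : nat) : (a <= c)%N ->
  c%:Z <= q < c%:Z + c%:Z -> a%:Z <= p < a%:Z + a%:Z -> `|p - q| <= (2 * c)%N by lia.
exact: G.
Qed.

Let mpre v (B : set R) : measurable B -> measurable (W v @^-1` B).
Proof. by move=> mB; rewrite -[X in measurable X]setTI; exact: measurable_funPT. Qed.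

Let mpreL e (B : set R) : measurable B -> measurable (L e @^-1` B).
Proof. by move=> mB; rewrite -[X in measurable X]setTI; exact: measurable_funPT. Qed.

Let mconn e : measurable [set w | conn e w].
Proof.
rewrite (_ : mkset _ = conn e @^-1` [set true])//.
by rewrite -[X in measurable X]setTI; exact: measurable_funPT.
Qed.

Lemma measurable_good_event k v : measurable (good_event k v).
Proof. exact: mpre. Qed.

(** The 4 pays for the rounding of two thresholds, and the denominator for the constant in
    [box_vertex_dist]. *)
Let c1 : R := lambda / 4 / (2 * d%:R) `^ alpha.

Let c1_gt0 : 0 < c1.
Proof. by rewrite !divr_gt0 ?powR_gt0 ?mulr_gt0 ?ltr0n. Qed.

Let threshold_ge k : 2 `^ (rho * (n k)%:R - 1) <= threshold k.
Proof.
rewrite /threshold -powR_mulrn// ler_powR ?ler1n//.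
by have := truncnS_gt (rho * (n k)%:R); rewrite -natr1; lra.
Qed.

(** In base 2 the exponent is rho (n k + n k.+1) - alpha n k.+1 up to a constant. As n k is at least
    (1 - 1/K) n k.+1, the hypothesis [edges_likely] bounds it below by delta n k.+1. *)
Lemma edge_exponent_ge k (x y : R) (r : R) : threshold k < x -> threshold k.+1 < y ->
  0 < r -> r <= d%:R * (2 * 2 ^+ n k.+1) ->
  c1 * 2 `^ (delta * (n k.+1)%:R) <= lambda * x * y / r `^ alpha.
Proof.
move=> xk yk r0 rd.
have D0 : 0 < d%:R :> R by rewrite ltr0n.
have ra : r `^ alpha <= (2 * d%:R) `^ alpha * 2 `^ (alpha * (n k.+1)%:R).
  apply: (@le_trans _ _ ((d%:R * (2 * 2 ^+ n k.+1)) `^ alpha)).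
    by rewrite ge0_ler_powR ?nnegrE ?(ltW alpha_gt0) ?(ltW r0) ?mulr_ge0 ?exprn_ge0.
  by rewrite mulrA (mulrC d%:R) powRM ?mulr_ge0 ?exprn_ge0// -(powR_mulrn (n k.+1) (ler0n _ 2)) -powRrM (mulrC alpha).
have xy : 2 `^ (rho * (n k)%:R - 1) * 2 `^ (rho * (n k.+1)%:R - 1) <= x * y.
  by apply: ler_pM; rewrite ?powR_ge0// (le_trans (threshold_ge _))// ltW.
rewrite ler_pdivlMr ?powR_gt0//.
apply: (@le_trans _ _ (c1 * 2 `^ (delta * (n k.+1)%:R) *
    ((2 * d%:R) `^ alpha * 2 `^ (alpha * (n k.+1)%:R)))).
  by rewrite ler_wpM2l// mulr_ge0 ?powR_ge0// ltW.
apply: (@le_trans _ _ (lambda * (2 `^ (rho * (n k)%:R - 1) * 2 `^ (rho * (n k.+1)%:R - 1)))); last first.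
  by rewrite -(mulrA lambda x y) ler_wpM2l// ltW.
rewrite /c1 [leLHS](_ : _ = lambda / 4 *
    (2 `^ (delta * (n k.+1)%:R) * 2 `^ (alpha * (n k.+1)%:R))); last first.
  have := powR_gt0 alpha (mulr_gt0 (ltr0Sn R 1) D0) => h0.
  by field; rewrite gt_eqF.
rewrite -mulrA ler_wpM2l ?(ltW lambda_gt0)//.
have -> : 4^-1 = 2 `^ (- 2) :> R.
  by rewrite powR_invn// -natrX.
rewrite -!powRD; do ?by apply/implyP.
rewrite ler_powR ?ler1n//.
have sr := scale_ratio_le (R := R) K_gt0 k.
have := ler_wpM2l (ltW rho_gt0) sr.
have n0 : 0 <= (n k.+1)%:R :> R by rewrite ler0n.
have := ler_wpM2r n0 edges_likely.
rewrite /n; move: (scale K k)%:R (scale K k.+1)%:R => s1 s2.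
by lra.
Qed.

Definition missing_edge_event k u v : set Omega :=
  (good_event k (@pos k u) `&` good_event k.+1 (@pos k.+1 v)) `\`
  [set w | conn [fset pos u; pos v]%fset w].

Lemma prob_missing_edge k u v :
  fine (P (@missing_edge_event k u v)) <= expR (- (c1 * 2 `^ (delta * (n k.+1)%:R))).
Proof.
set x := pos u; set y := pos v.
have xy : x != y by exact: box_vertex_neq.
set A := good_event k x `&` good_event k.+1 y.
have mA : measurable A by apply: measurableI; exact: measurable_good_event.
have sA : sigma_family setT (fun x => W x : Omega -> R) A.
  by apply: sigma_family_setI => //; exact: (sigma_family_W (W := W)).
set v0 := expR _.
have v01 : v0 <= 1 by rewrite -[leRHS]expR0 ler_expR oppr_le0 mulr_ge0 ?powR_ge0// ltW.
(* On [A] the conditional probability of the edge is at least [1 - v0]. Integrating over [A] leaves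
   at most [v0 * P A] for a missing edge, and [P A] is at most 1. *)
suff PA : (1 - v0) * fine (P A) <= fine (P (A `&` [set w | conn [fset x; y]%fset w])).
  rewrite probD//; have := prob_le1 P mA; have := prob_ge0 P A.
  have : 0 <= v0 by exact: expR_ge0.
  by move: PA; nra.
rewrite -lee_fin EFinM !fineK_prob//; last exact: measurableI.
rewrite (prob_conn1 lawW_ge1 sfp xy sA).
rewrite -(integral_cst P mA (1 - v0)%:E).
apply: ge0_le_integral => //.
- by move=> w _; rewrite lee_fin subr_ge0.
- apply/measurable_EFinP/measurable_funTS.
  apply: (measurable_edges_prob (f := fun v w => W v w)) => //.
  by move=> e; rewrite inE => /eqP ->; rewrite /pairs /= cardfs2 xy.
move=> w [/=]; rewrite /good_event /= !in_itv /= !andbT => Wx Wy; rewrite lee_fin.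
rewrite /edges_prob big_seq_fset1 (edge_probE _ _ _ xy); case: ifPn => _.
  by rewrite lerBlDr lerDl expR_ge0.
have t0 j : 0 < threshold j by rewrite exprn_gt0.
rewrite lerD2l lerN2 ler_expR lerN2.
rewrite !gtr0_norm ?(lt_trans (t0 _) Wx) ?(lt_trans (t0 _) Wy)//.
apply: (edge_exponent_ge Wx Wy); last exact: box_vertex_dist.
rewrite lt_def; apply/andP; split; last by rewrite sqrtr_ge0.
apply/eqP => e0; move/eqP : xy; apply; apply/rowP => i.
have := enorm_ge_coord (R := R) (x - y) i; rewrite e0 normr_le0 intr_eq0 mxE => /eqP.
by rewrite [(- y) _ _]mxE => /eqP; rewrite subr_eq0 => /eqP; rewrite (_ : ord0 = 0) //; exact: val_inj.
Qed.

(** The presence of the edge is left to [missing_edge_event]. What remains involves one vertex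
    weight and one edge weight for each [v], hence is independent over [v]. *)
Definition quick_event k (t : R) x (v : 'rV['I_(N k)]_d) : set Omega :=
  good_event k (pos v) `&` L [fset x; pos v]%fset @^-1` `]-oo, t]%classic.

Let prob_quick_aux k t x (r : seq 'rV['I_(N k)]_d) : uniq r ->
  (forall v, x != @pos k v) ->
  fine (P (\big[setI/setT]_(v <- r) quick_event t x v)) =
  (dyadic_tail lawW (Num.truncn (rho * (n k)%:R)) * fine (lawL `]-oo, t]%classic)) ^+ size r.
Proof.
move=> ur xr.
have [lawWE indW] := sfp_W sfp; have [lawLE indL] := sfp_L sfp.
have xp v : pairs [fset x; @pos k v]%fset by rewrite /pairs /= cardfs2 xr.
rewrite big_split /= setIC.
pose AL e := L e @^-1` `]-oo, t]%classic.
have hL : injective (fun v => [fset x; @pos k v]%fset).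
  move=> v v' /fsetP/(_ (pos v)); rewrite !inE eqxx orbT eq_sym (negbTE (xr v)) /=.
  by move=> /esym/eqP; exact: cube_vertex_inj.
rewrite (sfp_L_indep sfp); last 2 first.
- pose M := g_sigma_algebraType (\bigcup_(e in pairs) g_sigma_algebra_preimage (L e)).
  apply: (@bigsetI_measurable _ M) => v _.
  by apply: sub_sigma_algebra; exists [fset x; @pos k v]%fset => //; exists `]-oo, t]%classic => //; rewrite setTI.
- pose G := sigma_family setT (fun x => W x : Omega -> R) `|`
    sigma_family pairs (fun e => conn e : Omega -> bool).
  pose M := g_sigma_algebraType G.
  apply: (@bigsetI_measurable _ M) => v _.
  by apply: sub_sigma_algebra; left; exact: (sigma_family_W (W := W)).
rewrite (prob_bigsetI (A := AL) (h := fun v => [fset x; @pos k v]%fset) indL hL ur)//; last first.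
  by move=> v; exists `]-oo, t]%classic => //; rewrite setTI.
rewrite (prob_bigsetI (A := good_event k) (h := @pos k) indW _ ur)//; last 2 first.
- exact: cube_vertex_inj.
- by move=> v; exists `]threshold k, +oo[%classic => //; rewrite setTI.
rewrite !fine_prod; last 2 first.
- by move=> v; apply: fin_num_measure; exact: measurable_good_event.
- by move=> v; apply: fin_num_measure; exact: mpreL.
rewrite -EFinM /= -big_split /=.
rewrite (eq_bigr (fun=> dyadic_tail lawW (Num.truncn (rho * (n k)%:R)) * fine (lawL `]-oo, t]%classic))).
  by rewrite big_const_seq count_predT -Monoid.iteropE /= -/(GRing.exp _ _).
by move=> v _; rewrite mulrC (has_law_preimage (sfp_W sfp))// (lawLE _ (xp v)).
Qed.

Definition slow_event k t x : set Omega :=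
  \big[setI/setT]_(v <- enum [set: 'rV['I_(N k)]_d]%SET) ~` quick_event t x v.

(** The candidates fail independently, which gives a power of [1 - g] bounded by an exponential.
    [prob_quick_aux] covers every duplicate-free list because [independent_setC] asks for all
    subfamilies. *)
Lemma prob_slow_event k t x : (forall v, x != @pos k v) ->
  fine (P (slow_event k t x)) <=
  expR (- (((2 ^ n k) ^ d)%:R * (dyadic_tail lawW (Num.truncn (rho * (n k)%:R)) *
     fine (lawL `]-oo, t]%classic)))).
Proof.
move=> xr.
have mU v : measurable (@quick_event k t x v).
  by apply: measurableI; [exact: measurable_good_event|exact: mpreL].
set g := dyadic_tail _ _ * _.
have PU (v : 'rV['I_(N k)]_d) : fine (P (quick_event t x v)) = g.
  have := @prob_quick_aux k t x [:: v] isT xr; rewrite big_seq1 expr1; exact.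
have H : fine (P (slow_event k t x)) =
    \prod_(v <- enum [set: 'rV['I_(N k)]_d]%SET) (1 - fine (P (quick_event t x v))).
  have := @independent_setC _ _ _ P _ (@quick_event k t x) mU [::]
    (enum [set: 'rV['I_(N k)]_d]%SET) (enum_uniq _).
  rewrite !big_nil setTI mul1r; apply => r ur _.
  rewrite prob_quick_aux// (eq_bigr (fun=> g)) => [|v _]; last exact: PU.
  by rewrite big_const_seq count_predT -Monoid.iteropE /= -/(GRing.exp _ _).
rewrite H (eq_bigr (fun=> 1 - g)) => [|v _]; last by rewrite PU.
rewrite big_const_seq count_predT -cardE cardsT card_mx card_ord mul1n.
rewrite iter_mulr_1 -(mulrN _ g) expRM_natl.
have [g0 g1] : 0 <= g /\ g <= 1.
  have := PU (const_mx (Ordinal (expn_gt0 2 (n k)))) => <-.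
  by split; [exact: prob_ge0|exact: prob_le1].
apply: lerXn2r; rewrite ?nnegrE ?expR_ge0 ?subr_ge0//.
exact: expR_ge1Dx.
Qed.

(* A vertex has at least [2 ^ (2 * delta * n k)] good candidates in the k-th box, so
   one of them is likely to be reached within a quantile of order [q k]. The term
   [2^-1 ^+ k] makes up for the infimum in [quantile] and is summable. *)
Let q k : R := 2 `^ (- (delta * (n k)%:R)).
Let time k : R := quantile lawL (q k) + 2^-1 ^+ k.

Let q01 k : 0 < q k < 1.
Proof.
have n0 : (0 < n k)%N by apply: leq_trans (scale_ge K k); rewrite muln_gt0.
have : - (delta * (n k)%:R) < 0 by rewrite oppr_lt0 mulr_gt0// ltr0n.
by move=> /ltr2_powR; rewrite powRr0 powR_gt0.
Qed.

Definition bad_event k : set Omega :=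
  \big[setU/set0]_(u <- enum [set: 'rV['I_(N k)]_d]%SET)
    \big[setU/set0]_(v <- enum [set: 'rV['I_(N k.+1)]_d]%SET) missing_edge_event u v `|`
  \big[setU/set0]_(u <- enum [set: 'rV['I_(N k)]_d]%SET)
    slow_event k.+1 (time k.+1) (pos u).

Let measurable_missing k u v : measurable (@missing_edge_event k u v).
Proof.
by apply: measurableD; [apply: measurableI; exact: measurable_good_event|exact: mconn].
Qed.

Let measurable_slow k s x : measurable (slow_event k s x).
Proof.
apply: bigsetI_measurable => v _; apply: measurableC.
by apply: measurableI; [exact: measurable_good_event|exact: mpreL].
Qed.

Lemma measurable_bad_event k : measurable (bad_event k).
Proof.
apply: measurableU; apply: bigsetU_measurable => u _ //.
exact: bigsetU_measurable.
Qed.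

Let sum_box k (x : R) : \sum_(u <- enum [set: 'rV['I_(N k)]_d]%SET) x = 2 `^ (d%:R * (n k)%:R) * x.
Proof.
rewrite big_const_seq count_predT -cardE cardsT card_mx card_ord mul1n iter_addr_0.
by rewrite -[LHS]mulr_natl; congr (_ * _); rewrite -natrM powR_mulrn// mulnC exprM -!natrX.
Qed.

(** In base 2 the box contributes d n k, a good weight costs at most b rho n k up to a constant, and
    a quick edge costs delta n k. By [many_good] at least delta n k is left. *)
Let slow_exponent : exists2 c, 0 < c & forall k,
  c * 2 `^ (delta * (n k)%:R) <= ((2 ^ n k) ^ d)%:R *
    (dyadic_tail lawW (Num.truncn (rho * (n k)%:R)) * fine (lawL `]-oo, time k]%classic)).
Proof.
have [c c0 Hc] := dyadic_tail_ge l_slow lawW_tail b_tau.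
exists c => // k.
have n0 : 0 <= (n k)%:R :> R by [].
have h1 : c * 2 `^ (- (b * rho * (n k)%:R)) <= dyadic_tail lawW (Num.truncn (rho * (n k)%:R)).
  apply: le_trans (Hc _); rewrite ler_wpM2l ?(ltW c0)// -powR_mulrn ?powR_ge0// -powRrM.
  rewrite ler_powR ?ler1n// mulNr lerN2 -mulrA ler_wpM2l ?(ltW b_gt0)//.
  by rewrite truncn_le// mulr_ge0// ltW.
have h2 : q k <= fine (lawL `]-oo, time k]%classic).
  by have /andP[? ?] := q01 k; apply: le_cdf_quantile => //; rewrite exprn_gt0// invr_gt0.
have -> : ((2 ^ n k) ^ d)%:R = 2 `^ (d%:R * (n k)%:R) :> R.
  by rewrite -natrM powR_mulrn// mulnC exprM -!natrX.
apply: (@le_trans _ _ (2 `^ (d%:R * (n k)%:R) * (c * 2 `^ (- (b * rho * (n k)%:R)) * q k))); last first.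
  by rewrite ler_wpM2l ?powR_ge0// ler_pM// ?mulr_ge0 ?powR_ge0// ltW.
rewrite mulrA mulrCA -[leRHS]mulrA ler_wpM2l ?(ltW c0)//.
rewrite /q -!powRD; do ?by apply/implyP.
rewrite ler_powR ?ler1n//.
by have := ler_wpM2r n0 many_good; lra.
Qed.

Lemma prob_bad_event : exists2 C, 0 <= C & forall k, fine (P (bad_event k)) <= C * 2^-1 ^+ k.
Proof.
have [c2 c20 Hc2] := slow_exponent.
pose c := Num.min c1 c2.
have c0 : 0 < c by rewrite lt_min c1_gt0.
pose X k : R := 2 `^ (delta * (n k.+1)%:R).
have X0 k : 0 < X k by exact: powR_gt0.
have H1 k : fine (P (bad_event k)) <= 2 * (2 `^ (2 * d%:R * (n k.+1)%:R) * expR (- (c * X k))).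
  have nk : d%:R * (n k)%:R <= d%:R * (n k.+1)%:R :> R.
    by rewrite ler_wpM2l// ler_nat ltnW// scale_mono.
  have dn0 : 0 <= d%:R * (n k.+1)%:R :> R by rewrite mulr_ge0.
  apply: (le_trans (le_prob_setU _ _ _)).
  - by apply: bigsetU_measurable => u _; exact: bigsetU_measurable.
  - exact: bigsetU_measurable.
  rewrite mulr_natl mulr2n; apply: lerD.
    apply: (le_trans (le_prob_bigsetU _ _ _)); first by move=> u; exact: bigsetU_measurable.
    apply: (@le_trans _ _ (\sum_(u <- enum [set: 'rV['I_(N k)]_d]%SET)
        2 `^ (d%:R * (n k.+1)%:R) * expR (- (c * X k)))).
      apply: ler_sum => u _; apply: (le_trans (le_prob_bigsetU _ _ _)) => //.
      rewrite -sum_box; apply: ler_sum => v _.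
      apply: (le_trans (prob_missing_edge _ _)).
      by rewrite ler_expR lerN2 ler_wpM2r ?(ltW (X0 k))// ge_min lexx.
    rewrite sum_box mulrA ler_wpM2r ?expR_ge0// -powRD; last exact/implyP.
    by rewrite ler_powR ?ler1n//; lra.
  apply: (le_trans (le_prob_bigsetU _ _ _)) => //.
  apply: (@le_trans _ _ (\sum_(u <- enum [set: 'rV['I_(N k)]_d]%SET) expR (- (c * X k)))).
    apply: ler_sum => u _; apply: (le_trans (prob_slow_event _ _)).
      by move=> v; exact: box_vertex_neq.
    rewrite ler_expR lerN2; apply: le_trans (Hc2 _).
    by rewrite ler_wpM2r ?(ltW (X0 k))// ge_min lexx orbT.
  rewrite sum_box ler_wpM2r ?expR_ge0// ler_powR ?ler1n//; lra.
(* The power [j.+1] of [X k] absorbs the at most 2^(2 d n k.+1) pairs of the union bound and leaves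
   a factor 2^(- n k.+1), which is geometric in [k] since the scales grow at least linearly. *)
pose j := Num.truncn ((2 * d%:R + 1) / delta).
have jd : 2 * d%:R + 1 <= delta * j.+1%:R.
  by rewrite [delta * _]mulrC -ler_pdivrMr// ltW// truncnS_gt.
exists (2 * (j.+1`!%:R / c ^+ j.+1)).
  by rewrite mulr_ge0// divr_ge0// exprn_ge0// ltW.
move=> k; apply: (le_trans (H1 k)); rewrite -[leRHS]mulrA ler_wpM2l//.
apply: (@le_trans _ _ (2 `^ (2 * d%:R * (n k.+1)%:R) * (j.+1`!%:R / (c * X k) ^+ j.+1))).
  by rewrite ler_wpM2l ?powR_ge0// expR_le_inv_exp// mulr_gt0.
rewrite exprMn invfM [leLHS](_ : _ = j.+1`!%:R / c ^+ j.+1 *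
  (2 `^ (2 * d%:R * (n k.+1)%:R) / X k ^+ j.+1)); last by ring.
rewrite ler_wpM2l// ?divr_ge0// ?exprn_ge0 ?(ltW c0)//.
rewrite exprVn -(powR_mulrn k (ler0n _ 2)) -(powR_mulrn _ (ltW (X0 k))) /X -powRrM -!powRN -powRD; last exact/implyP.
rewrite ler_powR ?ler1n//.
have kn : k%:R <= (n k.+1)%:R :> R.
  by rewrite ler_nat (leq_trans (leqnSn k))// scale_ge_id.
have := ler_wpM2r (ler0n R (n k.+1)) jd; lra.
Qed.

Lemma box_path w k0 : (forall k, (k0 <= k)%N -> ~ bad_event k w) ->
  exists s : nat -> vertex, [/\ forall i j, s i = s j -> i = j,
    forall i, adj conn w (s i) (s i.+1) &
    forall i, L [fset s i; s i.+1]%fset w <= time (k0 + i).+2].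
Proof.
move=> nbad.
pose good k x := exists2 u, x = @pos k u & good_event k x w.
have quick k u : (k0 <= k)%N -> exists2 v, good_event k.+1 (pos v) w &
    L [fset @pos k u; @pos k.+1 v]%fset w <= time k.+1.
  move=> kk; apply: contrapT => nv; apply: (nbad k kk); right.
  rewrite -bigcup_seq; exists u => /=; first by rewrite mem_enum inE.
  rewrite /slow_event -bigcap_seq => v _ [gv /=]; rewrite in_itv /= => Lv.
  by apply: nv; exists v.
(* The successor is made total, with the vertex itself as default value off the good vertices, so
   that the axiom of choice applies. *)
have step (a : nat * vertex) : exists y, (k0 <= a.1)%N -> good a.1 a.2 ->
    [/\ good a.1.+1 y, adj conn w a.2 y & L [fset a.2; y]%fset w <= time a.1.+1].
  case: a => k x /=; have [[kk [u xu gx]]|h] := pselect ((k0 <= k)%N /\ good k x); last first.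
    by exists x => kk gx; exfalso; apply: h.
  have [v gv Lv] := quick k u kk; exists (pos v) => _ _; split.
  - by exists v.
  - rewrite xu /adj /= box_vertex_neq//=; apply: contrapT => /negP nc.
    apply: (nbad k kk); left; rewrite -bigcup_seq; exists u => /=; first by rewrite mem_enum inE.
    rewrite -bigcup_seq; exists v => /=; first by rewrite mem_enum inE.
    by split; [split; rewrite // -xu|apply/negP].
  - by rewrite xu.
have [f fP] := choice step.
(* [slow_event] is excluded from every vertex of box [k0], good or not, so a corner of that box
   provides the first good vertex. The path therefore starts in box [k0.+1] and its i-th edge ends
   in box [(k0 + i).+2]. *)
have [v0 g0 _] := quick k0 (const_mx (Ordinal (expn_gt0 2 (n k0)))) (leqnn _).
pose fix s i : vertex := if i is j.+1 then f ((k0 + j).+1, s j) else pos v0.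
have sP i : good (k0 + i).+1 (s i).
  elim: i => [|i IH]; first by rewrite addn0; exists v0.
  by have [|gs _ _] := fP ((k0 + i).+1, s i) _ IH; rewrite /= ?addnS// leqW// leq_addr.
exists s; split.
- suff lt_neq i j : (i < j)%N -> s i <> s j.
    by move=> i j sij; have [/lt_neq|/lt_neq/nesym|//] := ltngtP i j.
  move=> ij; have [u su _] := sP i; have [v sv _] := sP j; rewrite su sv => /eqP.
  by apply/negP/box_vertex_neq; rewrite ltnS ltn_add2l.
- by move=> i; have [|_ ? _] := fP ((k0 + i).+1, s i) _ (sP i); rewrite //= leqW// leq_addr.
- by move=> i; have [|_ _] := fP ((k0 + i).+1, s i) _ (sP i); rewrite //= leqW// leq_addr.
Qed.

Lemma time_sum_bounded : (explosion_integral lawL < +oo)%E ->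
  exists k1, forall k0, (k1 <= k0)%N -> exists T : R,
  forall m, \sum_(i < m) time (k0 + i).+2 <= T.
Proof.
move=> Ifin.
(* Chosen so that [q k] is the argument of the quantile in the explosion integral at [y k]; a growth
   factor of the scales becomes the additive gap [h]. *)
pose y k : R := ln (delta * ln 2 * (n k)%:R).
have ln20 : 0 < ln 2 :> R by rewrite ln_gt0// ltr1n.
have a0 : 0 < delta * ln 2 by rewrite mulr_gt0.
have n0 k : 0 < (n k)%:R :> R.
  by rewrite ltr0n; apply: leq_trans (scale_ge K k); rewrite muln_gt0.
have an0 k : 0 < delta * ln 2 * (n k)%:R by rewrite mulr_gt0.
have qE k : q k = expR (- expR (y k)).
  by rewrite lnK ?posrE// mulrAC expR_opp_ln2.
pose h : R := ln (1 + (2 * K%:R)^-1).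
have K20 : 0 < (2 * K%:R)^-1 :> R by rewrite invr_gt0 mulr_gt0// ltr0n.
have h0 : 0 < h by rewrite ln_gt0//; lra.
have yh k : y k + h <= y k.+1.
  have K21 : 0 < 1 + (2 * K%:R)^-1 :> R by rewrite addr_gt0.
  rewrite /y /h -lnM ?posrE// ler_ln ?posrE ?mulr_gt0//.
  by rewrite -mulrA ler_wpM2l ?(ltW a0)// scale_ratio_ge.
(* From this rank on, [delta * ln 2 * n k0.+1] is at least 1, so [y k0.+1] is nonnegative and lies
   in the domain of the integral. *)
exists (Num.truncn (delta * ln 2)^-1) => k0 k10.
have y0 : 0 <= y k0.+1.
  rewrite ln_ge0// mulrC -ler_pdivrMr// mul1r (le_trans (ltW (truncnS_gt _)))//.
  by rewrite ler_nat; apply: leq_trans (scale_ge_id K_gt0 _); rewrite ltnS.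
have yh' i : y (k0 + i).+1 + h <= y (k0 + i.+1).+1 by rewrite addnS.
have y0' : 0 <= y (k0 + 0).+1 by rewrite addn0.
have [T HT] := quantile_sum_bounded lawL_ge0 h0 y0' yh' Ifin.
exists (T + 1) => m.
have geo : \sum_(i < m) 2^-1 ^+ (k0 + i).+2 <= 1 - 2^-1 ^+ m :> R.
  elim: m => [|m IH]; first by rewrite big_ord0 expr0 subrr.
  rewrite big_ord_recr /=.
  have : 2^-1 ^+ (k0 + m).+2 <= 2^-1 ^+ m.+1 :> R.
    by apply: ler_wiXn2l; [lra|lra|rewrite ltnS leqW// leq_addl].
  by rewrite (exprS _ m); lra.
rewrite big_split /=; apply: lerD; last first.
  by apply: (le_trans geo); rewrite gerBl exprn_ge0// invr_ge0.
rewrite (eq_bigr (fun i : 'I_m => quantile lawL (expR (- expR (y (k0 + i.+1).+1))))) => [|i _].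
  exact: HT.
by rewrite qE addnS.
Qed.

Lemma ae_exists_explosion : (explosion_integral lawL < +oo)%E ->
  {ae P, forall w, forall m v, finite_set (gball (R := R) conn m v w)} ->
  {ae P, forall w, exists x, (explosion_time conn L x w < +oo)%E}.
Proof.
move=> Ifin aefin.
have aebad : {ae P, forall w, exists k0, forall k, (k0 <= k)%N -> ~ bad_event k w}.
  apply: Borel_Cantelli; first exact: measurable_bad_event.
  have [C C0 HC] := prob_bad_event.
  rewrite (eq_eseriesr (g := fun k => (fine (P (bad_event k)))%:E)); last first.
    by move=> k _; rewrite fineK_prob//; exact: measurable_bad_event.
  apply: (@nneseries_geometric_lty _ _ C 2^-1) => //.
  - by rewrite invr_lt1 ?unitfE// ltr1n.
  - by move=> k; rewrite prob_ge0 HC.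
have [k1 Hk1] := time_sum_bounded Ifin.
apply: filterS2 aefin aebad => w fin [k0 Hk0].
have [|s [s_inj sadj sL]] := @box_path w (maxn k0 k1).
  by move=> k; rewrite geq_max => /andP[? _]; exact: Hk0.
have [T HT] := Hk1 (maxn k0 k1) (leq_maxr _ _).
exists (s 0%N); apply: le_lt_trans (ltry T).
have L0 e : pairs e -> 0 <= L e w by exact: (sfp_L_ge0 sfp).
apply: (explosion_time_fin L0 erefl) => //.
- by move=> m; apply: le_trans (HT m); apply: ler_sum => i _.
(* An injective sequence cannot stay in a finite ball. *)
- move=> m; apply: contrapT => ns.
  have sB i : gball (R := R) conn m (s 0%N) w (s i).
    by apply: contrapT => nsi; apply: ns; exists i.
  apply: infinite_nat.
  apply: sub_finite_set (finite_preimage (f := s) (in2W s_inj) (fin m (s 0%N))) => i _.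
  exact: sB.
Qed.

End dyadic_boxes.

(** * Convergence of the explosion times *)

Lemma cvg_prob_null {R : realType} {disp : measure_display}
    {Omega : measurableType disp} (P : probability Omega R) (A : (set Omega)^nat) :
  (forall n, measurable (A n)) -> nonincreasing_seq A ->
  {ae P, forall w, exists n, ~ A n w} -> fine (P (A n)) @[n --> \oo] --> (0 : R).
Proof.
move=> mA niA aeA.
have mC n : measurable (~` A n) by exact: measurableC.
have ndC : nondecreasing_seq (fun n => ~` A n).
  by move=> n m nm; apply/subsetPset => w nAn; apply: contra_not nAn; have /subsetPset := niA _ _ nm; apply.
have mU : measurable (\bigcup_n ~` A n) by exact: bigcupT_measurable.
have PU : fine (P (\bigcup_n ~` A n)) = 1.
  suff z : fine (P (~` (\bigcup_n ~` A n))) = 0.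
    by move: z; rewrite probC//; lra.
  rewrite (_ : P _ = 0%E)//; apply/negligibleP; first exact: measurableC.
  apply: negligibleS aeA => w /= nU [n nAn]; apply: nU; by exists n.
rewrite (_ : (fun n => fine (P (A n))) = (fun n => 1 - fine (P (~` A n)))); last first.
  by apply/funext => n; rewrite probC//; lra.
have -> : 0 = 1 - 1 :> R by rewrite subrr.
have c := cvg_prob (P := P) mC ndC; rewrite PU in c.
by apply: cvgB => //; exact: cvg_cst.
Qed.

Lemma ae_prob1 {R : realType} {disp : measure_display}
    {Omega : measurableType disp} (P : probability Omega R) (A : set Omega) :
  measurable A -> P A = 1%E -> {ae P, forall w, A w}.
Proof.
move=> mA PA; apply/negligibleP; first exact: measurableC.
have : P (~` A) = 0%E; last exact.
by rewrite probability_setC// PA subee.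
Qed.

Section lattice_connectivity.
Context {d : nat}.
Notation vertex := 'rV[int]_d.
Context {disp : measure_display} {Omega : measurableType disp}.
Variables (conn : {fset vertex} -> Omega -> bool) (w : Omega).
Hypothesis nn : forall v i, adj conn w v (v + delta_mx ord0 i).

Lemma nearest_neighbour_path (u v : vertex) : exists p, is_path conn w u v p.
Proof.
pose linked x y := exists p, is_path conn w x y p.
have link_trans x y z : linked x y -> linked y z -> linked x z.
  by move=> [p hp] [q hq]; exists (p ++ q); exact: is_path_cat hp hq.
have link_sym x y : linked x y -> linked y x.
  by move=> [p hp]; exists (rev (belast x p)); exact: is_path_rev.
have link_refl x : linked x x by exists [::].
have link_nat x i (n : nat) : linked x (x + n%:Z *: delta_mx ord0 i).
  elim: n => [|n IH]; first by rewrite scale0r addr0.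
  apply: link_trans IH _; exists [:: x + n.+1%:Z *: delta_mx ord0 i].
  split => //=; rewrite andbT intS scalerDl scale1r [delta_mx _ _ + _]addrC addrA; exact: nn.
have link_int x i (z : int) : linked x (x + z *: delta_mx ord0 i).
  case: z => n; first exact: link_nat.
  rewrite NegzE; apply: link_sym.
  by have := link_nat (x + (- n.+1%:Z) *: delta_mx ord0 i) i n.+1; rewrite scaleNr subrK.
have link_sum x (z : vertex) (s : seq 'I_d) :
    linked x (x + \sum_(i <- s) z ord0 i *: delta_mx ord0 i).
  elim: s x => [|i s IH] x; first by rewrite big_nil addr0.
  by rewrite big_cons addrA; apply: link_trans (link_int x i (z ord0 i)) _.
have := link_sum u (v - u) (enum 'I_d).
rewrite big_enum /= [X in u + X](_ : _ = v - u); first by rewrite addrC subrK.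
by rewrite [RHS]row_sum_delta; apply: eq_bigr.
Qed.

End lattice_connectivity.

(* [b * alpha < 2 * D] leaves room for some [rho] between [alpha / 2] (two vertices
   of weight [N ^ rho] at distance [N] are then joined with high probability) and
   [D / b] (a box of side [N] contains many vertices of such weight). *)
Lemma exploding_scales {R : realType} (alpha t D : R) : 0 < alpha -> 0 < t -> 0 < D ->
  1 < alpha * t / D < 2 ->
  exists b rho delta : R, exists K : nat, [/\ t < b, 0 < rho, 0 < delta, (0 < K)%N &
    2 * delta <= D - b * rho /\ alpha + delta <= rho * (2 - K%:R^-1)].
Proof.
move=> a0 t0 D0; rewrite ltr_pdivlMr// ltr_pdivrMr// mul1r => /andP[_ at2].
(* The midpoint between [t] and [2 * D / alpha], in this order because [alpha * t < 2 * D]. Being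
   below the latter, [b] satisfies [alpha / 2 < D / b], and [rho] is the midpoint of these two. *)
pose b := (t + 2 * D / alpha) / 2.
have b1 : t < 2 * D / alpha by rewrite ltr_pdivlMr// mulrC.
have tb : t < b by rewrite /b; lra.
have b0 : 0 < b by exact: lt_trans tb.
have ab : alpha / 2 < D / b.
  rewrite ltr_pdivlMr// mulrAC ltr_pdivrMr// mulrC -ltr_pdivlMr//.
  by rewrite [D * 2]mulrC /b; lra.
pose rho := (alpha / 2 + D / b) / 2.
have rho0 : 0 < rho by rewrite /rho; lra.
have rb : 0 < D - b * rho.
  by rewrite subr_gt0 mulrC -ltr_pdivlMr// /rho; lra.
have ra : 0 < 2 * rho - alpha by rewrite /rho; lra.
pose delta := Num.min ((2 * rho - alpha) / 2) ((D - b * rho) / 2).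
have delta0 : 0 < delta by rewrite lt_min !divr_gt0.
have d1 : delta <= (2 * rho - alpha) / 2 by rewrite ge_min lexx.
have d2 : delta <= (D - b * rho) / 2 by rewrite ge_min lexx orbT.
(* This [K] makes [rho / K] at most [delta], while [2 * rho - alpha] is at least [2 * delta]. *)
exists b, rho, delta, (Num.truncn (rho / delta)).+1; split => //; split; first lra.
rewrite mulrBr; set k : R := (Num.truncn _).+1%:R.
have : rho / k <= delta.
  by rewrite ler_pdivrMr ?ltr0n// mulrC -ler_pdivrMr// ltW// truncnS_gt.
by clearbody k; clearbody delta; clearbody rho; lra.
Qed.

Section explosion.
Context {R : realType} {d : nat} {alpha lambda tau : R} {l : R -> R}
  {lawW lawL : probability R R}
  {disp : measure_display} {Omega : measurableType disp}
  {P : probability Omega R} {W : 'rV[int]_d -> {RV P >-> R}}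
  {conn : {fset 'rV[int]_d} -> {RV P >-> bool}}
  {L : {fset 'rV[int]_d} -> {RV P >-> R}}.
Notation vertex := 'rV[int]_d.
Hypothesis d_gt0 : (1 <= d)%N.
Hypothesis d_lt_alpha : d%:R < alpha.
Hypothesis lambda_gt0 : 0 < lambda.
Hypothesis tau_gt1 : 1 < tau.
Hypothesis lawW_ge1 : lawW `[1, +oo[%classic = 1%E.
Hypothesis l_slow : slowly_varying l.
Hypothesis lawW_tail : forall t : R, 0 < t ->
  lawW `]t, +oo[%classic = (l t / t `^ (tau - 1))%:E.
Hypothesis gamma_itv : 1 < alpha * (tau - 1) / d%:R < 2.
Hypothesis lawL_ge0 : lawL `[0, +oo[%classic = 1%E.
Hypothesis integral_fin : (explosion_integral lawL < +oo)%E.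
Hypothesis sfp : is_SFP alpha lambda lawW lawL W conn L.

Let V := explosion_time conn L.
Let M n x w := dist_to_sphere conn L n x w.

Let mconn e : measurable_fun setT (conn e). Proof. by []. Qed.
Let mL e : measurable_fun setT (L e). Proof. by []. Qed.
Let L_ge0 w e : pairs e -> 0 <= L e w. Proof. exact: (sfp_L_ge0 sfp). Qed.
Let mV x : measurable_fun setT (V x).
Proof. by apply: measurable_explosion_time => // e w; exact: L_ge0. Qed.

Let V_ge0 x w : (0 <= V x w)%E.
Proof. exact: (explosion_time_ge0 conn (@L_ge0 w)). Qed.

Let M_ge0 n x w : (0 <= M n x w)%E.
Proof. exact: (dist_to_sphere_ge0 conn (@L_ge0 w)). Qed.

Let M_le_V n x w : (M n x w <= V x w)%E.
Proof. exact: (dist_to_sphere_le_explosion_time conn (@L_ge0 w)). Qed.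

Let cvg_M x w : M n x w @[n --> \oo] --> V x w.
Proof. exact: (cvg_explosion_time (@L_ge0 w)). Qed.

Lemma ae_nearest_neighbour :
  {ae P, forall w, forall v i, adj conn w v (v + delta_mx ord0 i)}.
Proof.
apply: ae_forall_countable => v; apply: ae_forall_countable => i.
have vi : v != v + delta_mx ord0 i.
  by rewrite -subr_eq0 opprD addNKr oppr_eq0; apply/eqP => /rowP/(_ i); rewrite !mxE !eqxx.
have n1 : enorm (v - (v + delta_mx ord0 i)) = 1 :> R.
  rewrite opprD addNKr enormN /enorm (bigD1 i)//= big1 ?addr0; last first.
    by move=> j ji; rewrite mxE (negbTE ji) andbF expr0n.
  by rewrite mxE !eqxx expr1n sqrtr1.
set C := [set w | conn [fset v; (v + delta_mx ord0 i)%R]%fset w].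
have mC : measurable C.
  rewrite (_ : C = conn [fset v; (v + delta_mx ord0 i)%R]%fset @^-1` [set true])//.
  by rewrite -[X in measurable X]setTI; exact: measurable_funPT.
have PC : P C = 1%E.
  have sT : sigma_family setT (fun x => W x : Omega -> R) setT.
    pose G := \bigcup_(x in [set: vertex]) g_sigma_algebra_preimage (W x).
    exact: (@measurableT _ (g_sigma_algebraType G)).
  rewrite -[C]setTI (prob_conn1 lawW_ge1 sfp vi sT).
  transitivity (\int[P]_(w in setT) (cst 1%E w))%E.
    by apply: eq_integral => w _; rewrite /edges_prob big_seq_fset1 (edge_probE _ _ _ vi) n1 eqxx.
  rewrite integral_cst// mul1e; exact: probability_setT.
apply: filterS (ae_prob1 mC PC) => w Cw; rewrite /adj /= vi; exact: Cw.
Qed.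

Lemma ae_finite_gball_sfp :
  {ae P, forall w, forall n v, finite_set (gball (R := R) conn n v w)}.
Proof.
have /andP[gamma1 _] := gamma_itv.
exact: (ae_finite_gball d_gt0 d_lt_alpha lambda_gt0 tau_gt1 lawW_ge1 l_slow lawW_tail gamma1 sfp).
Qed.

Lemma ae_explosion_time_fin : {ae P, forall w, forall v, (V v w < +oo)%E}.
Proof.
have D0 : 0 < d%:R :> R by rewrite ltr0n.
have a0 : 0 < alpha by exact: lt_trans d_lt_alpha.
have t0 : 0 < tau - 1 by rewrite subr_gt0.
have [b [rho [delta [K [tb rho0 delta0 K0 [h1 h2]]]]]] := exploding_scales a0 t0 D0 gamma_itv.
have b0 : 0 < b by exact: lt_trans tb.
have aeV := ae_exists_explosion d_gt0 lambda_gt0 a0 lawW_ge1 l_slow lawW_tail lawL_ge0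
  sfp K0 rho0 delta0 b0 tb h1 h2 integral_fin ae_finite_gball_sfp.
apply: filterS2 aeV ae_nearest_neighbour => w [x Vx] nn v.
have [p pP] := nearest_neighbour_path nn v x.
apply: (le_lt_trans (explosion_time_le_path (@L_ge0 w) pP)).
by rewrite lte_add_pinfty// ltry.
Qed.

Lemma explosion_time_mixing (A B : set R) : measurable A -> measurable B ->
  fine (P ((fine \o V 0) @^-1` A `&` (fine \o V x) @^-1` B)) @[x --> enorm_infty R d] -->
  fine (P ((fine \o V 0) @^-1` A)) * fine (P ((fine \o V 0) @^-1` B)).
Proof.
move=> mA mB.
pose S A : set (@field_config R d) := (fine \o explosion_time field_conn field_L 0) @^-1` A.
have mS A' : measurable A' -> measurable (S A').
  move=> mA'; rewrite -[X in measurable X]setTI; apply: measurableT_comp => //.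
  apply: measurable_explosion_time.
  - exact: measurable_field_conn.
  - exact: measurable_field_L.
  - exact: field_L_ge0.
have SE x A' : (fine \o V x) @^-1` A' = field (conn := conn) (L := L) x @^-1` S A'.
  by apply/seteqP; split => w; rewrite /S /= /V (explosion_time_field sfp).
have := field_mixing lambda_gt0 lawW_ge1 sfp (mS A mA) (mS B mB).
by rewrite -!SE; under eq_fun do rewrite -SE.
Qed.

(** An infinite [V x w] always makes [w] late, so off this event the explosion time is finite. *)
Let late n x (e : R) : set Omega := [set w | (M n x w + e%:E <= V x w)%E].

Let measurable_late n x e : measurable (late n x e).
Proof.
rewrite -[X in measurable X]setTI; apply: measurable_lee => //.
by apply: emeasurable_funD => //; exact: measurable_dist_to_sphere.
Qed.

Let late_stationary n x e : P (late n x e) = P (late n 0 e).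
Proof.
pose S : set (@field_config R d) :=
  [set c | (dist_to_sphere field_conn field_L n 0 c + e%:E <=
            explosion_time field_conn field_L 0 c)%E].
have mS : measurable S.
  rewrite -[X in measurable X]setTI; apply: measurable_lee.
  - by [].
  - apply: emeasurable_funD => //; apply: measurable_dist_to_sphere.
    + exact: measurable_field_conn.
    + exact: measurable_field_L.
  - apply: measurable_explosion_time.
    + exact: measurable_field_conn.
    + exact: measurable_field_L.
    + exact: field_L_ge0.
have SE y : late n y e = field (conn := conn) (L := L) y @^-1` S.
  apply/seteqP; split => w; rewrite /S /late /= /M /V;
  by rewrite (explosion_time_field sfp) (dist_to_sphere_field sfp).
by rewrite !SE (field_stationary lambda_gt0 lawW_ge1 sfp).
Qed.

Let cvg_late (e : R) : 0 < e -> fine (P (late n 0 e)) @[n --> \oo] --> (0 : R).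
Proof.
move=> e0; apply: cvg_prob_null => //.
  move=> n m nm; apply/subsetPset => w; apply: le_trans; rewrite leeD2r//.
  exact: dist_to_sphere_ndecr (@L_ge0 w) _ _ _ nm.
apply: filterS ae_explosion_time_fin => w /(_ 0) Vfin.
have Vf : V 0 w \is a fin_num by rewrite ge0_fin_numE.
have [n _ /(_ n (leqnn n)) /= Mn] : \forall n \near \oo, (V 0 w - e%:E < M n 0 w)%E.
  have H : nbhs (V 0 w) [set z | V 0 w - e%:E < z]%E.
    apply: open_nbhs_nbhs; split; first exact: open_ereal_gt_ereal.
    have VV : (V 0 w - e%:E < V 0 w)%E by rewrite lteBlDr// lteDl.
    exact: VV.
  exact: (cvg_M H).
by exists n; rewrite /late /= leNgt; apply/negP/negPn; rewrite -lteBlDr.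
Qed.

(** A finite ball is bounded, so the events that the ball about 0 contains a vertex of norm above
    [r] decrease to a null event; for [x] of norm above [r] they contain the event in question. *)
Let cvg_prob_gball m :
  fine (P [set w | gball (R := R) conn m 0 w x]) @[x --> enorm_infty R d] --> (0 : R).
Proof.
pose far r := [set w | exists2 y, r%:R < enorm y :> R & gball (R := R) conn m 0 w y].
have mG y : measurable [set w | gball (R := R) conn m 0 w y] by exact: measurable_gball.
have mfar r : measurable (far r).
  rewrite (_ : far r = \bigcup_(y in [set y | r%:R < enorm y :> R])
      [set w | gball (R := R) conn m 0 w y]).
    rewrite bigcup_mkcond; apply: countable_bigcupT_measurable => // y.
    by case: ifP.
  by apply/seteqP; split => w /= [y]; exists y.
have : fine (P (far r)) @[r --> \oo] --> (0 : R).
  apply: cvg_prob_null => //.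
    move=> r s rs; apply/subsetPset => w [y sy yB]; exists y => //.
    by apply: le_lt_trans sy; rewrite ler_nat.
  apply: filterS ae_finite_gball_sfp => w /(_ m 0) /finite_seqP[s sE].
  pose c : R := \sum_(y <- s) enorm y.
  exists (Num.truncn c).+1 => -[y yc]; rewrite sE => /= ys.
  have : c < enorm y by apply: lt_trans yc; exact: truncnS_gt.
  rewrite ltNge => /negP; apply; rewrite /c (big_rem y)//= lerDl.
  by apply: sumr_ge0 => z _; exact: sqrtr_ge0.
move=> /cvgrPdist_lt cf; apply/cvgrPdist_lt => e e0.
have [r _ /(_ r (leqnn r)) /=] := cf e e0.
rewrite !sub0r !normrN => Pr; exists r%:R => x rx /=.
rewrite sub0r normrN; apply: le_lt_trans Pr.
rewrite !ger0_norm ?prob_ge0//; apply: le_prob => // w wx; by exists x.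
Qed.

(** If neither end is late by [eps / 2] and the graph distance exceeds [n + n], then
    [dist_to_sphereD] excludes a deficit of [eps]. Three events remain to be made unlikely. *)
Lemma cvg_dist_L_lower (eps : R) : 0 < eps ->
  P [set w | (dist_L conn L 0%R x w - (V 0%R w + V x w) < (- eps)%:E)%E]
    @[x --> enorm_infty R d] --> 0%E.
Proof.
move=> eps0; pose E x := [set w | (dist_L conn L 0%R x w - (V 0%R w + V x w) < (- eps)%:E)%E].
have mE x : measurable (E x).
  rewrite -[X in measurable X]setTI; apply: measurable_lte => //.
  apply: emeasurable_funB; first exact: measurable_dist_L.
  exact: emeasurable_funD.
suff : fine (P (E x)) @[x --> enorm_infty R d] --> (0 : R).
  move=> cE; rewrite [X in X @ _ --> _](_ : _ = fun x => (fine (P (E x)))%:E).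
    by apply: cvg_EFin => //; exact: nearW.
  by apply/funext => x; rewrite fineK_prob.
have e2 : 0 < eps / 2 by rewrite divr_gt0.
have sub n x : E x `<=` late n 0 (eps / 2) `|` late n x (eps / 2) `|`
    [set w | gball (R := R) conn (n + n) 0 w x].
  move=> w Ew; apply: contrapT => /not_orP[/not_orP[]].
  rewrite /late /= => /negP; rewrite -ltNge => l0 /negP; rewrite -ltNge => lx nx.
  have nx' : ~ gball (R := R) conn (n + n) 0 w x := nx.
  have := @dist_to_sphereD _ _ _ _ conn L w (@L_ge0 w) _ _ _ nx'; rewrite -/(M n 0 w) -/(M n x w) => MM.
  have Vf y : (V y w < M n y w + (eps / 2)%:E)%E -> V y w \is a fin_num.
    move=> ly; rewrite ge0_fin_numE//.
    by apply: (lt_le_trans ly); rewrite leey.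
  have V0f := Vf _ l0; have Vxf := Vf _ lx.
  move: Ew; rewrite /E /= lteBlDr ?fin_numD ?V0f// => Ew.
  have := le_lt_trans MM Ew.
  have Mf y : V y w \is a fin_num -> M n y w \is a fin_num.
    move=> Vyf; rewrite ge0_fin_numE//; apply: le_lt_trans (M_le_V _ _ _) _.
    by rewrite -ge0_fin_numE.
  move: l0 lx; rewrite -(fineK V0f) -(fineK Vxf) -(fineK (Mf _ V0f)) -(fineK (Mf _ Vxf)).
  rewrite -!EFinD !lte_fin; lra.
apply/cvgrPdist_lt => e e0.
have e3 : 0 < e / 3 by rewrite divr_gt0.
(* [n] is fixed from the vertex 0 alone; [late_stationary] transfers the bound to every [x]. *)
have [n _ /(_ n (leqnn n)) /=] : \forall n \near \oo, fine (P (late n 0 (eps / 2))) < e / 3.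
  by apply: (cvgr_lt _ (cvg_late e2)).
move=> Pn; near=> x.
have Px : fine (P [set w | gball (R := R) conn (n + n) 0 w x]) < e / 3.
  by near: x; apply: (cvgr_lt _ (@cvg_prob_gball (n + n))).
rewrite sub0r normrN ger0_norm ?prob_ge0//.
have mG : measurable [set w | gball (R := R) conn (n + n) 0 w x] by exact: measurable_gball.
have mLL : measurable (late n 0 (eps / 2) `|` late n x (eps / 2)) by exact: measurableU.
apply: le_lt_trans (le_prob P (mE x) (measurableU _ _ mLL mG) (@sub n x)) _.
apply: le_lt_trans (le_prob_setU P mLL mG) _.
have := le_prob_setU P (measurable_late n 0 (eps / 2)) (measurable_late n x (eps / 2)).
by rewrite (late_stationary n x); lra.
Unshelve. all: by end_near. Qed.

End explosion.

Theorem theorem1p7 (R : realType) (d : nat) (alpha lambda tau : R) (l : R -> R)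
    (lawW lawL : probability R R)
    (disp : measure_display) (Omega : measurableType disp)
    (P : probability Omega R)
    (W : 'rV[int]_d -> {RV P >-> R})
    (conn : {fset 'rV[int]_d} -> {RV P >-> bool})
    (L : {fset 'rV[int]_d} -> {RV P >-> R}) :
  (1 <= d)%N -> d%:R < alpha -> 0 < lambda -> 1 < tau ->
  lawW `[1, +oo[%classic = 1%E ->
  slowly_varying l ->
  (forall t : R, 0 < t -> lawW `]t, +oo[%classic = (l t / t `^ (tau - 1))%:E) ->
  1 < alpha * (tau - 1) / d%:R < 2 ->
  lawL `[0, +oo[%classic = 1%E ->
  (explosion_integral lawL < +oo)%E ->
  is_SFP alpha lambda lawW lawL W conn L ->
  let V := explosion_time conn L in
  (forall (disp' : measure_display) (Omega' : measurableType disp')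
     (P' : probability Omega' R) (V1 V2 : {RV P' >-> R}),
     independent_copies P (fine \o V 0) V1 V2 ->
     cvg_in_distribution P (enorm_infty R d)
       (fun x w => (fine (V 0 w), fine (V x w)))
       P' (fun w => (V1 w, V2 w))) /\
  (forall eps : R, 0 < eps ->
     P [set w | (dist_L conn L 0%R x w - (V 0%R w + V x w) < (- eps)%:E)%E]
       @[x --> enorm_infty R d] --> 0%E).
Proof.
move=> d_gt0 d_lt_alpha lambda_gt0 tau_gt1 lawW_ge1 l_slow lawW_tail gamma_itv
  lawL_ge0 integral_fin sfp V; split; last first.
  exact: (cvg_dist_L_lower d_gt0 d_lt_alpha lambda_gt0 tau_gt1 lawW_ge1 l_slow
    lawW_tail gamma_itv lawL_ge0 integral_fin sfp).
move=> disp' Omega' P' V1 V2 copies.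
have mV x : measurable_fun setT (fine \o V x).
  apply: measurableT_comp => //; apply: measurable_explosion_time => // e w.
  exact: (sfp_L_ge0 sfp).
apply: (cvg_in_distribution_mixing (X0 := fine \o V 0) (X := fun x => fine \o V x)) => //.
exact: (explosion_time_mixing lambda_gt0 lawW_ge1 sfp).
Qed.
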